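(* Let $d\geq 4$. For any $g\in \mathrm{GL}_d(\mathbb{R})$ there is a constant $c=c(g)>0$ such that for all $T\geq 2$ $$\int_{U_{d,l}(\mathbb{Z})\backslash U_{d,l}(\mathbb{R})}|\mathcal{R}_{B_T}(\mathbb{Z}^d u g)|^2\,du\leq c\,T^{d-1}\log^2(T),$$ for any integer $1\leq l\leq [d/2]$, where $[\cdot]$ denotes the integer part and $du$ is Lebesgue measure on $U_{d,l}(\mathbb{R})$.
   Context: $U_d<\mathrm{GL}_d$ is the group of unipotent upper triangular matrices (ones on the diagonal). For $1\le l\le d-1$, $U_{d,l}\leq U_d$ is the subgroup of matrices having zeros above the diagonal in the leftmost $l$ columns (so $U_{d,1}=U_d$). $U_{d,l}(\mathbb{R})$ is identified with a Euclidean space via the free above-diagonal entries (those in columns $l+1,\dots,d$), and the integral over the quotient is over a fundamental domain, e.g. all these entries in $[0,1)$. Vectors are row vectors, and $\mathbb{Z}^d h=\{nh: n\in\mathbb{Z}^d\}$ for $h\in \mathrm{GL}_d(\mathbb{R})$. $B_T=\{v\in\mathbb{R}^d:\|v\|<T\}$ is the Euclidean ball of radius $T$ centered at the origin. For a lattice $\Lambda\subset\mathbb{R}^d$, $$\mathcal{R}_{B_T}(\Lambda)=\#(\Lambda\cap B_T)-\frac{\mathrm{vol}(B_T)}{\mathrm{vol}(\mathbb{R}^d/\Lambda)}.$$ *)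

(* Defs.v *)
From HB Require Import structures.
From mathcomp Require Import all_boot all_order all_algebra.
From mathcomp Require Import finmap.
From mathcomp Require Import all_classical all_reals all_analysis.

Set Implicit Arguments.
Unset Strict Implicit.
Unset Printing Implicit Defensive.

Import Order.TTheory GRing.Theory Num.Theory.
Import numFieldNormedType.Exports.

Local Open Scope classical_set_scope.
Local Open Scope ring_scope.

Notation Rtuple R n := (n.-tuple (measurableTypeR R)).

Section lebesgue_cons.
Local Open Scope ereal_scope.
Context (R : realType) (n : nat).
Variable m : {sigma_finite_measure set (Rtuple R n) -> \bar R}.

Definition tuple_of_pair (p : measurableTypeR R * Rtuple R n) : Rtuple R n.+1 :=
  [the Rtuple R n.+1 of p.1 :: p.2].

Lemma measurable_tuple_of_pair : measurable_fun [set: _] tuple_of_pair.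
Proof.
by apply: (measurable_cons (f := fst) (g := snd));
  [exact: measurable_fst | exact: measurable_snd].
Qed.

Definition lebesgue_cons : set (Rtuple R n.+1) -> \bar R :=
  pushforward (@lebesgue_measure R \x m) tuple_of_pair.

Let mpre (A : set (Rtuple R n.+1)) :
  measurable A -> measurable (tuple_of_pair @^-1` A).
Proof.
by move=> mA; rewrite -[X in measurable X]setTI; exact: measurable_tuple_of_pair.
Qed.

Let lebesgue_cons0 : lebesgue_cons set0 = 0.
Proof. by rewrite /lebesgue_cons /pushforward preimage_set0 measure0. Qed.

Let lebesgue_cons_ge0 A : 0 <= lebesgue_cons A.
Proof. by rewrite /lebesgue_cons /pushforward; apply: integral_ge0 => x _. Qed.

Let lebesgue_cons_sigma_additive : semi_sigma_additive lebesgue_cons.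
Proof.
move=> F mF tF mUF; rewrite /lebesgue_cons /pushforward preimage_bigcup.
apply: (@measure_semi_sigma_additive _ _ _ (@lebesgue_measure R \x m)).
- by move=> k; exact: mpre.
- apply/trivIsetP => /= i j _ _ ij; rewrite -preimage_setI.
  by move/trivIsetP : tF => /(_ _ _ _ _ ij) ->//; rewrite preimage_set0.
- by rewrite -preimage_bigcup; exact: mpre.
Qed.

HB.instance Definition _ := isMeasure.Build _ _ _ lebesgue_cons
  lebesgue_cons0 lebesgue_cons_ge0 lebesgue_cons_sigma_additive.

Let lebesgue_cons_sigma_finite : sigma_finite [set: Rtuple R n.+1] lebesgue_cons.
Proof.
have /sigma_finiteP[F [FT ndF Foo]] := sigma_finiteT (@lebesgue_measure R).
have /sigma_finiteP[G [GT ndG Goo]] := sigma_finiteT m.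
pose u (t : Rtuple R n.+1) : measurableTypeR R * Rtuple R n :=
  (thead t, [tuple of behead t]).
have mu : measurable_fun [set: _] u.
  apply/measurable_fun_pairP; split; first exact: measurable_tnth.
  exact: measurable_behead.
have uK p : u (tuple_of_pair p) = p.
  case: p => x y; rewrite /u theadE; apply: (congr1 (pair x)); exact: val_inj.
exists (fun k => u @^-1` (F k `*` G k)).
  rewrite -preimage_bigcup (_ : \bigcup_k _ = setT); first exact/esym/preimage_setT.
  rewrite -setXTT FT GT predeqE => -[x y]; split.
    by move=> [k _ []/= ? ?]; split; exists k.
  move=> [/= [i _ Fix] [j _ Gjy]]; exists (maxn i j) => //; split.
  - by move: x Fix; exact/subsetPset/ndF/leq_maxl.
  - by move: y Gjy; exact/subsetPset/ndG/leq_maxr.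
move=> k; have [mF Fk] := Foo k; have [mG Gk] := Goo k; split.
  rewrite -[X in measurable X]setTI; apply: mu => //; exact: measurableX.
rewrite /lebesgue_cons /pushforward -comp_preimage.
rewrite (_ : u \o tuple_of_pair = id); last by apply/funext => p /=; rewrite uK.
by rewrite preimage_id product_measure1E// lte_mul_pinfty// ge0_fin_numE.
Qed.

HB.instance Definition _ := Measure_isSigmaFinite.Build _ _ _ lebesgue_cons
  lebesgue_cons_sigma_finite.

End lebesgue_cons.

(* Lebesgue measure on R^n as an iterated product, R^n.+1 = R * R^n; see
   [lebesgue_tuple_box] for its values on boxes. *)
Fixpoint lebesgue_tuple (R : realType) (n : nat) :
    {sigma_finite_measure set (Rtuple R n) -> \bar R} :=
  match n with
  | 0 => [the {sigma_finite_measure set (Rtuple R 0) -> \bar R} of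
          dirac ([tuple] : Rtuple R 0)]
  | n'.+1 => [the {sigma_finite_measure set (Rtuple R n'.+1) -> \bar R} of
          lebesgue_cons (lebesgue_tuple R n')]
  end.

Lemma measurable_tuple_box (R : realType) (n : nat)
    (A : 'I_n -> set (measurableTypeR R)) : (forall i, measurable (A i)) ->
  measurable [set t : Rtuple R n | forall i, A i (tnth t i)].
Proof.
move=> mA; rewrite (_ : [set t | _] =
    \big[setI/setT]_(i < n) ((fun t : Rtuple R n => tnth t i) @^-1` A i)).
  apply: bigsetI_measurable => i _.
  by rewrite -[X in measurable X]setTI; exact: measurable_tnth.
apply/seteqP; split=> t /=; rewrite -bigcap_seq/=.
  by move=> At i _; exact: At.
by move=> At i; apply: At; rewrite /= mem_index_enum.
Qed.

Lemma lebesgue_tuple_box (R : realType) (n : nat)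
    (A : 'I_n -> set (measurableTypeR R)) : (forall i, measurable (A i)) ->
  lebesgue_tuple R n [set t | forall i, A i (tnth t i)] =
  (\prod_(i < n) lebesgue_measure (A i))%E.
Proof.
elim: n A => [|n IH] A mA.
  by rewrite big_ord0 /= /dirac indicE mem_set// => -[].
rewrite big_ord_recl -(IH (fun i => A (lift ord0 i)))//.
rewrite /= /lebesgue_cons /pushforward -product_measure1E//; last first.
  exact: (measurable_tuple_box (A := fun i => A (lift ord0 i))).
congr (_ _); apply/seteqP; split=> -[x t] /=.
  move=> At; split=> [|i]; first exact: (At ord0).
  by have := At (lift ord0 i); rewrite tnthS.
move=> [Ax At] i; case: (unliftP ord0 i) => [j ->|->]; last exact: Ax.
by rewrite tnthS; exact: At.
Qed.

Section lattices.
Context (R : realType) (d : nat).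
Implicit Types (A B F L : set 'rV[R]_d) (t : Rtuple R d).

Definition rV_of_tuple t : 'rV[R]_d := \row_i tnth t i.

(* Lebesgue measure and Borel sets, for sets of row vectors. *)
Definition vol A : \bar R := lebesgue_tuple R d (rV_of_tuple @^-1` A).
Definition borel A : Prop := measurable (rV_of_tuple @^-1` A).

(* The norm [`|v|] of row vectors provided by the library is the sup norm. *)
Definition euclidean_norm (v : 'rV[R]_d) : R := Num.sqrt (\sum_i v 0 i ^+ 2).

Definition eball (T : R) : set 'rV[R]_d := [set v | euclidean_norm v < T].

Definition Zlattice (h : 'M[R]_d) : set 'rV[R]_d :=
  [set map_mx intr n *m h | n in [set: 'rV[int]_d]].

(* F is a Borel set meeting every class v + L in exactly one point. *)
Definition fundamental_domain L F : Prop :=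
  borel F /\ forall v, exists! x, F x /\ L (x - v).

(* vol(R^d / L), as the volume of a fundamental domain of L. For a lattice
   all fundamental domains have the same finite positive volume, so that the
   one picked by [xget] is irrelevant. *)
Definition covolume L : R := fine (vol (xget set0 (fundamental_domain L))).

(* The intersection of a lattice and a bounded set is finite, hence it is
   faithfully represented by [fset_set]. *)
Definition remainder B L : R :=
  #|` fset_set (L `&` B)|%:R - fine (vol B) / covolume L.

End lattices.

(* The group U_{d,l}(K). Columns are numbered from 0, the leftmost l columns
   being those of index j < l. *)
Definition unipotent (K : nzRingType) (d l : nat) : set 'M[K]_d :=
  [set u | [/\ forall i, u i i = 1,
               forall i j : 'I_d, (j < i)%N -> u i j = 0 &
               forall i j : 'I_d, (i < j)%N -> (j < l)%N -> u i j = 0]].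
Arguments unipotent K {d} l.

Definition free_entry (d l : nat) : Type :=
  {ij : 'I_d * 'I_d | (ij.1 < ij.2)%N && (l <= ij.2)%N}.

Definition nfree (d l : nat) : nat := #|{: free_entry d l}|.

Section unipotent_coordinates.
Context (R : realType) (d l : nat).
Implicit Types (t : Rtuple R (nfree d l)) (u : 'M[R]_d).

Definition unipotent_mx t : 'M[R]_d := \matrix_(i, j)
  if i == j then 1
  else if insub (i, j) is Some k then tnth t (enum_rank (k : free_entry d l))
  else 0.

Definition unit_box : set (Rtuple R (nfree d l)) :=
  [set t | forall k, 0 <= tnth t k < 1].

(* The integral over U_{d,l}(Z) \ U_{d,l}(R), with respect to Lebesgue measure
   in the free entries, of a left U_{d,l}(Z)-invariant function f. *)
Definition integral_quotient (f : 'M[R]_d -> \bar R) : \bar R :=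
  (\int[lebesgue_tuple R (nfree d l)]_(t in unit_box) f (unipotent_mx t))%E.

Lemma unipotent_mx_free t (k : free_entry d l) :
  unipotent_mx t (val k).1 (val k).2 = tnth t (enum_rank k).
Proof.
rewrite mxE; case: eqP => [e|_].
  by have := valP k; rewrite e ltnn.
by rewrite -surjective_pairing valK.
Qed.

Lemma unipotent_mxP t : unipotent R l (unipotent_mx t).
Proof.
split=> [i|i j ji|i j ij jl]; rewrite mxE ?eqxx//.
  by rewrite gt_eqF ?insubF//= ltnNge (ltnW ji).
by rewrite lt_eqF ?insubF//= ij leqNgt jl.
Qed.

Lemma unipotent_mx_bij :
  set_bij [set: Rtuple R (nfree d l)] (unipotent R l) unipotent_mx.
Proof.
split=> [t _|t1 t2 _ _ e|u [u1 uL uF]]; first exact: unipotent_mxP.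
- apply: eq_from_tnth => k; rewrite -(enum_valK k) -!unipotent_mx_free.
  by rewrite e.
- exists [tuple (u (val (enum_val k)).1 (val (enum_val k)).2
                 : measurableTypeR R) | k < nfree d l] => //.
  apply/matrixP => i j; rewrite mxE; case: eqP => [->|/eqP ij]; first by rewrite u1.
  case: insubP => [k _ kE|].
    by rewrite tnth_mktuple enum_rankK kE.
  rewrite negb_and -leqNgt -ltnNge /= leq_eqVlt => /orP[/orP[/eqP e|ji]|jl].
  - by rewrite (val_inj e) eqxx in ij.
  - by rewrite uL.
  - case: (ltngtP i j) => [ij'|ji|/val_inj e]; [by rewrite uF|by rewrite uL|].
    by rewrite e eqxx in ij.
Qed.

Lemma unipotent_mx_unit_boxP u : unipotent R l u ->
  (unipotent_mx @` unit_box) u <->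
  (forall i j : 'I_d, (i < j)%N -> 0 <= u i j < 1).
Proof.
move=> Uu; split=> [[t tB <-] i j ij|uB].
  have [_ _ uF] := unipotent_mxP t.
  have [jl|lj] := ltnP j l; first by rewrite uF// lexx ltr01.
  have kP : ((i, j).1 < (i, j).2)%N && (l <= (i, j).2)%N by rewrite /= ij.
  by rewrite (unipotent_mx_free t (Sub (i, j) kP)) tB.
have [_ _ surj] := unipotent_mx_bij.
have [t _ tu] := surj _ Uu; exists t => // k.
rewrite -(enum_valK k) -unipotent_mx_free tu uB//.
by have /andP[] := valP (enum_val k).
Qed.

(* The image of the unit box is a fundamental domain of U_{d,l}(Z) acting on
   U_{d,l}(R) by left multiplication. *)
Lemma unit_box_fundamental u : unipotent R l u ->
  exists! z : 'M[int]_d, unipotent int l z /\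
    (unipotent_mx @` unit_box) (map_mx intr z *m u).
Proof.
move=> [u1 uL uF].
have mulE (z : 'M[int]_d) (i j : 'I_d) : (map_mx intr z *m u) i j =
    (z i j)%:~R + \sum_(k < d | (k < j)%N) (z i k)%:~R * u k j.
  rewrite mxE (bigD1 j)//= u1 mulr1 mxE; congr (_ + _).
  rewrite (bigID (fun k : 'I_d => (k < j)%N))/= [X in _ + X]big1 ?addr0.
    apply: eq_big => [k|k _]; last by rewrite mxE.
    by rewrite andb_idl// => kj; rewrite lt_eqF.
  move=> k /andP[kj]; rewrite -leqNgt leq_eqVlt => /orP[/eqP e|jk].
    by rewrite (val_inj e) eqxx in kj.
  by rewrite uL// mulr0.
have mulU (z : 'M[int]_d) : unipotent int l z ->
    unipotent R l (map_mx intr z *m u).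
  move=> [z1 zL zF]; split=> [i|i j ji|i j ij jl]; rewrite mulE.
  - rewrite z1 big1 ?addr0// => k ki.
    by rewrite zL// mul0r.
  - rewrite zL// big1 ?addr0// => k kj.
    by rewrite zL ?mul0r// (ltn_trans kj).
  - rewrite zF// (bigD1 i)//= z1 uF// mulr0 !add0r big1// => k /andP[kj ki].
    by rewrite uF// mulr0.
have boxP (z : 'M[int]_d) : unipotent int l z ->
    (unipotent_mx @` unit_box) (map_mx intr z *m u) <->
    (forall i j : 'I_d, (i < j)%N -> 0 <= (map_mx intr z *m u) i j < 1).
  by move=> zU; apply: unipotent_mx_unit_boxP; exact: mulU.
have [z [zU zB]] : exists z : 'M[int]_d, unipotent int l z /\
    forall i j : 'I_d, (i < j)%N -> (j < d)%N ->
      0 <= (map_mx intr z *m u) i j < 1.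
  suff H : forall m, (m <= d)%N -> exists z : 'M[int]_d, unipotent int l z /\
      forall i j : 'I_d, (i < j)%N -> (j < m)%N ->
        0 <= (map_mx intr z *m u) i j < 1.
    exact: H.
  elim=> [_|m IH md].
    exists 1%:M; split => //; split=> [i|i j ji|i j ij _]; rewrite mxE ?eqxx//.
      by rewrite gt_eqF.
    by rewrite lt_eqF.
  have [z [zU zB]] := IH (ltnW md).
  pose w := map_mx intr z *m u; have [w1 wL wF] : unipotent R l w := mulU _ zU.
  pose m' := Ordinal md.
  pose f (i : 'I_d) : int := if (i < m)%N then Num.floor (w i m') else 0.
  pose z' : 'M[int]_d := \matrix_(i, j) (z i j - f i * z m' j).
  have wE i j : (map_mx intr z' *m u) i j = w i j - (f i)%:~R * w m' j.
    rewrite !mxE mulr_sumr -sumrB; apply: eq_bigr => k _.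
    by rewrite !mxE rmorphB rmorphM/= mulrBl mulrA.
  have [z1 zL zF] := zU.
  exists z'; split.
    split=> [i|i j ji|i j ij jl]; rewrite mxE.
    - rewrite z1 /f; case: ifPn => im; last by rewrite mul0r subr0.
      by rewrite (zL m' i)// mulr0 subr0.
    - rewrite zL// /f; case: ifPn => im; last by rewrite mul0r subr0.
      by rewrite (zL m' j) ?mulr0 ?subr0// (ltn_trans ji).
    - rewrite zF// /f; case: ifPn => im; last by rewrite mul0r subr0.
      have [lm|ml] := ltnP m l; first by rewrite wF// floor0 mul0r subr0.
      by rewrite (zL m' j) ?mulr0 ?subr0//= (leq_trans jl).
  move=> i j ij; rewrite ltnS leq_eqVlt wE => /orP[/eqP jm|jm].
    have -> : j = m' by exact: val_inj.
    have im : (i < m)%N by rewrite -jm.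
    rewrite w1 mulr1 /f im subr_ge0 ltrBlDl Num.Theory.floor_le/=.
    by have := floorD1_gt (w i m'); rewrite intrD.
  by rewrite (wL m' j)// mulr0 subr0 zB.
exists z; split; first by split => //; apply/boxP => // i j ij; exact: zB.
move=> z' [z'U] /(boxP _ z'U) z'B; have [z1 zL zF] := zU.
have [z'1 z'L z'F] := z'U.
apply/matrixP => i j; move: {2}(nat_of_ord j).+1 (ltnSn j) => m.
elim: m j => // m IH j jm.
case: (ltngtP i j) => [ij|ji|/val_inj <-]; last 2 first.
- by rewrite zL ?z'L.
- by rewrite z1 z'1.
have := z'B i j ij; have := zB i j ij (ltn_ord j); rewrite !mulE.
under eq_bigr => k kj do rewrite IH ?(leq_trans kj)//.
set S := \sum_(_ < _ | _) _ => /andP[a0 a1] /andP[b0 b1].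
have ab : (z i j < z' i j + 1)%R.
  rewrite -(@ltr_int R) intrD -(ltrD2r S) (lt_le_trans a1)//.
  by rewrite -addrA (addrC 1) addrA lerDr.
have ba : (z' i j < z i j + 1)%R.
  rewrite -(@ltr_int R) intrD -(ltrD2r S) (lt_le_trans b1)//.
  by rewrite -addrA (addrC 1) addrA lerDr.
by apply/eqP; rewrite eq_le -!ltzD1 ab ba.
Qed.

End unipotent_coordinates.

(* Main.v *)
Require Import Defs.
From HB Require Import structures.
From mathcomp Require Import all_boot all_order all_algebra.
From mathcomp Require Import finmap.
From mathcomp Require Import all_classical all_reals all_analysis.
From mathcomp Require Import measurable_realfun.
From mathcomp Require Import ring lra zify.

Set Implicit Arguments.
Unset Strict Implicit.
Unset Printing Implicit Defensive.

Import Order.TTheory GRing.Theory Num.Theory.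
Import numFieldNormedType.Exports.

Local Open Scope classical_set_scope.
Local Open Scope ring_scope.

(** Why the bound holds. Write g = b k^T with b upper triangular and k
    orthogonal. The ball is round, so one counts the points n u b, n integral,
    rather than the points n u g. As u b is upper triangular, the coordinate j
    of n u b is b_jj (n_j + x), where x depends on n_0, ..., n_(j-1) only; and
    the entries of column j of u enter x linearly, with the integral slopes
    n_0, ..., n_(j-1).

    Let S_j be the count in which n_0, ..., n_(j-1) run over the integers while
    the sum over the remaining n_i is replaced by an integral ([partial_count]).
    Then S_d is the number of lattice points in the ball, S_0 is vol(B_T)
    divided by the covolume ([remainderE]), and the remainder is
    (S_l - S_0) + sum over l <= j < d of (S_(j+1) - S_j).

    The term S_l - S_0 does not depend on u, whose first l columns are those of
    the identity. It compares the sum over a fixed lattice of R^l of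
    (T^2 - |y|^2)_+^((d-l)/2) with the integral of that function. Its Fourier
    transform decays like |xi|^(-(d+1)/2), which is summable in dimension
    l <= d/2, and Poisson summation yields O(T^((d-1)/2)) ([lattice_sum],
    [first_count]). Poisson summation itself is done with products of Fejer
    kernels, that is with finite trigonometric sums, for which bounds on the
    Fourier integrals suffice ([poisson_bound]); the decay of the latter is that
    of a Bessel function ([bcos_bound]).

    The term S_(j+1) - S_j is a sum over n' = (n_0, ..., n_(j-1)) of the errors
    ([zerr]) made by integrating over n_j instead of summing. Such an error is
    periodic in x and satisfies |sum over i < N of E(x + i/N)| <= K uniformly in
    N, with K^2 = O(T^(d-1-j)), because that sum is the error for a step N times
    smaller ([zerr_avg]). In the mean square over u, consider the correlation
    of the terms of n' and n''. The integral over column j is invariant under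
    all translations of that column ([integral_cube_shift]). If n' and n'' are
    not parallel, or if just one of them is 0, translations move the argument of one error through the
    points i/N for any N while fixing that of the other, so that the
    correlation is smaller than any positive bound. If n' = a q and n'' = c q
    with a and c coprime and nonzero, the two arguments can be moved independently
    through the points i/|c| and i'/|a|, so that the correlation is at most
    K^2 / |a c| ([column_err_correlation], [column_err_pair]). There are
    O(T^j) vectors q, and a, c are O(T), whence a total of
    O(T^(d-1-j) T^j log^2 T) ([column_err_square_sum], [column_bound]). *)

(** * Integration over row vectors *)
Section image_measure.
Local Open Scope ereal_scope.
Context d1 d2 (X : measurableType d1) (Y : measurableType d2) (R : realType).
Context (mu : {measure set X -> \bar R}) (nu : {measure set Y -> \bar R}).
Context (phi : X -> Y) (mphi : measurable_fun [set: X] phi) (k : {nonneg R}).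
Hypothesis munu : forall A, measurable A -> mu (phi @^-1` A) = k%:num%:E * nu A.

Lemma ge0_integral_image (f : Y -> \bar R) :
  measurable_fun [set: Y] f -> (forall y, 0 <= f y) ->
  \int[mu]_x f (phi x) = k%:num%:E * \int[nu]_y f y.
Proof.
move=> mf f0.
have := ge0_integral_pushforward mphi mu measurableT mf (in1W f0).
rewrite preimage_setT => <-.
rewrite -ge0_integral_mscale//; apply: eq_measure_integral => A mA _.
by rewrite /= /pushforward munu.
Qed.

End image_measure.

Section affine.
Local Open Scope ereal_scope.
Context (R : realType).
Notation leb := (@lebesgue_measure R).

Lemma measurable_affine (a b : R) :
  measurable_fun setT (fun x : measurableTypeR R => (a * x + b)%R : measurableTypeR R).
Proof.
by apply: measurable_funD => //; apply: measurable_funM.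
Qed.

Lemma lebesgue_affine (a b : R) (A : set (measurableTypeR R)) : a != 0%R ->
  measurable A -> leb ((fun x => a * x + b)%R @^-1` A) = (`|a|^-1)%:E * leb A.
Proof.
move=> a0 mA.
pose k : {nonneg R} := NngNum (normr_ge0 a).
have mphi := measurable_affine a b.
pose nu := [the {measure set (measurableTypeR R) -> \bar R} of mscale k
  (measure_function_pushforward__canonical__measure_function_Measure leb mphi)].
have -> : leb A = nu A.
  apply: (lebesgue_measure_unique (mu := nu)) => //= _ [[s t] _ <-] /=.
  rewrite lebesgue_measure_itv/= /mscale/= /pushforward.
  have [a_gt0|a_lt0|] := ltgtP 0%R a; last by move=> e; rewrite -e eqxx in a0.
    rewrite (_ : _ @^-1` _ = `]((s - b) / a)%R, ((t - b) / a)%R]%classic); last first.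
      apply/seteqP; split=> x /=; rewrite !in_itv/= ltr_pdivrMr// ler_pdivlMr//;
        by rewrite ltrBlDr lerBrDr (mulrC x).
    rewrite [in RHS]lebesgue_measure_itv/= !lte_fin ltr_pM2r ?invr_gt0// ltrD2r.
    case: ifPn => // _; last by rewrite mule0.
    by rewrite -!EFinB -EFinM gtr0_norm//; congr (_%:E); field.
  rewrite (_ : _ @^-1` _ = `[((t - b) / a)%R, ((s - b) / a)%R[%classic); last first.
    apply/seteqP; split=> x /=; rewrite !in_itv/= ltr_ndivlMr// ler_ndivrMr//;
      by rewrite ltrBlDr lerBrDr (mulrC x) andbC.
  rewrite [in RHS]lebesgue_measure_itv/= !lte_fin ltr_nM2r ?invr_lt0// ltrD2r.
  case: ifPn => // _; last by rewrite mule0.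
  by rewrite -!EFinB -EFinM ltr0_norm//; congr (_%:E); field.
rewrite /nu /mscale /= /pushforward muleA -EFinM mulVf ?normr_eq0// mul1e//.
Qed.

Lemma ge0_integral_affine (a b : R) (f : R -> \bar R) : a != 0%R ->
  measurable_fun [set: measurableTypeR R] f -> (forall x, 0 <= f x) ->
  \int[leb]_x f (a * x + b)%R = (`|a|^-1)%:E * \int[leb]_x f x.
Proof.
move=> a0 mf f0.
have k0 : (0 <= `|a|^-1)%R by rewrite invr_ge0.
apply: (ge0_integral_image (measurable_affine a b) (k := NngNum k0)) => // A mA.
exact: lebesgue_affine.
Qed.

End affine.

Section tuple_measure.
Local Open Scope ereal_scope.
Context (R : realType).
Notation leb := (@lebesgue_measure R).
Notation lam n := (lebesgue_tuple R n).

Lemma integral_lebesgue_tuple0 (f : Rtuple R 0 -> \bar R) :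
  measurable_fun setT f ->
  \int[lam 0]_t f t = f [tuple].
Proof. by move=> mf; rewrite integral_dirac// diracT mul1e. Qed.

Lemma ge0_integral_lebesgue_tupleS n (f : Rtuple R n.+1 -> \bar R) :
  measurable_fun setT f -> (forall t, 0 <= f t) ->
  \int[lam n.+1]_t f t =
  \int[leb]_x \int[lam n]_t f [the Rtuple R n.+1 of x :: t].
Proof.
move=> mf f0.
have mt := @measurable_tuple_of_pair R n.
have := ge0_integral_pushforward mt (leb \x lam n)%E measurableT mf (in1W f0).
rewrite preimage_setT => H.
transitivity (\int[(leb \x lam n)%E]_x (f \o tuple_of_pair (n:=n)) x).
  by rewrite -H; apply: eq_measure_integral.
rewrite fubini_tonelli1//; [exact: measurableT_comp|by move=> x /=].
Qed.

End tuple_measure.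

Section row_cons.
Context (T : Type).

Definition row_cons n (x : T) (v : 'rV[T]_n) : 'rV[T]_n.+1 :=
  \row_i oapp (v 0) x (unlift ord0 i).

Lemma row_cons0 n x (v : 'rV[T]_n) : row_cons x v 0 ord0 = x.
Proof. by rewrite mxE unlift_none. Qed.

Lemma row_consS n x (v : 'rV[T]_n) i : row_cons x v 0 (lift ord0 i) = v 0 i.
Proof. by rewrite mxE liftK. Qed.

Lemma row_consP n (v : 'rV[T]_n.+1) :
  v = row_cons (v 0 ord0) (\row_i v 0 (lift ord0 i)).
Proof.
apply/rowP => i; case: (unliftP ord0 i) => [j ->|->].
  by rewrite row_consS mxE.
by rewrite row_cons0.
Qed.

End row_cons.

Section row_vectors.
Context (R : realType).
Notation leb := (@lebesgue_measure R).
Notation lam n := (lebesgue_tuple R n).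
Notation rv := (@rV_of_tuple R _).

Definition tuple_of_rV n (v : 'rV[R]_n) : Rtuple R n :=
  [tuple (v 0 i : measurableTypeR R) | i < n].

Lemma tuple_of_rVK n : cancel (@tuple_of_rV n) rv.
Proof. by move=> v; apply/rowP => i; rewrite mxE tnth_mktuple. Qed.

Lemma rV_of_tupleK n : cancel rv (@tuple_of_rV n).
Proof. by move=> t; apply: eq_from_tnth => i; rewrite tnth_mktuple mxE. Qed.

Lemma row_consD n x y (v w : 'rV[R]_n) :
  row_cons x v + row_cons y w = row_cons (x + y) (v + w).
Proof.
apply/rowP => i; rewrite mxE; case: (unliftP ord0 i) => [j ->|->].
  by rewrite !row_consS mxE.
by rewrite !row_cons0.
Qed.

Definition measurable_row d (X : measurableType d) n (F : X -> 'rV[R]_n) :=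
  forall i, measurable_fun setT (fun x => F x 0 i).

Section measurable_row.
Context d (X : measurableType d).

Lemma measurable_fun_row d' (Y : measurableType d') n (F : X -> 'rV[R]_n)
    (f : 'rV[R]_n -> Y) : measurable_row F ->
  measurable_fun setT (fun t => f (rv t)) -> measurable_fun setT (fun x => f (F x)).
Proof.
move=> mF mf; rewrite (_ : (fun _ => _) = (fun t => f (rv t)) \o (fun x => tuple_of_rV (F x))).
  apply: measurableT_comp => //; apply/measurable_fun_tnthP => i.
  rewrite (_ : _ \o _ = fun x => F x 0 i); last first.
    by apply/funext => x /=; rewrite tnth_mktuple.
  exact: mF.
by apply/funext => x /=; rewrite tuple_of_rVK.
Qed.

Lemma measurable_row_cst n (v : 'rV[R]_n) : measurable_row (fun _ : X => v).
Proof. by move=> i. Qed.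

Lemma measurable_rowD n (F G : X -> 'rV[R]_n) :
  measurable_row F -> measurable_row G -> measurable_row (fun x => F x + G x).
Proof.
move=> mF mG i; rewrite (_ : (fun x => _) = (fun x => F x 0 i) \+ (fun x => G x 0 i)).
  exact: measurable_funD.
by apply/funext => x; rewrite mxE.
Qed.

Lemma measurable_rowN n (F : X -> 'rV[R]_n) :
  measurable_row F -> measurable_row (fun x => - F x).
Proof.
move=> mF i; rewrite (_ : (fun x => _) = (fun x => - F x 0 i)).
  exact: measurable_funN.
by apply/funext => x; rewrite mxE.
Qed.

Lemma measurable_row_mulmx m n (F : X -> 'rV[R]_m) (h : 'M[R]_(m, n)) :
  measurable_row F -> measurable_row (fun x => F x *m h).
Proof.
move=> mF i; rewrite (_ : (fun x => _) = (fun x => \sum_k F x 0 k * h k i)).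
  by apply: measurable_sum => k; apply: measurable_funM.
by apply/funext => x; rewrite mxE.
Qed.

Lemma measurable_row_cons n (f : X -> R) (F : X -> 'rV[R]_n) :
  measurable_fun setT f -> measurable_row F ->
  measurable_row (fun x => row_cons (f x) (F x)).
Proof.
move=> mf mF i; case: (unliftP ord0 i) => [j ->|->].
  rewrite (_ : (fun x => _) = fun x => F x 0 j); first exact: mF.
  by apply/funext => x; rewrite row_consS.
rewrite (_ : (fun x => _) = f)//; apply/funext => x.
by rewrite row_cons0.
Qed.

End measurable_row.

Lemma measurable_row_rv n : measurable_row (fun t : Rtuple R n => rv t).
Proof.
move=> i; rewrite (_ : (fun x => _) = fun t : Rtuple R n => tnth t i); last first.
  by apply/funext => t; rewrite mxE.
exact: measurable_tnth.
Qed.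

Lemma rV_of_tuple_cons n x (t : Rtuple R n) :
  rv [the Rtuple R n.+1 of x :: t] = row_cons x (rv t).
Proof.
apply/rowP => i; rewrite mxE; case: (unliftP ord0 i) => [j ->|->].
  by rewrite row_consS mxE tnthS.
by rewrite row_cons0 tnth0.
Qed.

Local Open Scope ereal_scope.

Lemma ge0_integral_rowS n (f : 'rV[R]_n.+1 -> \bar R) :
  measurable_fun setT (fun t => f (rv t)) -> (forall v, 0 <= f v) ->
  \int[lam n.+1]_t f (rv t) =
  \int[leb]_x \int[lam n]_t f (row_cons x (rv t)).
Proof.
move=> mf f0; rewrite (ge0_integral_lebesgue_tupleS mf (fun t => f0 (rv t))).
by apply: eq_integral => x _; apply: eq_integral => t _; rewrite rV_of_tuple_cons.
Qed.


Lemma measurable_integral_row_cons n (f : 'rV[R]_n.+1 -> \bar R) :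
  measurable_fun setT (fun t => f (rv t)) -> (forall v, 0 <= f v) ->
  measurable_fun [set: measurableTypeR R]
    (fun x : measurableTypeR R => \int[lam n]_t f (row_cons (x : R) (rv t))).
Proof.
move=> mf f0.
have := @measurable_fun_fubini_tonelli_F _ _ _ _ _ (lam n)
  (fun p : measurableTypeR R * Rtuple R n => f (row_cons (p.1 : R) (rv p.2))).
apply => [|p]; last exact: f0.
apply: (@measurable_fun_row _ _ _ _ _ (fun p => row_cons (p.1 : R) (rv p.2)) f) => //.
apply: measurable_row_cons; first exact: measurable_fst.
move=> i; apply: (measurableT_comp (f := fun t : Rtuple R n => (rv t) 0%R i)) => //.
exact: measurable_row_rv.
Qed.

Lemma ge0_integral_row_shift n (z : 'rV[R]_n) (f : 'rV[R]_n -> \bar R) :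
  measurable_fun setT (fun t => f (rv t)) -> (forall v, 0 <= f v) ->
  \int[lam n]_t f (rv t + z)%R = \int[lam n]_t f (rv t).
Proof.
elim: n z f => [|n IH] z f mf f0.
  by apply: eq_integral => t _; congr f; apply/rowP => -[].
rewrite (row_consP z); set z0 := z _ ord0; set z' := (\row_i _)%R.
have mX d (X : measurableType d) (F : X -> 'rV[R]_n.+1) :
    measurable_row F -> measurable_fun setT (fun x => f (F x)).
  by move=> mF; exact: measurable_fun_row.
rewrite (ge0_integral_rowS mf f0).
have mfz : measurable_fun setT (fun t => f (rv t + row_cons z0 z')%R).
  apply: (mX _ _ (fun t => rv t + row_cons z0 z')%R).
  by apply: measurable_rowD; [exact: measurable_row_rv|exact: measurable_row_cst].
rewrite (ge0_integral_rowS (f := fun v => f (v + row_cons z0 z')%R) mfz (fun v => f0 _)).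
pose g (x : R) := \int[lam n]_t f (row_cons x (rv t)).
have mg : measurable_fun [set: measurableTypeR R] g.
  exact: measurable_integral_row_cons.
transitivity (\int[leb]_x g (1 * x + z0)%R); last first.
  rewrite (ge0_integral_affine z0 (oner_neq0 _) mg) ?normr1 ?invr1 ?mul1e//.
  by move=> x; apply: integral_ge0.
apply: eq_integral => x _; rewrite /g mul1r.
rewrite -(IH z' (fun v => f (row_cons (x + z0)%R v)))//; last first.
  apply: (mX _ _ (fun t : Rtuple R n => row_cons (x + z0)%R (rv t))).
  apply: measurable_row_cons => //; exact: measurable_row_rv.
by apply: eq_integral => t _; rewrite row_consD.
Qed.

Lemma borel_preimage n (F : 'rV[R]_n -> 'rV[R]_n) (A : set 'rV[R]_n) :
  measurable_row (fun t : Rtuple R n => F (rv t)) -> borel A -> borel (F @^-1` A).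
Proof.
move=> mF mA; rewrite /borel.
rewrite (_ : _ @^-1` _ = (fun t => tuple_of_rV (F (rv t))) @^-1` (rv @^-1` A)).
  rewrite -[X in measurable X]setTI.
  have : measurable_fun setT (fun t : Rtuple R n => tuple_of_rV (F (rv t))).
    apply: (@measurable_fun_row _ _ _ _ _ (fun t => F (rv t)) (@tuple_of_rV n)) => //.
    apply: (eq_measurable_fun id) => // t _; by rewrite rV_of_tupleK.
  by apply.
by apply/seteqP; split=> t /=; rewrite tuple_of_rVK.
Qed.

Lemma measurable_row_indic n d (X : measurableType d) (F : X -> 'rV[R]_n) (A : set 'rV[R]_n) :
  borel A -> measurable_row F -> measurable_fun setT (fun x => \1_A (F x) : R).
Proof.
move=> mA mF; apply: (measurable_fun_row (f := \1_A : _ -> R) mF).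
rewrite (_ : (fun t => _) = \1_(rv @^-1` A)); first exact: measurable_indic.
by apply/funext => t; rewrite !indicE; congr (nat_of_bool _)%:R; apply/asboolP/asboolP.
Qed.

Lemma integral_row_indic n (A : set 'rV[R]_n) : borel A ->
  \int[lam n]_t (\1_A (rv t))%:E = vol A.
Proof.
by move=> mA; rewrite /vol -[rv @^-1` A]setIT -integral_indic.
Qed.

Definition unit_cube n : set 'rV[R]_n := [set v | forall i, 0%R <= v 0%R i < 1%R]%R.
Arguments unit_cube n : clear implicits.

Lemma unit_cubeE n : rv @^-1` unit_cube n =
  [set t | forall i : 'I_n, `[0%R, 1%R[%classic (tnth t i)].
Proof.
by apply/seteqP; split=> t /= h i; have := h i; rewrite /= in_itv/= mxE.
Qed.

Lemma borel_unit_cube n : borel (unit_cube n).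
Proof. by rewrite /borel unit_cubeE; exact: (measurable_tuple_box (A := fun=> `[0%R, 1%R[%classic)). Qed.

Lemma vol_unit_cube n : vol (unit_cube n) = 1.
Proof.
rewrite /vol unit_cubeE (lebesgue_tuple_box (A := fun=> `[0%R, 1%R[%classic))//.
by rewrite big1// => i _; rewrite lebesgue_measure_itv/= lte_fin ltr01 oppr0 adde0.
Qed.

Lemma mule1_fin_pos (x y : \bar R) : 0 <= x -> 0 <= y -> 1 = x * y ->
  exists2 k : R, (0 < k)%R & x = k%:E.
Proof.
case: x => [k| |]//=.
  rewrite lee_fin le_eqVlt => /orP[/eqP <- _|k0 _ _]; last by exists k.
  by rewrite mul0e => /eqP; rewrite onee_eq0.
move=> _; have [->|Vn0] := eqVneq y 0.
  by rewrite mule0 => _ /eqP; rewrite onee_eq0.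
by move=> y0; rewrite gt0_mulye// lt_def Vn0.
Qed.

(** The measure A |-> vol [set v | A (v *m h)] is invariant under translations,
    hence a multiple of [vol]: the double integral of
    1_A(x h) 1_U(y - x h), where U is the unit cube, equals the left-hand side
    when y is integrated first, and a constant times vol A when x is replaced
    by x + y h^-1 and then y is integrated first. *)
Lemma vol_mulmx n (h : 'M[R]_n) : h \in unitmx ->
  exists2 k : R, (0 < k)%R &
    forall A, borel A -> vol [set v | A (v *m h)%R] = k%:E * vol A.
Proof.
move=> hu.
pose K := vol [set v | unit_cube n (- (v *m h))%R].
have mh d (X : measurableType d) (F : X -> 'rV[R]_n) :
    measurable_row F -> measurable_row (fun x => F x *m h)%R.
  exact: measurable_row_mulmx.
have m1 : measurable_row (fun p : Rtuple R n * Rtuple R n => rv p.1).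
  move=> i; apply: (measurableT_comp (f := fun t : Rtuple R n => (rv t) 0%R i)).
    exact: measurable_row_rv.
  exact: measurable_fst.
have m2 : measurable_row (fun p : Rtuple R n * Rtuple R n => rv p.2).
  move=> i; apply: (measurableT_comp (f := fun t : Rtuple R n => (rv t) 0%R i)).
    exact: measurable_row_rv.
  exact: measurable_snd.
have mU := @borel_unit_cube n.
have key A : borel A -> vol [set v | A (v *m h)%R] = K * vol A.
  move=> mA.
  have mAh : borel [set v | A (v *m h)%R].
    by apply: (borel_preimage (F := fun v => v *m h)%R) => //; apply: mh; exact: measurable_row_rv.
  have mUh : borel [set v | unit_cube n (- (v *m h))%R].
    apply: (borel_preimage (F := fun v => - (v *m h))%R) => //.
    by apply: measurable_rowN; apply: mh; exact: measurable_row_rv.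
  pose f x y : R := (\1_A (x *m h)%R * \1_(unit_cube n) (y - x *m h))%R.
  pose f' x y : R := (\1_A (x *m h + y)%R * \1_(unit_cube n) (- (x *m h)))%R.
  have f0 x y : (0 <= f x y)%R by exact: mulr_ge0.
  have f'0 x y : (0 <= f' x y)%R by exact: mulr_ge0.
  transitivity (\int[lam n]_x \int[lam n]_y (f (rv x) (rv y))%:E).
    rewrite -integral_row_indic//; apply: eq_integral => x _.
    under eq_integral do rewrite /f EFinM.
    rewrite ge0_integralZl//; last first.
      apply/measurable_EFinP; apply: measurable_row_indic => //.
      apply: measurable_rowD; [exact: measurable_row_rv|exact: measurable_row_cst].
    rewrite (ge0_integral_row_shift (- (rv x *m h))%R
      (f := fun v => (\1_(unit_cube n) v)%:E))//; last first.
      by apply/measurable_EFinP; apply: measurable_row_indic => //; exact: measurable_row_rv.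
    rewrite integral_row_indic// vol_unit_cube mule1.
    by rewrite !indicE.
  have := @fubini_tonelli _ _ _ _ _ (lam n) (lam n)
    (fun p => (f (rv p.1) (rv p.2))%:E).
  rewrite /fubini_F /fubini_G /= => ->; last 2 first.
  - apply/measurable_EFinP; apply: measurable_funM.
      by apply: measurable_row_indic => //; exact: mh.
    apply: measurable_row_indic => //; apply: measurable_rowD => //.
    by apply: measurable_rowN; exact: mh.
  - by move=> p; rewrite lee_fin f0.
  transitivity (\int[lam n]_y \int[lam n]_x (f' (rv x) (rv y))%:E).
    apply: eq_integral => y _.
    rewrite -(ge0_integral_row_shift (rv y *m invmx h)%R
      (f := fun v => (f v (rv y))%:E)); last 2 first.
    - apply/measurable_EFinP; apply: measurable_funM.
        by apply: measurable_row_indic => //; apply: mh; exact: measurable_row_rv.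
      apply: measurable_row_indic => //; apply: measurable_rowD.
        exact: measurable_row_cst.
      by apply: measurable_rowN; apply: mh; exact: measurable_row_rv.
    - by move=> v; rewrite lee_fin f0.
    by apply: eq_integral => x _; rewrite /f /f' mulmxDl mulmxKV// opprD addrCA subrr addr0.
  have := @fubini_tonelli _ _ _ _ _ (lam n) (lam n)
    (fun p => (f' (rv p.1) (rv p.2))%:E).
  rewrite /fubini_F /fubini_G /= => <-; last 2 first.
  - apply/measurable_EFinP; apply: measurable_funM.
      by apply: measurable_row_indic => //; apply: measurable_rowD => //; exact: mh.
    by apply: measurable_row_indic => //; apply: measurable_rowN; exact: mh.
  - by move=> p; rewrite lee_fin f'0.
  transitivity (\int[lam n]_x ((\1_[set v | unit_cube n (- (v *m h))%R] (rv x))%:E * vol A)).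
    apply: eq_integral => x _.
    under eq_integral do rewrite /f' mulrC EFinM addrC.
    rewrite ge0_integralZl//; last first.
      apply/measurable_EFinP; apply: measurable_row_indic => //.
      apply: measurable_rowD; [exact: measurable_row_rv|exact: measurable_row_cst].
    rewrite (ge0_integral_row_shift (rv x *m h)%R (f := fun v => (\1_A v)%:E))//; last first.
      by apply/measurable_EFinP; apply: measurable_row_indic => //; exact: measurable_row_rv.
    rewrite integral_row_indic//.
  rewrite ge0_integralZr//; first by rewrite integral_row_indic.
  by apply/measurable_EFinP; apply: measurable_row_indic => //; exact: measurable_row_rv.
have := key [set v | unit_cube n (v *m invmx h)%R].
have -> : [set v | [set v | unit_cube n (v *m invmx h)%R] (v *m h)%R] = unit_cube n.
  by apply/seteqP; split=> v /=; rewrite mulmxK.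
rewrite vol_unit_cube => K1.
have {}K1 : 1 = K * vol [set v | unit_cube n (v *m invmx h)%R].
  apply: K1; apply: (borel_preimage (F := fun v => v *m invmx h)%R) => //.
  by apply: measurable_row_mulmx; exact: measurable_row_rv.
have K0 : 0 <= K by exact: measure_ge0.
have V0 : 0 <= vol [set v | unit_cube n (v *m invmx h)%R] by exact: measure_ge0.
have [k k0 KE] := mule1_fin_pos K0 V0 K1.
by exists k => // A mA; rewrite key// KE.
Qed.

Lemma ge0_integral_row_mulmx n (h : 'M[R]_n) (k : R) (f : 'rV[R]_n -> \bar R) :
  (0 <= k)%R -> (forall A, borel A -> vol [set v | A (v *m h)%R] = k%:E * vol A) ->
  measurable_fun setT (fun t => f (rv t)) -> (forall v, 0 <= f v) ->
  \int[lam n]_t f (rv t *m h)%R = k%:E * \int[lam n]_t f (rv t).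
Proof.
move=> k0 kP mf f0.
have mphi : measurable_fun setT (fun t : Rtuple R n => tuple_of_rV (rv t *m h)%R).
  apply: (@measurable_fun_row _ _ _ _ _ (fun t => rv t *m h)%R (@tuple_of_rV n)).
    by apply: measurable_row_mulmx; exact: measurable_row_rv.
  by apply: (eq_measurable_fun id) => // t _; rewrite rV_of_tupleK.
rewrite -(ge0_integral_image (mu := lam n) mphi (k := NngNum k0) _ mf)//.
  by apply: eq_integral => t _; rewrite tuple_of_rVK.
move=> A mA /=; have := kP [set v | A (tuple_of_rV v)].
rewrite /borel /vol.
rewrite (_ : rv @^-1` [set v | A (tuple_of_rV v)] = A).
  by apply.
by apply/seteqP; split=> t /=; rewrite rV_of_tupleK.
Qed.

End row_vectors.

(** * Decay of an integral of Bessel type *)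
Section bessel.
Context (R : realType).
Notation leb := (@lebesgue_measure R).
Implicit Types (x s : R) (k : nat).

Definition bweight k s : R := Num.sqrt (1 - s ^+ 2) ^+ k.
(** By Poisson's integral, [bcos k x] is a constant times x^(-(k+1)/2) times the
    Bessel function of order (k+1)/2 at x, and [- bsin k] is its derivative. *)
Definition bcos k x : R := (\int[leb]_(s in `[-1, 1]) (bweight k s * cos (x * s)))%R.
Definition bsin k x : R := (\int[leb]_(s in `[-1, 1]) (s * bweight k s * sin (x * s)))%R.

Lemma continuous_bweight k : continuous (bweight k).
Proof.
move=> s; rewrite /bweight; apply: (@continuous_comp _ _ _ (fun s => Num.sqrt (1 - s ^+ 2)) (fun y => y ^+ k)).
  apply: (@continuous_comp _ _ _ (fun s => 1 - s ^+ 2)); last exact: sqrt_continuous.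
  by apply: cvgB; [exact: cvg_cst|exact: exprn_continuous].
exact: exprn_continuous.
Qed.

Lemma bweight_ge0 k s : 0 <= bweight k s.
Proof. by rewrite exprn_ge0. Qed.

Lemma bweight_le1 k s : bweight k s <= 1.
Proof.
rewrite exprn_ile1// -[leRHS]sqrtr1 ler_wsqrtr// gerBl; exact: sqr_ge0.
Qed.

Lemma continuous_itv_integrable (f : R -> R) (a b : R) : continuous f ->
  leb.-integrable `[a, b] (EFin \o f).
Proof.
move=> cf; apply: continuous_compact_integrable; first exact: segment_compact.
by apply: continuous_subspaceT.
Qed.

Lemma continuous_cosM x : continuous (fun s => cos (x * s)).
Proof.
move=> s; apply: (@continuous_comp _ _ _ (fun s => x * s) cos).
  exact: mulrl_continuous.
exact: continuous_cos.
Qed.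

Lemma continuous_sinM x : continuous (fun s => sin (x * s)).
Proof.
move=> s; apply: (@continuous_comp _ _ _ (fun s => x * s) sin).
  exact: mulrl_continuous.
exact: continuous_sin.
Qed.

Section under.
Variable (w : R -> R).
Hypothesis cw : continuous w.
Hypothesis w1 : forall s, s \in `[-1, 1] -> `|s * w s| <= 1.

Lemma is_derive_int_cos x :
  is_derive x 1 (fun x => \int[leb]_(s in `[-1, 1]) (w s * cos (x * s)))%R
    (- (\int[leb]_(s in `[-1, 1]) (s * w s * sin (x * s)))%R).
Proof.
have dcos (y s : R) : is_derive y 1 (fun y : R => w s * cos (y * s)) (- (s * w s * sin (y * s))).
  apply: is_derive_eq; rewrite /GRing.scale/=; ring.
have d1 (y s : R) : partial1of2 (fun y s : R => w s * cos (y * s)) y s = - (s * w s * sin (y * s)).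
  by rewrite partial1of2E; apply: derive_val.
have intf (y : R) : leb.-integrable `[-1, 1] (EFin \o (fun s => w s * cos (y * s))).
  apply: continuous_itv_integrable => s; apply: cvgM; [exact: cw|exact: continuous_cosM].
have Ix : `]x - 1, x + 1[%classic x by rewrite /= in_itv/= ltrBlDr ltrDl ltr01.
have der (y s : R) : `]x - 1, x + 1[%classic y -> `[-1, 1]%classic s ->
    derivable ((fun y s : R => w s * cos (y * s)) ^~ s) y 1.
  by move=> _ _; exact: ex_derive.
have int1 : leb.-integrable `[-1, 1] (EFin \o (cst 1 : R -> R)).
  by apply: continuous_itv_integrable => s; exact: cvg_cst.
have G_ub (y s : R) : `]x - 1, x + 1[%classic y -> `[-1, 1]%classic s ->
    `|partial1of2 (fun y s : R => w s * cos (y * s)) y s| <= (cst 1 : R -> R) s.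
  move=> _ sI; rewrite d1 normrN normrM /= -[leRHS]mulr1 ler_pM//; first exact: w1.
  by rewrite ler_norml sin_geN1 sin_le1.
have g0 (s : R) : 0 <= (cst 1 : R -> R) s by [].
have mI : measurable (`[-1, 1] : set (measurableTypeR R)) by [].
have D := derivable_under_integral mI Ix (fun y _ => intf y) der g0 int1 G_ub.
have E := differentiation_under_integral mI Ix (fun y _ => intf y) der g0 int1 G_ub.
apply: DeriveDef => //.
rewrite -derive1E E.
rewrite -[RHS]mulN1r -RintegralZl//; last first.
  apply: continuous_itv_integrable => s; apply: cvgM; last exact: continuous_sinM.
  by apply: cvgM; [exact: cvg_id|exact: cw].
by apply: eq_Rintegral => s _; rewrite d1 mulN1r.
Qed.

Lemma is_derive_int_sin x :
  is_derive x 1 (fun x => \int[leb]_(s in `[-1, 1]) (w s * sin (x * s)))%R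
    ((\int[leb]_(s in `[-1, 1]) (s * w s * cos (x * s)))%R).
Proof.
have dcos (y s : R) : is_derive y 1 (fun y : R => w s * sin (y * s)) ((s * w s * cos (y * s))).
  apply: is_derive_eq; rewrite /GRing.scale/=; ring.
have d1 (y s : R) : partial1of2 (fun y s : R => w s * sin (y * s)) y s = (s * w s * cos (y * s)).
  by rewrite partial1of2E; apply: derive_val.
have intf (y : R) : leb.-integrable `[-1, 1] (EFin \o (fun s => w s * sin (y * s))).
  apply: continuous_itv_integrable => s; apply: cvgM; [exact: cw|exact: continuous_sinM].
have Ix : `]x - 1, x + 1[%classic x by rewrite /= in_itv/= ltrBlDr ltrDl ltr01.
have der (y s : R) : `]x - 1, x + 1[%classic y -> `[-1, 1]%classic s ->
    derivable ((fun y s : R => w s * sin (y * s)) ^~ s) y 1.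
  by move=> _ _; exact: ex_derive.
have int1 : leb.-integrable `[-1, 1] (EFin \o (cst 1 : R -> R)).
  by apply: continuous_itv_integrable => s; exact: cvg_cst.
have G_ub (y s : R) : `]x - 1, x + 1[%classic y -> `[-1, 1]%classic s ->
    `|partial1of2 (fun y s : R => w s * sin (y * s)) y s| <= (cst 1 : R -> R) s.
  move=> _ sI; rewrite d1 normrM /= -[leRHS]mulr1 ler_pM//; first exact: w1.
  by rewrite ler_norml cos_geN1 cos_le1.
have g0 (s : R) : 0 <= (cst 1 : R -> R) s by [].
have mI : measurable (`[-1, 1] : set (measurableTypeR R)) by [].
have D := derivable_under_integral mI Ix (fun y _ => intf y) der g0 int1 G_ub.
have E := differentiation_under_integral mI Ix (fun y _ => intf y) der g0 int1 G_ub.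
apply: DeriveDef => //.
rewrite -derive1E E.
by apply: eq_Rintegral => s _; rewrite d1.
Qed.

End under.

Lemma is_derive_exprn n x : is_derive x 1 (fun y : R => y ^+ n) (n%:R * x ^+ n.-1).
Proof.
apply: DeriveDef; first exact: exprn_derivable.
by rewrite exp_derive /GRing.scale/= mulr1.
Qed.

Lemma itvN11 s : s \in `[-1, 1] -> `|s| <= 1.
Proof. by rewrite in_itv/= ler_norml. Qed.

Lemma is_derive_bcos k x : is_derive x 1 (bcos k) (- bsin k x).
Proof.
apply: is_derive_int_cos; first exact: continuous_bweight.
move=> s /itvN11 s1; rewrite normrM mulr_ile1// ger0_norm ?bweight_ge0//.
exact: bweight_le1.
Qed.

Lemma bweightS2 k s : s \in `[-1, 1] ->
  bweight k.+2 s = bweight k s - s * (s * bweight k s).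
Proof.
move=> /itvN11 s1; rewrite /bweight -[in LHS](addn2 k) exprD sqr_sqrtr.
  by ring.
by rewrite subr_ge0 -real_normK ?num_real// exprn_ile1.
Qed.

Lemma is_derive_bsin k x : is_derive x 1 (bsin k) (bcos k x - bcos k.+2 x).
Proof.
have cw : continuous (fun s => s * bweight k s).
  by move=> s; apply: cvgM; [exact: cvg_id|exact: continuous_bweight].
have w1 s : s \in `[-1, 1] -> `|s * (s * bweight k s)| <= 1.
  move=> /itvN11 s1; rewrite normrM mulr_ile1// normrM mulr_ile1// ger0_norm ?bweight_ge0//.
  exact: bweight_le1.
have := is_derive_int_sin cw w1 x.
rewrite /bcos -RintegralB//; last 2 first.
- by apply: continuous_itv_integrable => s; apply: cvgM; [exact: continuous_bweight|exact: continuous_cosM].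
- by apply: continuous_itv_integrable => s; apply: cvgM; [exact: continuous_bweight|exact: continuous_cosM].
congr (is_derive _ _ _ _); apply: eq_Rintegral => s /set_mem sI.
by rewrite bweightS2//; ring.
Qed.

Lemma bsin_parts k x : bsin k x = x / k.+2%:R * bcos k.+2 x.
Proof.
pose F s := sin (x * s); pose f s := x * cos (x * s).
pose G s := - (k.+2%:R^-1 * bweight k.+2 s); pose g s := s * bweight k s.
have dF s : is_derive s 1 F (f s).
  by rewrite /f; apply: is_derive_eq; rewrite /GRing.scale/=; ring.
have dG s : s \in `]-1, 1[ -> is_derive s 1 G (g s).
  rewrite in_itv/= => s1.
  have s0 : 0 < 1 - s ^+ 2.
    by rewrite subr_gt0 -real_normK ?num_real// exprn_ilt1// ltr_norml.
  have ds := is_derive1_sqrt s0.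
  have d1 : is_derive s 1 (fun s => Num.sqrt (1 - s ^+ 2)) (- (s / Num.sqrt (1 - s ^+ 2))).
    have := @is_derive1_comp _ (@Num.sqrt R) (fun s => 1 - s ^+ 2) s _ (- (2 * s)) ds.
    have d2 : is_derive s 1 (fun s : R => 1 - s ^+ 2) (- (2 * s)).
      by apply: is_derive_eq; rewrite /GRing.scale/=; ring.
    move=> /(_ d2); rewrite /comp; congr (is_derive _ _ _ _).
    field.
    by rewrite sqrtr_eq0 -ltNge.
  have dX (y : R) : is_derive y 1 (fun y : R => - (k.+2%:R^-1 * y ^+ k.+2)) (- y ^+ k.+1).
    have dn := is_derive_exprn k.+2 y.
    by apply: is_derive_eq; rewrite /GRing.scale/= mulKf ?pnatr_eq0.
  have := @is_derive1_comp _ _ (fun s => Num.sqrt (1 - s ^+ 2)) s _ _ (dX _) d1.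
  rewrite /comp/= /g /bweight; congr (is_derive _ _ _ _).
  rewrite exprS; field.
  by rewrite sqrtr_eq0 -ltNge.
have cf : continuous f.
  by move=> s; apply: cvgM; [exact: cvg_cst|exact: continuous_cosM].
have cg : continuous g.
  by move=> s; apply: cvgM; [exact: cvg_id|exact: continuous_bweight].
have cF : continuous F by exact: continuous_sinM.
have cG : continuous G.
  by move=> s; apply: cvgN; apply: cvgM; [exact: cvg_cst|exact: continuous_bweight].
have LR (H : R -> R) : continuous H ->
    (forall s, s \in `]-1, 1[ -> derivable H s 1) -> derivable_oo_LRcontinuous H (-1) 1.
  move=> cH dH; split => //.
  - by apply: cvg_at_right_filter; exact: cH.
  - by apply: cvg_at_left_filter; exact: cH.
have bw0 s : `|s| = 1 -> bweight k.+2 s = 0.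
  by move=> s1; rewrite /bweight -real_normK ?num_real// s1 expr1n subrr sqrtr0 expr0n.
have G1 : G 1 = 0 by rewrite /G bw0 ?normr1// mulr0 oppr0.
have GN1 : G (-1) = 0 by rewrite /G bw0 ?normrN ?normr1// mulr0 oppr0.
have := @Rintegration_by_parts R F G f g (-1) 1.
rewrite G1 GN1 !mulr0 subr0 sub0r => parts.
rewrite /bsin (_ : \int[_]_(_ in _) _ = \int[leb]_(s in `[-1, 1]) (F s * g s)); last first.
  by apply: eq_Rintegral => s _; rewrite mulrC.
rewrite parts; last 7 first.
- by lra.
- exact: continuous_subspaceT.
- by apply: LR => // s _; exact: ex_derive.
- by move=> s _; rewrite derive1E; exact: derive_val.
- exact: continuous_subspaceT.
- by apply: (LR _ cG) => s /dG[].
- by move=> s /dG sI; rewrite derive1E; exact: derive_val.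
rewrite -RintegralZl//; last first.
  by apply: continuous_itv_integrable => s; apply: cvgM; [exact: continuous_bweight|exact: continuous_cosM].
rewrite -[LHS]mulN1r -RintegralZl//; last first.
  by apply: continuous_itv_integrable => s; apply: cvgM; [exact: cf|exact: cG].
by apply: eq_Rintegral => s _; rewrite /f /G; ring.
Qed.

(** Put m = k + 2, y = bcos k and p = bsin k. Then y' = - p and
    p' = y - m p / x, so that the energy V below satisfies
    V' = m x^(m-2) y p, without the leading terms of order x^(m-1). For x >= m
    this makes V exp(m / x) nonincreasing, while V >= x^m y^2 / 2. *)
Lemma bcos_bound k : exists2 C : R, 0 <= C & forall x, 0 < x ->
  x ^+ k.+2 * bcos k x ^+ 2 <= C.
Proof.
pose m := k.+2; have m0 : (0 : R) < m%:R by rewrite ltr0n.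
pose V x := x ^+ m * (bcos k x ^+ 2 + bsin k x ^+ 2) -
  m%:R * (x ^+ m.-1 * (bcos k x * bsin k x)).
pose W x := V x * expR (m%:R * x^-1).
have YP2 x : 2 * `|bcos k x * bsin k x| <= bcos k x ^+ 2 + bsin k x ^+ 2.
  have h1 := sqr_ge0 (bcos k x - bsin k x); have h2 := sqr_ge0 (bcos k x + bsin k x).
  by case: (ger0P (bcos k x * bsin k x)) => _; nra.
have dbsin x : 0 < x -> is_derive x 1 (bsin k) (bcos k x - m%:R / x * bsin k x).
  move=> x0; have := is_derive_bsin k x; congr (is_derive _ _ _ _).
  rewrite bsin_parts mulrA -[_ / x]invf_div mulVf ?mul1r//.
  by rewrite mulf_neq0 ?invr_neq0 ?gt_eqF.
have dV x : 0 < x -> is_derive x 1 V (m%:R * (x ^+ k * (bcos k x * bsin k x))).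
  move=> x0; have d1 := is_derive_bcos k x; have d2 := dbsin _ x0.
  have d3 := is_derive_exprn m x; have d4 := is_derive_exprn m.-1 x.
  rewrite /V; apply: is_derive_eq; rewrite /GRing.scale/= /m/= !exprS.
  rewrite -!natr1; field.
  by rewrite gt_eqF.
have dW x : 0 < x -> is_derive x 1 W (expR (m%:R * x^-1) *
   (m%:R * (x ^+ k * (bcos k x * bsin k x)) - m%:R * x ^- 2 * V x)).
  move=> x0; have d1 := dV _ x0.
  have d2 : is_derive x 1 (fun x : R => m%:R * x^-1) (- (m%:R * x ^- 2)).
    have xn0 : x != 0 by rewrite gt_eqF.
    have d3 : is_derive x 1 (fun x : R => x^-1) (- x ^- 2).
      have dx := is_derive_id x 1.
      apply: DeriveDef; first exact: derivableV.
      by rewrite deriveV//  derive_id /GRing.scale/= mulr1.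
    by apply: is_derive_eq; rewrite /GRing.scale/= mulrN.
  have d3 := @is_derive1_comp _ (@expR R) (fun x => m%:R * x^-1) x _ _ (is_derive_expR _) d2.
  have := is_deriveM d1 d3; rewrite /W /comp /= /GRing.scale/=; congr (is_derive _ _ _ _).
  by ring.
have Vge x : m%:R <= x -> x ^+ m * bcos k x ^+ 2 <= 2 * V x.
  move=> mx; have x0 : 0 < x by exact: lt_le_trans mx.
  have xk0 : 0 < x ^+ k.+1 by exact: exprn_gt0.
  have x0' := ltW x0; have xk0' := ltW xk0.
  have := YP2 x; rewrite /V /m/= (exprS x k.+1) => h.
  have h1 : m%:R * (bcos k x * bsin k x) <= x * `|bcos k x * bsin k x|.
    by apply: (le_trans (ler_wpM2l (ltW m0) (ler_norm _))); rewrite ler_wpM2r.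
  have h2 : x ^+ k.+1 * (m%:R * (bcos k x * bsin k x)) <= x ^+ k.+1 * (x * `|bcos k x * bsin k x|).
    by rewrite ler_wpM2l// ltW.
  have h3 : x ^+ k.+1 * (x * (2 * `|bcos k x * bsin k x|)) <= x ^+ k.+1 * (x * (bcos k x ^+ 2 + bsin k x ^+ 2)).
    by rewrite ler_wpM2l// ler_wpM2l.
  have h4 : 0 <= x ^+ k.+1 * (x * bsin k x ^+ 2).
    by rewrite mulr_ge0// mulr_ge0// sqr_ge0.
  rewrite /m in h2; lra.
have V0 x : m%:R <= x -> 0 <= V x.
  move=> mx; have x0 : 0 < x by exact: lt_le_trans mx.
  have := Vge _ mx; have : 0 <= x ^+ m * bcos k x ^+ 2.
    by rewrite mulr_ge0 ?sqr_ge0// exprn_ge0// ltW.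
  lra.
have dec x : m%:R <= x -> W x <= W m%:R.
  move=> mx; apply: (ler0_derive1_nincry (a := m%:R)) => //.
  - move=> y; rewrite in_itv/= andbT => my; have y0 : 0 < y by exact: lt_trans my.
    by have := dW _ y0 => ?; exact: ex_derive.
  - move=> y; rewrite in_itv/= andbT => my; have y0 : 0 < y by exact: lt_trans my.
    have d := dW _ y0; rewrite derive1E derive_val.
    rewrite mulr_ge0_le0 ?expR_ge0// subr_le0.
    set Y := bcos k y; set P := bsin k y.
    have -> : m%:R * y ^- 2 * V y =
        m%:R * (y ^+ k * ((Y ^+ 2 + P ^+ 2) - m%:R / y * (Y * P))).
      rewrite /V -/Y -/P /m /= (exprS y k.+1) (exprS y k).
      move: (k.+2%:R : R) => M; field.
      by rewrite gt_eqF.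
    have y0' := ltW y0; rewrite ler_wpM2l// ler_wpM2l ?exprn_ge0//.
    have h := YP2 y; rewrite -/Y -/P in h.
    have h1 : m%:R / y * (Y * P) <= 1 * `|Y * P|.
      rewrite (le_trans (ler_norm _))// normrM ler_wpM2r// ger0_norm; last first.
        by rewrite divr_ge0// ltW.
      by rewrite ler_pdivrMr// mul1r ltW.
    have h2 := ler_norm (Y * P); lra.
  - apply/continuous_in_subspaceT => y; rewrite inE/= in_itv/= andbT => my.
    have y0 : 0 < y by exact: lt_le_trans my.
    have d := dW _ y0.
    by apply/differentiable_continuous/derivable1_diffP; exact: ex_derive.
exists (Num.max (2 * W m%:R) (4 * m%:R ^+ m)).
  by rewrite le_max; apply/orP; right; rewrite mulr_ge0// exprn_ge0// ltW.
move=> x x0; rewrite le_max; have [mx|xm] := leP m%:R x.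
  apply/orP; left; rewrite (le_trans (Vge _ mx))// ler_wpM2l// (le_trans _ (dec _ mx))//.
  rewrite /W -[leLHS]mulr1 ler_wpM2l ?V0//.
  by rewrite -expR0 ler_expR divr_ge0// ltW.
have x0' := ltW x0; apply/orP; right; rewrite mulrC ler_pM ?sqr_ge0 ?exprn_ge0//; last first.
  by apply: lerXn2r; rewrite ?nnegrE ltW.
have -> : (4 : R) = 2 ^+ 2 by rewrite -natrX.
rewrite -real_normK ?num_real// ler_pXn2r ?nnegrE//.
have mI : measurable (`[-1, 1] : set (measurableTypeR R)) by [].
have ci : leb.-integrable `[-1, 1] (EFin \o (fun s => bweight k s * cos (x * s))).
  apply: continuous_itv_integrable => s; apply: cvgM; [exact: continuous_bweight|exact: continuous_cosM].
have c1 : leb.-integrable `[-1, 1] (EFin \o (cst 1 : R -> R)).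
  by apply: continuous_itv_integrable => s; exact: cvg_cst.
apply: (le_trans (le_normr_Rintegral mI ci)).
apply: (@le_trans _ _ (\int[leb]_(s in `[-1, 1]) (cst 1 : R -> R) s)%R).
  apply: le_Rintegral => //.
    by apply: continuous_itv_integrable => s; apply: cvg_norm; apply: cvgM; [exact: continuous_bweight|exact: continuous_cosM].
  move=> s _; rewrite normrM mulr_ile1//.
    by rewrite ger0_norm ?bweight_ge0// bweight_le1.
  by rewrite ler_norml cos_geN1 cos_le1.
rewrite Rintegral_cst// mul1r.
rewrite [X in fine X](_ : _ = 2%:E)//.
  rewrite [LHS]lebesgue_measure_itv/= lte_fin ifT; last by lra.
  by rewrite -EFinB; congr (_%:E); ring.
Qed.

End bessel.

(** * Truncated powers *)
Section phi.
Context (R : realType).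
Notation leb := (@lebesgue_measure R).
Notation lam n := (lebesgue_tuple R n).
Notation rv := (@rV_of_tuple R _).
Implicit Types (v s a b : R) (k n : nat).

(** The truncated power v_+^(k/2), the indicator of v > 0 when k = 0. *)
Definition phi k v : R := (0 < v)%R%:R * Num.sqrt v ^+ k.

Lemma phi_ge0 k v : 0 <= phi k v.
Proof. by rewrite mulr_ge0// exprn_ge0. Qed.

Lemma phi_le0 k v : v <= 0 -> phi k v = 0.
Proof. by rewrite /phi ltNge => ->; rewrite mul0r. Qed.

Lemma phi_gt0 k v : 0 < v -> phi k v = Num.sqrt v ^+ k.
Proof. by rewrite /phi => ->; rewrite mul1r. Qed.

Lemma phiM k v s : 0 < v -> phi k (v * s) = Num.sqrt v ^+ k * phi k s.
Proof.
by move=> v0; rewrite /phi pmulr_rgt0// sqrtrM ?ltW// exprMn; ring.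
Qed.

Lemma phi_mono k v w : v <= w -> phi k v <= phi k w.
Proof.
move=> vw; have [v0|v0] := leP v 0; first by rewrite phi_le0// phi_ge0.
by rewrite !phi_gt0// ?(lt_le_trans v0)// lerXn2r ?nnegrE ?sqrtr_ge0// ler_wsqrtr.
Qed.

Lemma measurable_phi k : measurable_fun setT (phi k).
Proof. by apply: nondecreasing_measurable => // x y xy; exact: phi_mono. Qed.

Lemma measurable_phi_comp d (X : measurableType d) k (f : X -> R) :
  measurable_fun setT f -> measurable_fun setT (fun x => phi k (f x)).
Proof. by move=> mf; apply: measurableT_comp => //; exact: measurable_phi. Qed.

Lemma phi_supp k s : phi k (1 - s ^+ 2) <= \1_(`[-1, 1] : set R) s.
Proof.
rewrite indicE; case: (boolP (s \in _)) => [_|].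
  apply: (le_trans (phi_mono _ (_ : _ <= 1))); first by rewrite gerBl sqr_ge0.
  by rewrite phi_gt0// sqrtr1 expr1n.
rewrite notin_setE/= in_itv/= => /negP; rewrite -ler_norml -ltNge => s1.
by rewrite phi_le0// subr_le0 -real_normK ?num_real// exprn_ege1 // ltW.
Qed.

Local Open Scope ereal_scope.

Definition phic k : R := fine (\int[leb]_s (phi k (1 - s ^+ 2))%:E).

Lemma measurable_phi_sqr k v : measurable_fun [set: measurableTypeR R]
  (fun s : measurableTypeR R => (phi k (v - (s : R) ^+ 2))%:E).
Proof.
apply/measurable_EFinP; apply: (measurable_phi_comp k (f := fun s : measurableTypeR R => v - (s : R) ^+ 2)%R).
by apply: measurable_funB => //; exact: measurable_funX.
Qed.

Lemma phicE k : \int[leb]_s (phi k (1 - s ^+ 2))%:E = (phic k)%:E.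
Proof.
rewrite /phic fineK// ge0_fin_numE; last first.
  by apply: integral_ge0 => s _; rewrite lee_fin phi_ge0.
apply: (@le_lt_trans _ _ (\int[leb]_s (\1_(`[(-1)%R, 1%R] : set R) s)%:E)).
  apply: ge0_le_integral => //=.
  - by move=> s _; rewrite lee_fin phi_ge0.
  - exact: measurable_phi_sqr.
  - by apply/measurable_EFinP; exact: measurable_indic.
  - by move=> s _; rewrite lee_fin phi_supp.
rewrite integral_indic// setIT [ltLHS]lebesgue_measure_itv/= lte_fin.
by case: ifPn => // _; rewrite -EFinB ltry.
Qed.

Lemma phic_gt0 k : (0 < phic k)%R.
Proof.
rewrite -lte_fin -phicE.
have h0 : (0 < 2^-1 :> R)%R by lra.
have sqP (s : R) : (0 <= s -> s <= 2^-1 -> 4^-1 <= 1 - s ^+ 2)%R by move=> ? ?; nra.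
apply: (@lt_le_trans _ _ (\int[leb]_s ((2^-1 ^+ k)%:E * (\1_(`[0%R, 2^-1%R] : set R) s)%:E))).
  rewrite ge0_integralZl_EFin//; last by apply/measurable_EFinP; exact: measurable_indic.
  rewrite integral_indic// setIT [X in _ * X]lebesgue_measure_itv/= lte_fin h0.
  by rewrite -EFinB -EFinM lte_fin mulr_gt0 ?exprn_gt0// subr0.
apply: ge0_le_integral => //=.
- by apply: measurable_funeM => //; apply/measurable_EFinP.
- exact: measurable_phi_sqr.
move=> s _; rewrite -EFinM lee_fin indicE; case: (boolP (s \in _)) => [|_]; last first.
  by rewrite mulr0 phi_ge0.
rewrite inE/= in_itv/= mulr1 => /andP[s0 s1].
have sq := sqP _ s0 s1.
rewrite phi_gt0; last by apply: lt_le_trans sq; lra.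
apply: lerXn2r; rewrite ?nnegrE ?sqrtr_ge0 ?(ltW h0)//.
have -> : (2^-1 = Num.sqrt (4^-1) :> R)%R.
  have -> : (4^-1 = 2^-1 ^+ 2 :> R)%R by rewrite expr2; field.
  by rewrite sqrtr_sqr ger0_norm// ltW.
by rewrite ler_wsqrtr.
Qed.

Lemma integral_phi_sqr k v :
  \int[leb]_s (phi k (v - s ^+ 2))%:E = (phic k * phi k.+1 v)%:E.
Proof.
have [v0|v0] := leP v 0%R.
  rewrite phi_le0// mulr0; apply: integral0_eq => s _.
  by rewrite phi_le0// subr_le0 (le_trans v0)// sqr_ge0.
have sv0 : (0 < Num.sqrt v)%R by rewrite sqrtr_gt0.
have sv0' : Num.sqrt v != 0%R by rewrite gt_eqF.
have := ge0_integral_affine 0 sv0' (measurable_phi_sqr k v).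
move=> /(_ (fun x => _)); rewrite gtr0_norm// => H.
have -> : \int[leb]_s (phi k (v - s ^+ 2))%:E =
    (Num.sqrt v)%:E * \int[leb]_s (phi k (v - (Num.sqrt v * s + 0) ^+ 2))%:E.
  rewrite H; last by move=> x; rewrite lee_fin phi_ge0.
  by rewrite muleA -EFinM divff// mul1e.
rewrite [X in _ * X](_ : _ = \int[leb]_s ((Num.sqrt v ^+ k)%:E * (phi k (1 - s ^+ 2))%:E)); last first.
  apply: eq_integral => s _; rewrite -EFinM -phiM//; congr (phi k _)%:E.
  by rewrite addr0 exprMn sqr_sqrtr ?ltW//; ring.
rewrite ge0_integralZl_EFin//.
- by rewrite phicE -!EFinM phi_gt0// exprS; congr (_%:E); ring.
- by move=> s _; rewrite lee_fin phi_ge0.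
- exact: measurable_phi_sqr.
Qed.

Lemma integral_phi_affine k v a b : a != 0%R ->
  \int[leb]_s (phi k (v - (a * s + b) ^+ 2))%:E = (phic k / `|a| * phi k.+1 v)%:E.
Proof.
move=> a0; rewrite (ge0_integral_affine b a0 (measurable_phi_sqr k v)); last first.
  by move=> x; rewrite lee_fin phi_ge0.
by rewrite integral_phi_sqr -EFinM; congr (_%:E); ring.
Qed.

End phi.

(** * Integrals of truncated powers over ellipsoids *)
Section quadratic.
Context (R : realType).
Notation leb := (@lebesgue_measure R).
Notation lam n := (lebesgue_tuple R n).
Notation rv := (@rV_of_tuple R _).

Definition sqn n (v : 'rV[R]_n) : R := \sum_i v 0 i ^+ 2.

Lemma sqn_ge0 n (v : 'rV[R]_n) : 0 <= sqn v.
Proof. by apply: sumr_ge0 => i _; exact: sqr_ge0. Qed.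

Lemma sqn_row_cons n x (v : 'rV[R]_n) : sqn (row_cons x v) = x ^+ 2 + sqn v.
Proof.
rewrite /sqn big_ord_recl row_cons0; congr (_ + _).
by apply: eq_bigr => i _; rewrite row_consS.
Qed.

Lemma measurable_sqn d (X : measurableType d) n (F : X -> 'rV[R]_n) :
  measurable_row F -> measurable_fun setT (fun x => sqn (F x)).
Proof.
by move=> mF; apply: measurable_sum => i; apply: measurable_funX; exact: mF.
Qed.

Definition upper_triangular n (w : 'M[R]_n) := forall i j : 'I_n, (j < i)%N -> w i j = 0.

Definition minor00 n (w : 'M[R]_n.+1) : 'M[R]_n := \matrix_(i, j) w (lift ord0 i) (lift ord0 j).
Definition tail0 n (w : 'M[R]_n.+1) : 'rV[R]_n := \row_j w ord0 (lift ord0 j).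

Lemma minor00_upper n (w : 'M[R]_n.+1) : upper_triangular w -> upper_triangular (minor00 w).
Proof. by move=> uw i j ij; rewrite mxE uw// !lift0 ltnS. Qed.

Lemma row_cons_mulmx n x (v : 'rV[R]_n) (w : 'M[R]_n.+1) : upper_triangular w ->
  row_cons x v *m w = row_cons (x * w ord0 ord0) (v *m minor00 w + x *: tail0 w).
Proof.
move=> uw; apply/rowP => j; rewrite mxE big_ord_recl row_cons0.
case: (unliftP ord0 j) => [i ->|->].
  rewrite row_consS !mxE addrC; congr (_ + _).
  by apply: eq_bigr => l _; rewrite row_consS mxE.
rewrite row_cons0 big1 ?addr0// => l _.
by rewrite row_consS uw ?mulr0// lift0.
Qed.

(** [phiC 0 n] is the volume of the unit ball of R^n. *)
Definition phiC k n : R := \prod_(i < n) phic R (k + i).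

Lemma phiC_gt0 k n : 0 < phiC k n.
Proof. by apply: prodr_gt0 => i _; exact: phic_gt0. Qed.

Lemma phiCS k n : phiC k n.+1 = phiC k n * phic R (k + n).
Proof. by rewrite /phiC big_ord_recr. Qed.

Local Open Scope ereal_scope.

Lemma measurable_phi_row d (X : measurableType d) n k (f : X -> R) (F : X -> 'rV[R]_n) :
  measurable_fun setT f -> measurable_row F ->
  measurable_fun setT (fun x => phi k (f x - sqn (F x))%R).
Proof.
move=> mf mF; apply: (measurable_phi_comp k (f := fun x => f x - sqn (F x))%R).
by apply: measurable_funB => //; exact: measurable_sqn.
Qed.

Lemma measurable_phi_quad n k v (w : 'M[R]_n) (r : 'rV[R]_n) :
  measurable_fun setT (fun t => (phi k (v - sqn (rv t *m w + r)))%:E).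
Proof.
apply/measurable_EFinP; apply: measurable_phi_row => //.
apply: measurable_rowD; last exact: measurable_row_cst.
by apply: measurable_row_mulmx; exact: measurable_row_rv.
Qed.

(** The first coordinate of x w + r depends on the first coordinate of x only,
    and the integral over the other coordinates is a truncated power of what it
    leaves of v: each integration raises the exponent by one half. *)
Lemma integral_phi_triangular n k v (w : 'M[R]_n) (r : 'rV[R]_n) :
  upper_triangular w -> (forall i, w i i != 0)%R ->
  \int[lam n]_t (phi k (v - sqn (rv t *m w + r)))%:E =
  (phiC k n / (\prod_i `|w i i|) * phi (k + n) v)%:E.
Proof.
elim: n k v w r => [|n IH] k v w r uw w0.
  rewrite /phiC !big_ord0 divr1 mul1r addn0.
  rewrite (integral_lebesgue_tuple0 (measurable_phi_quad _ _ _ _)).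
  by rewrite /sqn big_ord0 subr0.
pose f (u : 'rV[R]_n.+1) := (phi k (v - sqn (u *m w + r)))%:E.
have mf : measurable_fun setT (fun t => f (rv t)) by exact: measurable_phi_quad.
have f0 u : 0 <= f u by rewrite lee_fin phi_ge0.
rewrite (ge0_integral_rowS mf f0).
pose r0 := r ord0 ord0; pose r' : 'rV[R]_n := (\row_j r ord0 (lift ord0 j))%R.
have fE x t : f (row_cons x (rv t)) =
    (phi k ((v - (w ord0 ord0 * x + r0) ^+ 2) -
            sqn (rv t *m minor00 w + (x *: tail0 w + r'))))%:E.
  rewrite /f row_cons_mulmx//.
  have -> (a : R) (b : 'rV[R]_n) : (row_cons a b + r = row_cons (a + r0) (b + r'))%R.
    by rewrite {1}(row_consP r) row_consD.
  by rewrite sqn_row_cons opprD addrA (mulrC x) addrA.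
under eq_integral => x _.
  under eq_integral do rewrite fE.
  rewrite IH; last 2 first.
  - exact: minor00_upper.
  - by move=> i; rewrite mxE.
  over.
rewrite /=.
set c := (_ / _)%R.
have c0 : (0 <= c)%R.
  rewrite divr_ge0//; first exact/ltW/phiC_gt0.
  by apply: prodr_ge0 => i _.
rewrite (eq_integral (fun x : measurableTypeR R => c%:E * (phi (k + n) (v - (w ord0 ord0 * x + r0) ^+ 2))%:E))//.
rewrite ge0_integralZl_EFin//; last 2 first.
- by move=> x _; rewrite lee_fin phi_ge0.
- apply/measurable_EFinP.
  apply: (measurable_phi_comp (k + n) (f := fun x : measurableTypeR R => v - (w ord0 ord0 * (x : R) + r0) ^+ 2)%R).
  apply: measurable_funB => //; apply: measurable_funX; exact: measurable_affine.
rewrite integral_phi_affine// -EFinM addnS; congr (_%:E).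
rewrite /c phiCS big_ord_recl.
under eq_bigr do rewrite mxE.
rewrite invfM; ring.
Qed.

End quadratic.

(** * Fourier integrals in one variable *)
Section fourier1.
Context (R : realType).
Notation leb := (@lebesgue_measure R).

Lemma continuous_measurable_R (h : R -> R) : continuous h ->
  measurable_fun [set: measurableTypeR R] (h : measurableTypeR R -> measurableTypeR R).
Proof. by move=> ch; exact: continuous_measurable_fun. Qed.

Lemma integral_phi1 k (h : R -> R) : continuous h ->
  (\int[leb]_s (phi k (1 - s ^+ 2) * h s)%:E)%E =
  ((\int[leb]_(s in `[-1, 1]) (bweight k s * h s))%R)%:E.
Proof.
move=> ch.
have cbh : continuous (fun s => bweight k s * h s).
  by move=> s; apply: cvgM; [exact: continuous_bweight|exact: ch].
have ih := continuous_itv_integrable (-1) 1 cbh.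
rewrite /Rintegral fineK; last exact: integrable_fin_num.
rewrite [RHS]integral_itv_bndoo; last first.
  apply: measurable_funTS; apply/measurable_EFinP; exact: continuous_measurable_R.
rewrite [RHS]integral_mkcond; apply: eq_integral => s _.
rewrite patchE; case: ifPn; rewrite ?inE ?notin_setE/= in_itv/= -ltr_norml => s1.
  rewrite /bweight phi_gt0// subr_gt0 -real_normK ?num_real// exprn_ilt1//.
move/negP : s1; rewrite -leNgt => s1.
by rewrite phi_le0 ?mul0r// subr_le0 -real_normK ?num_real// exprn_ege1.
Qed.

Lemma cosD1_ge0 (x : R) : 0 <= 1 + cos x.
Proof. by rewrite -lerBlDl sub0r cos_geN1. Qed.

Lemma integrable_bweightM k (h : R -> R) : continuous h ->
  leb.-integrable `[-1, 1] (EFin \o (fun s => bweight k s * h s)).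
Proof.
move=> ch; apply: continuous_itv_integrable => s.
by apply: cvgM; [exact: continuous_bweight|exact: ch].
Qed.

(** The integrand is odd; nonnegativity of 1 + sin allows the substitution
    s |-> - s to be made in a nonnegative integral. *)
Lemma bweight_odd k (la : R) :
  (\int[leb]_(s in `[-1, 1]) (bweight k s * sin (la * s)) = 0)%R.
Proof.
have key a : (\int[leb]_s (phi k (1 - s ^+ 2) * (1 + sin (a * s)))%:E)%E =
   (((\int[leb]_(s in `[-1, 1]) (bweight k s * 1)) +
   (\int[leb]_(s in `[-1, 1]) (bweight k s * sin (a * s))))%R)%:E.
  rewrite integral_phi1; last first.
    by move=> s; apply: cvgD; [exact: cvg_cst|exact: continuous_sinM].
  rewrite -RintegralD//.
  - by congr (_%:E); apply: eq_Rintegral => s _; rewrite mulrDr.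
  - by apply: integrable_bweightM => s; exact: cvg_cst.
  - by apply: integrable_bweightM; exact: continuous_sinM.
have n1 : (-1 : R) != 0 by rewrite oppr_eq0 oner_eq0.
have mf : measurable_fun [set: measurableTypeR R] (fun s : measurableTypeR R =>
    (phi k (1 - (s : R) ^+ 2) * (1 + sin (la * (s : R))))%:E).
  apply/measurable_EFinP; apply: measurable_funM.
    by apply/measurable_EFinP; exact: measurable_phi_sqr.
  apply: continuous_measurable_R => s.
  by apply: cvgD; [exact: cvg_cst|exact: continuous_sinM].
have pos (x : R) : (0 <= (phi k (1 - x ^+ 2) * (1 + sin (la * x)))%:E)%E.
  rewrite lee_fin; apply: mulr_ge0; first exact: phi_ge0.
  by have := sin_geN1 (la * x); lra.
have := ge0_integral_affine 0 n1 mf pos.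
rewrite normrN normr1 invr1 mul1e key.
rewrite (_ : (\int[leb]_x _)%E = (\int[leb]_s (phi k (1 - s ^+ 2) * (1 + sin ((- la) * s)))%:E)%E).
  rewrite key.
  have -> : (\int[leb]_(s in `[-1, 1]) (bweight k s * sin (- la * s)) = - (\int[leb]_(s in `[-1, 1]) (bweight k s * sin (la * s))))%R.
    rewrite -[RHS]mulN1r -RintegralZl//; last by apply: integrable_bweightM; exact: continuous_sinM.
    by apply: eq_Rintegral => s _; rewrite mulNr sinN mulrN mulN1r.
  by move=> [] /addrI e; lra.
apply: eq_integral => s _; congr (_%:E).
by rewrite addr0 mulN1r sqrrN mulrN mulNr.
Qed.

Lemma bweight_cosD k (la th : R) :
  (\int[leb]_(s in `[-1, 1]) (bweight k s * cos (la * s + th)) = cos th * bcos k la)%R.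
Proof.
rewrite /bcos -RintegralZl//; last by apply: integrable_bweightM; exact: continuous_cosM.
transitivity (\int[leb]_(s in `[-1, 1]) (cos th * (bweight k s * cos (la * s)) -
   sin th * (bweight k s * sin (la * s))))%R.
  by apply: eq_Rintegral => s _; rewrite cosD; ring.
rewrite RintegralB//; last 2 first.
- apply: (continuous_itv_integrable (f := fun s => cos th * (bweight k s * cos (la * s)))) => s.
  by apply: cvgM; [exact: cvg_cst|apply: cvgM; [exact: continuous_bweight|exact: continuous_cosM]].
- apply: (continuous_itv_integrable (f := fun s => sin th * (bweight k s * sin (la * s)))) => s.
  by apply: cvgM; [exact: cvg_cst|apply: cvgM; [exact: continuous_bweight|exact: continuous_sinM]].
rewrite [X in _ - X]RintegralZl//; last by apply: integrable_bweightM; exact: continuous_sinM.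
by rewrite bweight_odd mulr0 subr0.
Qed.

Lemma continuous_cosD (la th : R) : continuous (fun s => cos (la * s + th)).
Proof.
move=> s; apply: (@continuous_comp _ _ _ (fun s => la * s + th) cos).
  by apply: cvgD; [exact: mulrl_continuous|exact: cvg_cst].
exact: continuous_cos.
Qed.

Lemma integral_phi_cos k v (la th : R) : 0 < v ->
  (\int[leb]_s (phi k (v - s ^+ 2) * (1 + cos (la * s + th)))%:E)%E =
  (phic R k * phi k.+1 v + cos th * (Num.sqrt v ^+ k.+1 * bcos k (Num.sqrt v * la)))%:E.
Proof.
move=> v0.
have sv0 : 0 < Num.sqrt v by rewrite sqrtr_gt0.
have sv0' : Num.sqrt v != 0 by rewrite gt_eqF.
have mf : measurable_fun [set: measurableTypeR R] (fun s : measurableTypeR R =>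
    (phi k (v - (s : R) ^+ 2) * (1 + cos (la * (s : R) + th)))%:E).
  apply/measurable_EFinP; apply: measurable_funM.
    by apply/measurable_EFinP; exact: measurable_phi_sqr.
  apply: continuous_measurable_R => s.
  by apply: cvgD; [exact: cvg_cst|exact: continuous_cosD].
have f0 x : (0 <= (phi k (v - x ^+ 2) * (1 + cos (la * x + th)))%:E)%E.
  by rewrite lee_fin mulr_ge0 ?phi_ge0// cosD1_ge0.
have H := ge0_integral_affine 0 sv0' mf f0; rewrite gtr0_norm// in H.
transitivity ((Num.sqrt v)%:E * ((Num.sqrt v)^-1%:E *
    \int[leb]_s (phi k (v - s ^+ 2) * (1 + cos (la * s + th)))%:E))%E.
  by rewrite muleA -EFinM divff// mul1e.
rewrite -H.
rewrite [X in (_ * X)%E](_ : _ = (\int[leb]_s ((Num.sqrt v ^+ k)%:E *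
    (phi k (1 - s ^+ 2) * (1 + cos ((Num.sqrt v * la) * s + th)))%:E))%E); last first.
  apply: eq_integral => s _; rewrite -EFinM mulrA -phiM//; congr (phi k _ * (1 + cos _))%:E.
    by rewrite addr0 exprMn sqr_sqrtr ?ltW//; ring.
  by ring.
have c1 : continuous (fun s => 1 + cos (Num.sqrt v * la * s + th)).
  by move=> s; apply: cvgD; [exact: cvg_cst|exact: continuous_cosD].
rewrite ge0_integralZl_EFin ?exprn_ge0//; last 2 first.
- by move=> s _; rewrite lee_fin mulr_ge0 ?phi_ge0// cosD1_ge0.
- apply/measurable_EFinP; apply: measurable_funM.
    by apply/measurable_EFinP; exact: measurable_phi_sqr.
  exact: continuous_measurable_R.
rewrite integral_phi1// -!EFinM; congr (_%:E).
rewrite (_ : (\int[leb]_(s in `[-1, 1]) _)%R = phic R k + cos th * bcos k (Num.sqrt v * la)).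
  by rewrite phi_gt0// exprS; ring.
transitivity (\int[leb]_(s in `[-1, 1]) ((bweight k s * 1) + (bweight k s * cos (Num.sqrt v * la * s + th))))%R.
  by apply: eq_Rintegral => s _; rewrite mulrDr.
rewrite RintegralD//; last 2 first.
- by apply: integrable_bweightM => s; exact: cvg_cst.
- by apply: integrable_bweightM; exact: continuous_cosD.
rewrite bweight_cosD; congr (_ + _).
apply: EFin_inj; rewrite -integral_phi1; last by move=> s; exact: cvg_cst.
by rewrite -phicE; apply: eq_integral => s _; rewrite mulr1.
Qed.

(** The oscillating part is [bcos] after scaling, so that [bcos_bound] applies.
    Here and below the cosine is accompanied by the constant 1, which keeps
    the integrands nonnegative. *)
Lemma integral_phi_cos_bound k : exists2 C : R, 0 <= C & forall v la th, 0 < la ->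
  exists2 x, (\int[leb]_s (phi k (v - s ^+ 2) * (1 + cos (la * s + th)))%:E)%E =
      (phic R k * phi k.+1 v + x)%:E &
    x ^+ 2 * la ^+ k.+2 <= C * Num.sqrt v ^+ k.
Proof.
have [C C0 HC] := bcos_bound R k; exists C => // v la th la0.
have [v0|v0] := leP v 0.
  exists 0; last by rewrite expr0n mul0r mulr_ge0// exprn_ge0.
  rewrite addr0 phi_le0// mulr0; apply: integral0_eq => s _.
  by rewrite phi_le0 ?mul0r// subr_le0 (le_trans v0)// sqr_ge0.
rewrite integral_phi_cos//; eexists; first by [].
set r := Num.sqrt v.
have r0 : 0 < r by rewrite sqrtr_gt0.
have rla : 0 < r * la by exact: mulr_gt0.
have h := HC _ rla; set Y := bcos k (r * la) in h *.
have c1 : cos th ^+ 2 <= 1.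
  by rewrite -(cos2Dsin2 th) lerDl sqr_ge0.
have -> : (cos th * (r ^+ k.+1 * Y)) ^+ 2 * la ^+ k.+2 =
    cos th ^+ 2 * (r ^+ k * ((r * la) ^+ k.+2 * Y ^+ 2)).
  by rewrite !exprMn !(exprS _ k.+1) !(exprS _ k); ring.
rewrite -[leRHS]mul1r ler_pM ?sqr_ge0//.
  have r0' := ltW r0; have rla' := ltW rla.
  by apply: mulr_ge0; [exact: exprn_ge0|apply: mulr_ge0; [exact: exprn_ge0|exact: sqr_ge0]].
by rewrite mulrC ler_wpM2r// exprn_ge0// ltW.
Qed.

End fourier1.

(** * Fourier integrals in several variables *)
Section householder.
Context (R : realType).

Lemma sqnE n (v : 'rV[R]_n) : sqn v = (v *m v^T) 0 0.
Proof. by rewrite /sqn mxE; apply: eq_bigr => i _; rewrite mxE expr2. Qed.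

Lemma sqn_orthogonal n (v : 'rV[R]_n) (H : 'M[R]_n) : H *m H^T = 1%:M ->
  sqn (v *m H) = sqn v.
Proof.
by move=> HH; rewrite !sqnE trmx_mul mulmxA -(mulmxA v) HH mulmx1.
Qed.

Lemma sqn_eq0 n (v : 'rV[R]_n) : (sqn v == 0) = (v == 0).
Proof.
rewrite /sqn psumr_eq0; last by move=> i _; exact: sqr_ge0.
apply/allP/eqP => [h|-> i _]; last by rewrite mxE expr0n eqxx.
by apply/rowP => i; rewrite mxE; apply/eqP; have := h i (mem_index_enum _); rewrite sqrf_eq0.
Qed.

(** The reflection in the hyperplane orthogonal to eta - |eta| e_0. *)
Lemma householder n (eta : 'cV[R]_n.+1) : eta != 0 ->
  exists2 H : 'M[R]_n.+1, H *m H^T = 1%:M &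
    H *m eta = Num.sqrt (sqn eta^T) *: delta_mx ord0 0.
Proof.
move=> eta0; set N := Num.sqrt _; pose e : 'cV[R]_n.+1 := delta_mx ord0 0.
have N2 : N ^+ 2 = sqn eta^T by rewrite sqr_sqrtr ?sqn_ge0.
pose u := eta - N *: e.
have dot (a b : 'cV[R]_n.+1) : a^T *m b = ((a^T *m b) 0 0)%:M by rewrite -mx11_scalar.
have etaeta : eta^T *m eta = (N ^+ 2)%:M by rewrite dot N2 sqnE trmxK.
have ee : e^T *m e = 1%:M.
  by rewrite trmx_delta mul_delta_mx; apply/matrixP => i j; rewrite !mxE !ord1 !eqxx.
pose c := eta ord0 0.
have ee1 : e^T *m eta = c%:M.
  apply/matrixP => i j; rewrite !ord1 mxE (bigD1 ord0)//= !mxE !eqxx mul1r big1 ?addr0// => l l0.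
  by rewrite !mxE (negbTE l0) mul0r.
have ee2 : eta^T *m e = c%:M by rewrite -[e]trmxK -trmx_mul ee1 tr_scalar_mx.
have uT : u^T = eta^T - N *: e^T by rewrite /u linearB linearZ.
have uu : u^T *m u = (2 * (N ^+ 2 - N * c))%:M.
  rewrite uT /u mulmxBr !mulmxBl -!scalemxAl -!scalemxAr etaeta ee ee1 ee2.
  rewrite !scale_scalar_mx -!raddfB/=; congr (_%:M); ring.
have ueta : u^T *m eta = (N ^+ 2 - N * c)%:M.
  by rewrite uT mulmxBl -scalemxAl etaeta ee1 scale_scalar_mx -raddfB.
have [u0|un0] := eqVneq u 0.
  exists 1%:M; first by rewrite trmx1 mulmx1.
  by rewrite mul1mx; apply/eqP; rewrite -subr_eq0 -/u u0.
set q := N ^+ 2 - N * c in uu ueta.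
have q0 : q != 0.
  apply: contra un0 => /eqP qe; rewrite -[u]trmxK -trmx0 (inj_eq (can_inj (@trmxK _ _ _))).
  by rewrite -sqn_eq0 sqnE trmxK uu qe mulr0 mxE mul0rn.
pose H : 'M[R]_n.+1 := 1%:M - q^-1 *: (u *m u^T).
have HT : H^T = H by rewrite /H linearB linearZ/= trmx1 trmx_mul trmxK.
exists H.
  rewrite HT /H mulmxBl mul1mx mulmxBr mulmx1 -scalemxAl -scalemxAr.
  rewrite mulmxA -(mulmxA u) uu -mulmxA mul_scalar_mx -scalemxAr !scalerA.
  rewrite opprB addrA [X in X - _]addrC.
  have -> : q^-1 * (q^-1 * (2 * q)) = q^-1 *+ 2 by field.
  by rewrite mulr2n scalerDl; apply/matrixP => i j; rewrite !mxE; ring.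
rewrite /H mulmxBl mul1mx -scalemxAl -mulmxA ueta mul_mx_scalar scalerA mulVf// scale1r.
by rewrite /u opprB addrC subrK.
Qed.

End householder.

Section fouriern.
Context (R : realType).
Notation leb := (@lebesgue_measure R).
Notation lam n := (lebesgue_tuple R n).
Notation rv := (@rV_of_tuple R _).

Lemma upper_unit n (w : 'M[R]_n) : upper_triangular w -> (forall i, 0 < w i i) ->
  w \in unitmx.
Proof.
move=> uw w0; rewrite unitmxE -det_tr det_trig.
  by rewrite unitfE; apply/prodf_neq0 => i _; rewrite mxE gt_eqF.
by apply/is_trig_mxP => i j ij; rewrite mxE uw.
Qed.

Lemma measurable_lin n (xi : 'cV[R]_n) d (X : measurableType d) (F : X -> 'rV[R]_n) :
  measurable_row F -> measurable_fun setT (fun x => (F x *m xi) 0 0 : R).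
Proof. by move=> mF; have := measurable_row_mulmx xi mF; exact. Qed.

Lemma measurable_cosD d (X : measurableType d) (f : X -> R) : measurable_fun setT f ->
  measurable_fun setT (fun x => 1 + cos (f x)).
Proof.
move=> mf; apply: measurable_funD => //; apply: measurableT_comp => //.
apply: continuous_measurable_fun; exact: continuous_cos.
Qed.

Lemma phi1 k : phi k 1 = 1 :> R.
Proof. by rewrite phi_gt0// sqrtr1 expr1n. Qed.

Lemma integral_phi_sqn n k v :
  (\int[lam n]_t (phi k (v - sqn (rv t)))%:E = (phiC R k n * phi (k + n) v)%:E)%E.
Proof.
have u1 : upper_triangular (1%:M : 'M[R]_n).
  by move=> i j ij; rewrite mxE gt_eqF.
have d1 i : (1%:M : 'M[R]_n) i i != 0 by rewrite mxE eqxx oner_eq0.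
have := integral_phi_triangular k v 0 u1 d1.
under eq_bigr do rewrite mxE eqxx normr1.
rewrite big1 ?divr1// => <-.
by apply: eq_integral => t _; rewrite mulmx1 addr0.
Qed.

(** Let H be a reflection that brings w^-1 xi to the first axis. Substituting
    x H w^-1 for x turns |x w|^2 into |x|^2 and the phase x xi into a multiple of the
    first coordinate of x; the other coordinates can be integrated out, which
    leaves a one-dimensional integral with exponent k + n. *)
Lemma fourier_quad n k : exists2 C : R, 0 <= C &
  forall (w : 'M[R]_n.+1) (r : 'rV[R]_n.+1) v (xi : 'cV[R]_n.+1) th,
  upper_triangular w -> (forall i, 0 < w i i) -> xi != 0 ->
  exists2 x, (\int[lam n.+1]_t (phi k (v - sqn (rv t *m w + r)) *
        (1 + cos ((rv t *m xi) 0 0 + th)))%:E)%E =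
      (phiC R k n.+1 / (\prod_i w i i) * phi (k + n.+1) v + x)%:E &
    x ^+ 2 * Num.sqrt (sqn (invmx w *m xi)^T) ^+ (k + n).+2 <=
      C / (\prod_i w i i) ^+ 2 * Num.sqrt v ^+ (k + n).
Proof.
have [C C0 HC] := integral_phi_cos_bound R (k + n).
exists (phiC R k n ^+ 2 * C); first by rewrite mulr_ge0// sqr_ge0.
move=> w r v xi th uw w0 xi0.
have wu := upper_unit uw w0.
set D := \prod_i w i i; have D0 : 0 < D by apply: prodr_gt0.
set eta := invmx w *m xi.
have eta0 : eta != 0.
  apply: contra xi0 => /eqP e; rewrite -[xi](mulKVmx wu) -/eta e mulmx0//.
have [H HH Heta] := householder eta0; set la := Num.sqrt _ in Heta.
have la0 : 0 < la.
  by rewrite sqrtr_gt0 lt_def sqn_ge0 sqn_eq0 andbT -trmx0 (inj_eq (can_inj (@trmxK _ _ _))).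
have Hu : H \in unitmx by have [] := mulmx1_unit HH.
pose h := H *m invmx w.
have hu : h \in unitmx by rewrite unitmx_mul Hu unitmx_inv.
have hw t : t *m h *m w = t *m H by rewrite /h mulmxA mulmxKV.
have hxi (t : 'rV[R]_n.+1) : (t *m h *m xi) 0 0 = la * t 0 ord0.
  rewrite -mulmxA -(mulmxA H) -/eta Heta -scalemxAr mxE; congr (_ * _).
  rewrite mxE (bigD1 ord0)//= big1 ?addr0 => [|i i0]; first by rewrite mxE !eqxx mulr1.
  by rewrite mxE (negbTE i0) mulr0.
have [kap kap0 kapP] := vol_mulmx hu.
have wn0 i : w i i != 0 by rewrite gt_eqF.
have absD : \prod_i `|w i i| = D by apply: eq_bigr => i _; rewrite gtr0_norm.
(* The Jacobian of x |-> x h, found by integrating one radial function twice. *)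
have kapD : kap = D.
  have mf : measurable_fun setT (fun t : Rtuple R n.+1 => (phi k (1 - sqn (rv t *m w)))%:E).
    by have := measurable_phi_quad k 1 w 0; under eq_fun do rewrite addr0.
  have p0 (u : 'rV[R]_n.+1) : (0 <= (phi k (1 - sqn (u *m w)))%:E)%E.
    by rewrite lee_fin phi_ge0.
  have := ge0_integral_row_mulmx (f := fun u => (phi k (1 - sqn (u *m w)))%:E) (ltW kap0) kapP mf p0.
  under eq_integral do rewrite hw sqn_orthogonal//.
  rewrite integral_phi_sqn phi1 mulr1.
  have := integral_phi_triangular k 1 0 uw wn0.
  under eq_integral do rewrite addr0.
  rewrite absD phi1 mulr1 => -> [].
  move=> e; have c0 := phiC_gt0 R k n.+1.
  have : kap / D = 1.
    have cn0 : phiC R k n.+1 != 0 by rewrite gt_eqF.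
    apply: (mulfI cn0).
    by rewrite mulr1 {2}e; ring.
  by move/(congr1 ( *%R^~ D)); rewrite mul1r divfK// gt_eqF.
pose z := - (r *m invmx w).
pose th' := (z *m xi) 0 0 + th.
pose f u := (phi k (v - sqn (u *m w + r)) * (1 + cos ((u *m xi) 0 0 + th)))%:E.
pose f2 u := (phi k (v - sqn (u *m w)) * (1 + cos ((u *m xi) 0 0 + th')))%:E.
have f0 u : (0 <= f u)%E by rewrite lee_fin mulr_ge0 ?phi_ge0// cosD1_ge0.
have f20 u : (0 <= f2 u)%E by rewrite lee_fin mulr_ge0 ?phi_ge0// cosD1_ge0.
have mfg (r' : 'rV[R]_n.+1) th0 : measurable_fun setT (fun t : Rtuple R n.+1 =>
    (phi k (v - sqn (rv t *m w + r')) * (1 + cos ((rv t *m xi) 0 0 + th0)))%:E).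
  apply/measurable_EFinP; apply: measurable_funM.
    by apply/measurable_EFinP; exact: measurable_phi_quad.
  apply: measurable_cosD; apply: measurable_funD => //.
  by apply: measurable_lin; exact: measurable_row_rv.
have mf2 : measurable_fun setT (fun t => f2 (rv t)).
  by have := mfg 0 th'; under eq_fun do rewrite addr0.
have E1 : (\int[lam n.+1]_t f (rv t) = \int[lam n.+1]_t f2 (rv t))%E.
  rewrite -(ge0_integral_row_shift z (mfg r th) f0).
  apply: eq_integral => t _; rewrite /f /f2 mulmxDl {1}/z mulNmx mulmxKV// subrK.
  by rewrite mulmxDl mxE /th' addrA.
have E2 := ge0_integral_row_mulmx (ltW kap0) kapP mf2 f20.
pose f3 (u : 'rV[R]_n.+1) := (phi k (v - sqn u) * (1 + cos (la * u 0 ord0 + th')))%:E.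
have f30 u : (0 <= f3 u)%E by rewrite lee_fin mulr_ge0 ?phi_ge0// cosD1_ge0.
have E3 : (\int[lam n.+1]_t f2 (rv t *m h) = \int[lam n.+1]_t f3 (rv t))%E.
  by apply: eq_integral => t _; rewrite /f2 /f3 hw sqn_orthogonal// hxi.
have mf3 : measurable_fun setT (fun t => f3 (rv t)).
  apply/measurable_EFinP; apply: measurable_funM.
    by apply: measurable_phi_row => //; exact: measurable_row_rv.
  apply: measurable_cosD; apply: measurable_funD => //; apply: measurable_funM => //.
  exact: measurable_row_rv.
have E4 : (\int[lam n.+1]_t f3 (rv t) =
   \int[leb]_x ((phiC R k n)%:E * (phi (k + n) (v - x ^+ 2) * (1 + cos (la * x + th')))%:E))%E.
  rewrite (ge0_integral_rowS mf3 f30); apply: eq_integral => x _.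
  rewrite (eq_integral (fun t => (1 + cos (la * x + th'))%:E * (phi k ((v - x ^+ 2) - sqn (rv t)))%:E)%E); last first.
    by move=> t _; rewrite /f3 row_cons0 sqn_row_cons opprD addrA -EFinM mulrC.
  rewrite ge0_integralZl_EFin ?cosD1_ge0//; last 2 first.
  - by move=> t _; rewrite lee_fin phi_ge0.
  - apply/measurable_EFinP; apply: measurable_phi_row => //; exact: measurable_row_rv.
  by rewrite integral_phi_sqn -!EFinM; congr (_%:E); ring.
have [x0 x0E x0B] := HC v la th' la0.
have E5 : (\int[lam n.+1]_t f3 (rv t) = (phiC R k n * (phic R (k + n) * phi (k + n).+1 v + x0))%:E)%E.
  rewrite E4 ge0_integralZl_EFin ?x0E//.
  - by move=> x _; rewrite lee_fin mulr_ge0 ?phi_ge0// cosD1_ge0.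
  - apply/measurable_EFinP; apply: measurable_funM.
      by apply/measurable_EFinP; exact: measurable_phi_sqr.
    apply: measurable_cosD; exact: measurable_affine.
  - exact/ltW/phiC_gt0.
exists (phiC R k n * x0 / D).
  have E6 : (D%:E * \int[lam n.+1]_t f (rv t) = (phiC R k n * (phic R (k + n) * phi (k + n).+1 v + x0))%:E)%E.
    by rewrite E1 -kapD -E2 E3 E5.
  have -> : (\int[lam n.+1]_t f (rv t) = (D^-1)%:E * (D%:E * \int[lam n.+1]_t f (rv t)))%E.
    by rewrite muleA -EFinM mulVf ?mul1e// gt_eqF.
  rewrite E6 -EFinM; congr (_%:E).
  by rewrite phiCS addnS; ring.
rewrite (_ : _ ^+ 2 * _ = (phiC R k n / D) ^+ 2 * (x0 ^+ 2 * la ^+ (k + n).+2)); last by ring.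
rewrite (_ : _ / _ * _ = (phiC R k n / D) ^+ 2 * (C * Num.sqrt v ^+ (k + n))).
  by rewrite ler_wpM2l// sqr_ge0.
by rewrite exprMn exprVn; ring.
Qed.

End fouriern.

(** * Fejer kernels *)
Section fejer.
Context (R : realType).
Notation leb := (@lebesgue_measure R).
Implicit Types (N A : nat) (th : R).

Definition tpi : R := 2 * pi.

Lemma cosDn th n : cos (th + tpi * n%:R) = cos th.
Proof.
rewrite (_ : tpi * n%:R = pi *+ 2 *+ n); first exact: periodicn (@cosD2pi R) n th.
by rewrite /tpi -[RHS]mulr_natr -[pi *+ 2]mulr_natr; ring.
Qed.

Lemma sinDn th n : sin (th + tpi * n%:R) = sin th.
Proof.
rewrite (_ : tpi * n%:R = pi *+ 2 *+ n); first exact: periodicn (@sinD2pi R) n th.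
by rewrite /tpi -[RHS]mulr_natr -[pi *+ 2]mulr_natr; ring.
Qed.

Lemma sinDnB th j k : sin (th + tpi * (j%:R - k%:R)) = sin th.
Proof.
have -> : th + tpi * (j%:R - k%:R) = (th - tpi * k%:R) + tpi * j%:R by ring.
by rewrite sinDn -(sinDn _ k) subrK.
Qed.

Definition dirC N (x : R) : R := \sum_(j < N) cos (tpi * j%:R * x).
Definition dirS N (x : R) : R := \sum_(j < N) sin (tpi * j%:R * x).
(** |sum over j < N of e(j x)|^2 / N, where e(x) = exp(2 pi i x). *)
Definition fejer N (x : R) : R := N%:R^-1 * (dirC N x ^+ 2 + dirS N x ^+ 2).

Lemma fejer_ge0 N x : 0 <= fejer N x.
Proof. by rewrite mulr_ge0 ?invr_ge0// addr_ge0// sqr_ge0. Qed.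

Lemma fejer_sum N x th : \sum_(j < N) \sum_(k < N) cos (th + tpi * (j%:R - k%:R) * x) =
  cos th * (dirC N x ^+ 2 + dirS N x ^+ 2).
Proof.
have -> : cos th * (dirC N x ^+ 2 + dirS N x ^+ 2) =
    cos th * (dirC N x * dirC N x + dirS N x * dirS N x) -
    sin th * (dirS N x * dirC N x - dirC N x * dirS N x) by ring.
rewrite /dirC /dirS !mulr_suml -big_split/= -sumrB !mulr_sumr -sumrB.
apply: eq_bigr => j _; rewrite !mulr_sumr -big_split/= -sumrB !mulr_sumr -sumrB.
apply: eq_bigr => k _.
rewrite (_ : th + _ = th + (tpi * j%:R * x - tpi * k%:R * x)); last by ring.
by rewrite cosD cosB sinB; ring.
Qed.

Lemma fejer_periodic N x n : fejer N (x + n%:R) = fejer N x.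
Proof.
rewrite /fejer /dirC /dirS; congr (_ * (_ ^+ 2 + _ ^+ 2)); apply: eq_bigr => j _.
  rewrite (_ : _ * (x + _) = tpi * j%:R * x + tpi * (j * n)%:R) ?cosDn// natrM; ring.
rewrite (_ : _ * (x + _) = tpi * j%:R * x + tpi * (j * n)%:R) ?sinDn// natrM; ring.
Qed.

(** A geometric sum: (e(x) - 1) times the sum of the e(j x), j < N, is
    e(N x) - 1, of modulus at most 2. *)
Lemma dirichlet_bound N x : (1 - cos (tpi * x)) * (dirC N x ^+ 2 + dirS N x ^+ 2) <= 2.
Proof.
set c := cos (tpi * x); set s := sin (tpi * x).
have cN n : cos (tpi * n.+1%:R * x) = c * cos (tpi * n%:R * x) - s * sin (tpi * n%:R * x).
  by rewrite -cosD; congr cos; rewrite -natr1; ring.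
have sN n : sin (tpi * n.+1%:R * x) = s * cos (tpi * n%:R * x) + c * sin (tpi * n%:R * x).
  by rewrite -sinD; congr sin; rewrite -natr1; ring.
have [h1 h2] : (c - 1) * dirC N x - s * dirS N x = cos (tpi * N%:R * x) - 1 /\
               (c - 1) * dirS N x + s * dirC N x = sin (tpi * N%:R * x).
  elim: N => [|N [h1 h2]].
    by rewrite /dirC /dirS !big_ord0 !mulr0 mul0r cos0 sin0; split; ring.
  rewrite /dirC /dirS !big_ord_recr/= -/(dirC N x) -/(dirS N x) cN sN; split.
    by transitivity (((c - 1) * dirC N x - s * dirS N x) + (c - 1) * cos (tpi * N%:R * x) - s * sin (tpi * N%:R * x)); [ring|rewrite h1; ring].
  by transitivity (((c - 1) * dirS N x + s * dirC N x) + (c - 1) * sin (tpi * N%:R * x) + s * cos (tpi * N%:R * x)); [ring|rewrite h2; ring].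
have cs := cos2Dsin2 (tpi * x); rewrite -/c -/s in cs.
have cs' := cos2Dsin2 (tpi * N%:R * x).
have c1 := cos_geN1 (tpi * N%:R * x).
have e : 2 * ((1 - c) * (dirC N x ^+ 2 + dirS N x ^+ 2)) =
   ((c - 1) * dirC N x - s * dirS N x) ^+ 2 + ((c - 1) * dirS N x + s * dirC N x) ^+ 2.
  transitivity (((c ^+ 2 + s ^+ 2) - 2 * c + 1) * (dirC N x ^+ 2 + dirS N x ^+ 2)); last by ring.
  by rewrite cs; ring.
rewrite h1 h2 in e; set C := cos _ in e cs' c1; set S := sin _ in e cs'.
have e2 : (C - 1) ^+ 2 + S ^+ 2 = 2 - 2 * C.
  by transitivity ((C ^+ 2 + S ^+ 2) - 2 * C + 1); [ring|rewrite cs'; ring].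
rewrite e2 in e; lra.
Qed.

Lemma cos_far (de x : R) : 0 < de -> de <= `|x| <= 2^-1 -> cos (tpi * x) <= cos (tpi * de).
Proof.
move=> de0 /andP[dx x2]; have p0 := pi_gt0 R.
have -> : cos (tpi * x) = cos (tpi * `|x|).
  by case: (ger0P x) => // _; rewrite mulrN cosN.
have tp : 0 < tpi by rewrite mulr_gt0.
have h1 : tpi * `|x| <= pi.
  by rewrite /tpi mulrAC ger_pMl//; lra.
have h2 : tpi * de <= tpi * `|x| by rewrite ler_pM2l.
have h3 : 0 <= tpi * de by rewrite mulr_ge0// ltW.
have [->//|ne] := eqVneq (tpi * de) (tpi * `|x|).
apply: ltW; rewrite ltr_cos ?lt_neqAle ?ne ?h2// in_itv/=; lra.
Qed.

Lemma cos_lt1 (de : R) : 0 < de -> de <= 2^-1 -> cos (tpi * de) < 1.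
Proof.
move=> de0 de2; have p0 := pi_gt0 R.
have tp : 0 < tpi by rewrite mulr_gt0.
have h1 : tpi * de <= pi by rewrite /tpi mulrAC ger_pMl//; lra.
have h3 : 0 < tpi * de by rewrite mulr_gt0.
rewrite -cos0 ltr_cos// in_itv/=; lra.
Qed.

Lemma fejer_far N (de x : R) : 0 < de -> de <= `|x| <= 2^-1 ->
  fejer N x <= 2 / (N%:R * (1 - cos (tpi * de))).
Proof.
move=> de0 dx; have [->|N0] := posnP N.
  by rewrite /fejer invr0 !mul0r invr0 mulr0.
have Np : (0 : R) < N%:R by rewrite ltr0n.
have c1 : cos (tpi * de) < 1.
  by apply: cos_lt1 => //; case/andP: dx => /le_trans; apply.
have h := dirichlet_bound N x.
have h2 := cos_far de0 dx.
have D0 : 0 <= dirC N x ^+ 2 + dirS N x ^+ 2 by rewrite addr_ge0// sqr_ge0.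
rewrite /fejer ler_pdivlMr ?mulr_gt0 ?subr_gt0//.
have -> : N%:R^-1 * (dirC N x ^+ 2 + dirS N x ^+ 2) * (N%:R * (1 - cos (tpi * de))) =
    (1 - cos (tpi * de)) * (dirC N x ^+ 2 + dirS N x ^+ 2).
  by field; rewrite gt_eqF.
by apply: le_trans h; apply: ler_wpM2r => //; lra.
Qed.

Lemma continuous_fejer N : continuous (fejer N).
Proof.
have cC : continuous (dirC N).
  elim: N => [|N IH] x.
    by rewrite /dirC; under eq_fun do rewrite big_ord0; exact: cvg_cst.
  rewrite /dirC; under eq_fun do rewrite big_ord_recr/=.
  by apply: cvgD; [exact: IH|exact: continuous_cosM].
have cS : continuous (dirS N).
  elim: N {cC} => [|N IH] x.
    by rewrite /dirS; under eq_fun do rewrite big_ord0; exact: cvg_cst.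
  rewrite /dirS; under eq_fun do rewrite big_ord_recr/=.
  by apply: cvgD; [exact: IH|exact: continuous_sinM].
move=> x; apply: cvgM; first exact: cvg_cst.
apply: cvgD.
  apply: (@continuous_comp _ _ _ (dirC N) (fun y => y ^+ 2)); [exact: cC|exact: exprn_continuous].
apply: (@continuous_comp _ _ _ (dirS N) (fun y => y ^+ 2)); [exact: cS|exact: exprn_continuous].
Qed.

Lemma integral_cos_period (a : R) (j k : nat) : j != k ->
  (\int[leb]_(x in `[a, (a + 1)%R]) (cos (tpi * (j%:R - k%:R) * x))%:E)%E = 0%E.
Proof.
move=> jk; set q : R := j%:R - k%:R.
have q0 : q != 0 by rewrite subr_eq0 eqr_nat.
have tp0 : tpi != 0 by rewrite mulf_neq0// gt_eqF ?pi_gt0.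
have tq0 : tpi * q != 0 by rewrite mulf_neq0.
pose G x := (tpi * q)^-1 * sin (tpi * q * x).
have dG (x : R) : is_derive x 1 G (cos (tpi * q * x)).
  rewrite /G; apply: is_derive_eq; rewrite /GRing.scale/=; field.
  by rewrite q0 tp0.
have cG : continuous G.
  by move=> x; apply: cvgM; [exact: cvg_cst|exact: continuous_sinM].
rewrite (@continuous_FTC2 _ (fun x => cos (tpi * q * x)) G).
- have -> : G (a + 1) = G a.
    by rewrite /G (mulrDr _ a) mulr1 /q sinDnB.
  by rewrite subee.
- by rewrite ltrDl.
- by apply: continuous_subspaceT; exact: continuous_cosM.
- split.
  + by move=> x _; apply: ex_derive.
  + by apply: cvg_at_right_filter; exact: cG.
  + by apply: cvg_at_left_filter; exact: cG.
- by move=> x _; rewrite derive1E derive_val.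
Qed.

Lemma integral_fejer N (a : R) : (0 < N)%N ->
  (\int[leb]_(x in `[a, (a + 1)%R[) (fejer N x)%:E)%E = 1%E.
Proof.
move=> N0; have Nn0 : (N%:R : R) != 0 by rewrite pnatr_eq0 -lt0n.
rewrite integral_itv_bndo_bndc; last first.
  apply: measurable_funTS; apply/measurable_EFinP.
  apply: continuous_measurable_R; exact: continuous_fejer.
have int1 (jk : 'I_N * 'I_N) : leb.-integrable `[a, a + 1]
    (fun x => (cos (tpi * (jk.1%:R - jk.2%:R) * x))%:E).
  by apply: continuous_itv_integrable; exact: continuous_cosM.
transitivity (\int[leb]_(x in `[a, (a + 1)%R]) ((N%:R^-1)%:E *
   \sum_(jk : 'I_N * 'I_N) (cos (tpi * (jk.1%:R - jk.2%:R) * x))%:E))%E.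
  apply: eq_integral => x _; rewrite sumEFin -EFinM; congr (_%:E).
  rewrite /fejer; congr (_ * _).
  have := fejer_sum N x 0; rewrite cos0 mul1r => <-.
  by rewrite pair_big/=; apply: eq_bigr => jk _; rewrite add0r.
rewrite integralZl//; last first.
  by apply: integrable_sum => // jk _; exact: int1.
rewrite integral_sum//.
rewrite (eq_bigr (fun jk => ((jk.1 == jk.2)%:R)%:E)); last first.
  move=> [j k] _ /=; have [->|jk] := eqVneq j k; last by rewrite integral_cos_period.
  under eq_integral do rewrite subrr mulr0 mul0r cos0.
  rewrite integral_cst// mul1e [LHS]lebesgue_measure_itv/= lte_fin ltrDl ltr01.
  by rewrite -EFinB addrAC subrr add0r.
rewrite sumEFin -(pair_big xpredT xpredT (fun j k => (j == k)%:R))/=.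
rewrite (eq_bigr (fun=> 1)) ?sumr_const ?card_ord; last first.
  move=> j _; rewrite (bigD1 j)//= eqxx big1 ?addr0// => k kj.
  by rewrite eq_sym (negbTE kj).
by rewrite -EFinM mulVf.
Qed.

End fejer.

(** * Fejer means in one variable *)
Section fejer_approx.
Context (R : realType).
Notation leb := (@lebesgue_measure R).
Implicit Types (N A : nat).

Lemma fejer_le N (x : R) : fejer N x <= (2 * N)%N%:R.
Proof.
have [->|N0] := posnP N; first by rewrite /fejer invr0 mul0r.
have bnd (f : R -> R) : (forall y, `|f y| <= 1) ->
    (\sum_(j < N) f (tpi R * j%:R * x)) ^+ 2 <= N%:R ^+ 2.
  move=> f1; rewrite -real_normK ?num_real// lerXn2r ?nnegrE//.
  apply: (le_trans (ler_norm_sum _ _ _)).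
  rewrite -[leRHS]mulr1 mulr_natl -[X in _ *+ X]card_ord -sumr_const.
  by apply: ler_sum => j _; exact: f1.
have h1 := bnd cos; have h2 := bnd sin.
rewrite /fejer mulrC ler_pdivrMr ?ltr0n//.
apply: (le_trans (lerD (h1 _) (h2 _))).
- by move=> y; rewrite ler_norml cos_geN1 cos_le1.
- by move=> y; rewrite ler_norml sin_geN1 sin_le1.
by rewrite natrM; lra.
Qed.

Lemma bounded_integrable (a b M : R) (f : R -> R) :
  measurable_fun [set: measurableTypeR R] (f : measurableTypeR R -> R) ->
  (forall x, `|f x| <= M) -> leb.-integrable `[a, b[ (EFin \o f).
Proof.
move=> mf fM; apply: measurable_bounded_integrable => //.
- rewrite [ltLHS]lebesgue_measure_itv/=; case: ifPn => // _.
  by rewrite -EFinB ltry.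
- exact: measurable_funTS.
- exists M; split; first exact: num_real.
  by move=> y My x _ /=; rewrite (le_trans (fM _))// ltW.
Qed.

Lemma Rintegral_itv_split (a : R) (n : nat) (f : R -> R) :
  (forall b c, leb.-integrable `[b, c[ (EFin \o f)) ->
  (\int[leb]_(x in `[a, a + n%:R[) f x =
   \sum_(i < n) \int[leb]_(x in `[a + i%:R, a + i%:R + 1[) f x)%R.
Proof.
move=> fi; elim: n => [|n IH].
  by rewrite big_ord0 addr0 set_itv_ge ?Rintegral_set0// -leNgt bnd_simp.
rewrite big_ord_recr/= -IH -Rintegral_setU//.
- congr (Rintegral _ _ _); rewrite -itv_bndbnd_setU ?bnd_simp ?lerDl//.
  by rewrite -natr1 addrA.
- rewrite -itv_bndbnd_setU ?bnd_simp ?lerDl//; exact: fi.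
- apply/disj_setPS => x /= []; rewrite !in_itv/= => /andP[_ h1] /andP[h2 _].
  by move: (lt_le_trans h1 h2); rewrite ltxx.
Qed.

(** Cut the line into unit intervals centred at the integers. On each of them
    the kernel has integral 1 and is small beyond the distance de from the centre. *)
Lemma fejer_approx1 N A (M e de : R) (f : R -> R) :
  (0 < N)%N -> 0 < de -> de <= 2^-1 ->
  measurable_fun [set: measurableTypeR R] (f : measurableTypeR R -> R) ->
  (forall x, `|f x| <= M) -> (forall x, A%:R <= `|x| -> f x = 0) ->
  (forall x i, `|x - (i%:R - A%:R)| <= de -> `|f x - f (i%:R - A%:R)| <= e) ->
  exists2 y, (\int[leb]_x (f x * fejer N x)%:E = y%:E)%E &
    `|y - \sum_(i < (2 * A)%N.+1) f (i%:R - A%:R)| <=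
    (2 * A)%N.+1%:R * (e + 4 * M / (N%:R * (1 - cos (tpi R * de)))).
Proof.
move=> N0 de0 de2 mf fM fA fe.
have mK : measurable_fun [set: measurableTypeR R] (fejer N : measurableTypeR R -> R).
  by apply: continuous_measurable_R; exact: continuous_fejer.
have M0 : 0 <= M by exact: le_trans (fM 0).
have e0 : 0 <= e by apply: le_trans (fe (0%:R - A%:R) 0%N _) => //; rewrite subrr normr0 ltW.
have Kb (x : R) : `|fejer N x| <= (2 * N)%N%:R.
  by rewrite ger0_norm ?fejer_ge0// fejer_le.
pose g x := f x * fejer N x.
have mg : measurable_fun [set: measurableTypeR R] (g : measurableTypeR R -> R).
  exact: measurable_funM.
have gi b c : leb.-integrable `[b, c[ (EFin \o g).
  apply: (@bounded_integrable _ _ (M * (2 * N)%N%:R)) => // x.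
  by rewrite normrM ler_pM.
have Ki b c : leb.-integrable `[b, c[ (EFin \o fejer N).
  by apply: (@bounded_integrable _ _ ((2 * N)%N%:R)).
pose a : R := - A%:R - 2^-1.
have AE : (2 * A)%N.+1%:R = 2 * A%:R + 1 :> R by rewrite -natr1 natrM.
have supp : (\int[leb]_x (g x)%:E = \int[leb]_(x in `[a, (a + (2 * A)%N.+1%:R)%R[) (g x)%:E)%E.
  rewrite [RHS]integral_mkcond; apply: eq_integral => x _; rewrite patchE.
  case: ifPn => //; rewrite notin_setE/= in_itv/= => /negP xI.
  rewrite /g fA ?mul0r//; rewrite leNgt; apply: contra xI.
  by rewrite ltr_norml /a AE => /andP[? ?]; apply/andP; split; lra.
exists (\int[leb]_(x in `[a, a + (2 * A)%N.+1%:R[) g x)%R.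
  by rewrite supp /Rintegral fineK// integrable_fin_num.
rewrite Rintegral_itv_split// -sumrB.
apply: (le_trans (ler_norm_sum _ _ _)).
rewrite -[(2 * A)%N.+1 in leRHS]card_ord mulr_natl -sumr_const.
apply: ler_sum => i _.
set I := `[_, _[%classic; set m := i%:R - A%:R; set D := N%:R * _.
have D0 : 0 < D.
  by rewrite mulr_gt0 ?ltr0n// subr_gt0 cos_lt1.
have mI : measurable (I : set (measurableTypeR R)) by exact: measurable_itv.
have K1 : (\int[leb]_(x in I) fejer N x = 1)%R by rewrite /Rintegral integral_fejer.
have -> : f m = (\int[leb]_(x in I) (f m * fejer N x))%R.
  rewrite RintegralZl//; last exact: Ki.
  by transitivity (f m * 1); [rewrite mulr1|congr (_ * _); exact: esym K1].
have fKi : leb.-integrable I (EFin \o (fun x => f m * fejer N x)).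
  apply: (@bounded_integrable _ _ (M * (2 * N)%N%:R)) => [|x].
    by apply: measurable_funM.
  by rewrite normrM ler_pM.
rewrite -RintegralB//; last exact: gi.
have di : leb.-integrable I (EFin \o (fun x => g x - f m * fejer N x)).
  apply: (@bounded_integrable _ _ ((M + M) * (2 * N)%N%:R)) => [|x].
    by apply: measurable_funB => //; apply: measurable_funM.
  rewrite -mulrBl normrM ler_pM// (le_trans (ler_normB _ _))// lerD//.
apply: (le_trans (le_normr_Rintegral mI di)).
have ci : leb.-integrable I (EFin \o (fun=> 4 * M / D)).
  apply: (@bounded_integrable _ _ (`|4 * M / D|)) => [|x]; first exact: measurable_cst.
  exact: lexx.
have eKi : leb.-integrable I (EFin \o (fun x => e * fejer N x)).
  apply: (@bounded_integrable _ _ (e * (2 * N)%N%:R)) => [|x].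
    by apply: measurable_funM.
  by rewrite normrM ler_pM// ger0_norm.
have bi : leb.-integrable I (EFin \o (fun x => e * fejer N x + 4 * M / D)).
  apply: (@bounded_integrable _ _ (e * (2 * N)%N%:R + `|4 * M / D|)) => [|x].
    by apply: measurable_funD => //; apply: measurable_funM.
  rewrite (le_trans (ler_normD _ _))// lerD// normrM ler_pM//.
  by rewrite ger0_norm.
have ai : leb.-integrable I (EFin \o (fun x => `|g x - f m * fejer N x|)).
  apply: (@bounded_integrable _ _ ((M + M) * (2 * N)%N%:R)) => [|x].
    apply: measurableT_comp => //.
    by apply: measurable_funB => //; apply: measurable_funM.
  rewrite normr_id -mulrBl normrM ler_pM// (le_trans (ler_normB _ _))// lerD//.
apply: (@le_trans _ _ (\int[leb]_(x in I) (e * fejer N x + 4 * M / D))%R); last first.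
  rewrite RintegralD// lerD//.
    rewrite RintegralZl//; last exact: Ki.
    apply: (@le_trans _ _ (e * 1)); last by rewrite mulr1.
    by apply: ler_wpM2l => //; move/eqP : K1; rewrite eq_le => /andP[].
  rewrite Rintegral_cst//.
  rewrite [X in _ * fine X](_ : _ = 1%E) ?mulr1//.
  rewrite [LHS]lebesgue_measure_itv/= lte_fin ltrDl ltr01.
  by rewrite -EFinB addrAC subrr add0r.
apply: le_Rintegral => // x; rewrite /I/= in_itv/= => /andP[x1 x2].
rewrite /g -mulrBl normrM (ger0_norm (fejer_ge0 _ _)).
have xm : `|x - m| <= 2^-1.
  by rewrite ler_norml /m; move: x1 x2; rewrite /a => *; apply/andP; split; lra.
have [near|far] := leP `|x - m| de.
  rewrite -[leLHS]addr0 lerD//; last by apply: divr_ge0; [exact: mulr_ge0|exact: ltW].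
  by rewrite ler_wpM2r ?fejer_ge0// fe.
rewrite -[leLHS]add0r lerD//; first by rewrite mulr_ge0// fejer_ge0.
have Kx : fejer N x <= 2 / D.
  have -> : fejer N x = fejer N (x - m).
    rewrite -(fejer_periodic _ _ i) -[in RHS](fejer_periodic _ (x - m) i).
    rewrite -[LHS](fejer_periodic _ _ 0) /m.
    rewrite (_ : x - (i%:R - A%:R) + i%:R = x + A%:R); last by ring.
    by rewrite !fejer_periodic.
  by apply: fejer_far => //; rewrite (ltW far).
rewrite (_ : 4 * M / D = (M + M) * (2 / D)); last by field; rewrite gt_eqF.
by rewrite ler_pM ?fejer_ge0// (le_trans (ler_normB _ _))// lerD.
Qed.

End fejer_approx.

(** * Fejer means in several variables *)
Lemma big_row0 (I : finType) (V : nmodType) (G : 'rV[I]_0 -> V) (m0 : 'rV[I]_0) :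
  \sum_m G m = G m0.
Proof.
rewrite (bigD1 m0)//= big1 ?addr0// => m /eqP mm0.
by exfalso; apply: mm0; apply/rowP => -[].
Qed.

Lemma big_row_cons (I : finType) (V : nmodType) n (G : 'rV[I]_n.+1 -> V) :
  \sum_m G m = \sum_a \sum_m G (row_cons a m).
Proof.
rewrite pair_big/= (reindex (fun p : I * 'rV[I]_n => row_cons p.1 p.2))//=.
exists (fun m => (m 0 ord0, \row_i m 0 (lift ord0 i))) => [[a m] _|m _] /=.
  rewrite row_cons0; congr (_, _); apply/rowP => i.
  by rewrite mxE row_consS.
by rewrite -row_consP.
Qed.

Section fejer_multi.
Context (R : realType).
Notation leb := (@lebesgue_measure R).
Notation lam n := (lebesgue_tuple R n).
Notation rv := (@rV_of_tuple R _).
Implicit Types (N A : nat).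

Definition ivec A n K (m : 'rV['I_K]_n) : 'rV[R]_n := \row_i ((m 0 i)%:R - A%:R).

Lemma ivec_cons A n K (a : 'I_K) (m : 'rV['I_K]_n) :
  ivec A (row_cons a m) = row_cons (a%:R - A%:R) (ivec A m).
Proof.
apply/rowP => i; rewrite mxE; case: (unliftP ord0 i) => [j ->|->].
  by rewrite !row_consS mxE.
by rewrite !row_cons0.
Qed.

(** A class of functions stable under fixing the first coordinate, with the
    same bound M and modulus of continuity om: this is what makes
    the induction on the dimension in [fejern_approx] uniform in the slice. *)
Definition tame A (M : R) (om : R -> R) n (F : 'rV[R]_n -> R) :=
  [/\ measurable_fun setT (fun t => F (rv t)), forall v, 0 <= F v <= M,
      forall (v : 'rV[R]_n) i, A%:R <= `|v 0 i| -> F v = 0 &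
      forall e (u v : 'rV[R]_n), 0 < e -> (forall i, `|u 0 i - v 0 i| <= om e) -> `|F u - F v| <= e].

Definition fejern N n (v : 'rV[R]_n) : R := \prod_i fejer N (v 0 i).

Lemma fejern_ge0 N n (v : 'rV[R]_n) : 0 <= fejern N v.
Proof. by apply: prodr_ge0 => i _; exact: fejer_ge0. Qed.

Lemma fejern_cons N n x (v : 'rV[R]_n) : fejern N (row_cons x v) = fejer N x * fejern N v.
Proof.
rewrite /fejern big_ord_recl row_cons0; congr (_ * _).
by apply: eq_bigr => i _; rewrite row_consS.
Qed.

Lemma measurable_fejern d (X : measurableType d) N n (G : X -> 'rV[R]_n) :
  measurable_row G -> measurable_fun setT (fun x => fejern N (G x)).
Proof.
move=> mG; apply: measurable_prod => i _.
have mK : measurable_fun [set: measurableTypeR R] (fejer N : measurableTypeR R -> R).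
  by apply: continuous_measurable_R; exact: continuous_fejer.
by apply: (measurableT_comp mK); exact: mG.
Qed.

Lemma tame_slice A (M : R) om n (F : 'rV[R]_n.+1 -> R) x :
  (forall e, 0 < e -> 0 <= om e) ->
  tame A M om F -> tame A M om (fun v => F (row_cons x v)).
Proof.
move=> om0 [mF F0 FA Fom]; split=> //.
- apply: (measurable_fun_row (F := fun t => row_cons x (rv t))) => //.
  by apply: measurable_row_cons => //; exact: measurable_row_rv.
- by move=> v i vi; apply: (FA _ (lift ord0 i)); rewrite row_consS.
- move=> e u v e0 uv; apply: Fom => // i; case: (unliftP ord0 i) => [j ->|->].
    by rewrite !row_consS.
  by rewrite !row_cons0 subrr normr0 om0.
Qed.

Lemma sumr_const_le (I : finType) (f : I -> R) (c : R) :
  (forall i, f i <= c) -> \sum_i f i <= #|I|%:R * c.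
Proof.
by move=> fc; rewrite mulr_natl -sumr_const; apply: ler_sum.
Qed.

(** Integrating F over all the coordinates but the first gives, by induction, a
    function of the first coordinate that is uniformly close to the sum of F
    over the integer points of the slice; then [fejer_approx1] applies to it. *)
Lemma fejern_approx n A (M : R) om (e : R) : (forall e, 0 < e -> 0 < om e) -> 0 < e ->
  exists N0, forall N, (N0 <= N)%N -> (0 < N)%N ->
    forall F : 'rV[R]_n -> R, tame A M om F ->
    exists2 y, (\int[lam n]_t (F (rv t) * fejern N (rv t))%:E = y%:E)%E &
      `|y - \sum_(m : 'rV['I_(2 * A)%N.+1]_n) F (ivec A m)| <= e.
Proof.
move=> om0; elim: n e => [|n IH] e e0.
  exists 0%N => N _ N0 F [mF _ _ _]; exists (F 0).
    rewrite integral_lebesgue_tuple0; last first.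
      apply/measurable_EFinP; apply: measurable_funM => //.
      by apply: measurable_fejern; exact: measurable_row_rv.
    rewrite /fejern big_ord0 mulr1; congr (F _)%:E; by apply/rowP => -[].
  rewrite (big_row0 _ (const_mx ord0)) (_ : ivec _ _ = 0) ?subrr ?normr0 ?ltW//.
  by apply/rowP => -[].
set K := (2 * A)%N.+1; have K0 : (0 : R) < K%:R by rewrite ltr0n.
pose e1 := e / (5 * K%:R); have e10 : 0 < e1 by rewrite divr_gt0// mulr_gt0.
have [N1 IHN] := IH _ e10.
pose T := #|{: 'rV['I_K]_n}|; have T0 : (0 : R) < T%:R.
  by rewrite ltr0n; apply/card_gt0P; exists (const_mx ord0).
pose e2 := e1 / T%:R; have e20 : 0 < e2 by rewrite divr_gt0.
pose M1 := T%:R * M + e1.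
pose de := Num.min (om e2) 2^-1.
have de0 : 0 < de by rewrite lt_min om0//= invr_gt0.
have de2 : de <= 2^-1 by rewrite ge_min lexx orbT.
pose s := 1 - cos (tpi R * de); have s0 : 0 < s by rewrite subr_gt0 cos_lt1.
pose N2 := (Num.truncn (4 * M1 / (s * e1))).+1.
exists (maxn N1 N2) => N; rewrite geq_max => /andP[N1N N2N] N0 F tF.
have [mF F0 FA Fom] := tF.
have Np : (0 : R) < N%:R by rewrite ltr0n.
pose h v := (F v * fejern N v)%:E.
have h0 v : (0 <= h v)%E.
  by rewrite lee_fin mulr_ge0 ?fejern_ge0//; have /andP[] := F0 v.
have mh : measurable_fun setT (fun t => h (rv t)).
  apply/measurable_EFinP; apply: measurable_funM => //.
  by apply: measurable_fejern; exact: measurable_row_rv.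
pose phix x := fine (\int[lam n]_t (F (row_cons x (rv t)) * fejern N (rv t))%:E)%E.
pose psi x := \sum_(m : 'rV['I_K]_n) F (row_cons x (ivec A m)).
have om0' e' : 0 < e' -> 0 <= om e' by move=> ?; exact/ltW/om0.
have phiE x : (\int[lam n]_t (F (row_cons x (rv t)) * fejern N (rv t))%:E)%E = (phix x)%:E.
  by have [y yE _] := IHN N N1N N0 _ (tame_slice x om0' tF); rewrite /phix yE.
have phipsi x : `|phix x - psi x| <= e1.
  by have [y yE] := IHN N N1N N0 _ (tame_slice x om0' tF); rewrite /phix yE.
have slE x : (\int[lam n]_t h (row_cons x (rv t)))%E = (fejer N x * phix x)%:E.
  rewrite EFinM -phiE -ge0_integralZl_EFin ?fejer_ge0//.
  - by apply: eq_integral => t _; rewrite /h fejern_cons -EFinM; congr (_%:E); ring.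
  - by move=> t _; rewrite lee_fin mulr_ge0 ?fejern_ge0//; have /andP[] := F0 (row_cons x (rv t)).
  - apply/measurable_EFinP; apply: measurable_funM.
      by have [] := tame_slice x om0' tF.
    by apply: measurable_fejern; exact: measurable_row_rv.
have M0 : 0 <= M by have /andP[h1 h2] := F0 0; exact: le_trans h2.
have psib x : `|psi x| <= T%:R * M.
  rewrite ger0_norm; last by apply: sumr_ge0 => m _; have /andP[] := F0 (row_cons x (ivec A m)).
  by apply: sumr_const_le => m; have /andP[] := F0 (row_cons x (ivec A m)).
have phib x : `|phix x| <= M1.
  rewrite -(subrK (psi x) (phix x)) addrC (le_trans (ler_normD _ _))//.
  by rewrite lerD.
have mphi : measurable_fun [set: measurableTypeR R] (phix : measurableTypeR R -> R).
  have mg : measurable_fun setT (fun t => (F (rv t) * fejern N (\row_i (rv t) 0 (lift ord0 i)))%:E).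
    apply/measurable_EFinP; apply: measurable_funM => //.
    apply: measurable_fejern => i.
    have := @measurable_row_rv R n.+1 (lift ord0 i).
    by apply: eq_measurable_fun => t _; rewrite mxE.
  have g0 (v : 'rV[R]_n.+1) : (0 <= (F v * fejern N (\row_i v 0 (lift ord0 i)))%:E)%E.
    by rewrite lee_fin mulr_ge0 ?fejern_ge0//; have /andP[] := F0 v.
  have := measurable_integral_row_cons (f := fun v => (F v * fejern N (\row_i v 0 (lift ord0 i)))%:E) mg g0.
  move=> mI; apply/measurable_EFinP; move: mI; apply: eq_measurable_fun => x _ /=.
  rewrite -phiE; apply: eq_integral => t _.
  congr (F _ * fejern N _)%:E; apply/rowP => i.
  by rewrite mxE row_consS.
have phiA x : A%:R <= `|x| -> phix x = 0.
  move=> Ax; rewrite /phix integral0_eq// => t _.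
  by rewrite (FA _ ord0) ?mul0r// row_cons0.
have phio x i : `|x - (i%:R - A%:R)| <= de -> `|phix x - phix (i%:R - A%:R)| <= 3 * e1.
  set z := i%:R - A%:R => xz.
  have pp : `|psi x - psi z| <= e1.
    rewrite /psi -sumrB (le_trans (ler_norm_sum _ _ _))//.
    rewrite (_ : e1 = T%:R * e2); last by rewrite /e2 mulrC divfK// gt_eqF.
    apply: sumr_const_le => m; apply: Fom => // j; case: (unliftP ord0 j) => [l ->|->].
      by rewrite !row_consS subrr normr0 om0'.
    by rewrite !row_cons0 (le_trans xz)// ge_min lexx.
  have := phipsi x; have := phipsi z; move: pp; rewrite !ler_norml.
  move=> /andP[? ?] /andP[? ?] /andP[? ?]; apply/andP; split; lra.
have [y yE yB] := fejer_approx1 N0 de0 de2 mphi phib phiA phio.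
exists y.
  rewrite (ge0_integral_rowS mh h0) -yE; apply: eq_integral => x _.
  by rewrite slE mulrC.
rewrite big_row_cons.
have -> : \sum_(a < K) \sum_(m : 'rV['I_K]_n) F (ivec A (row_cons a m)) =
    \sum_(a < K) psi (a%:R - A%:R).
  by apply: eq_bigr => a _; apply: eq_bigr => m _; rewrite ivec_cons.
have h1 : `|\sum_(a < K) phix (a%:R - A%:R) - \sum_(a < K) psi (a%:R - A%:R)| <= K%:R * e1.
  rewrite -sumrB (le_trans (ler_norm_sum _ _ _))// -[in K%:R](card_ord K).
  by apply: sumr_const_le.
have h2 : 4 * M1 / (N%:R * s) <= e1.
  have : 4 * M1 / (s * e1) <= N%:R.
    apply: (@le_trans _ _ N2%:R); last by rewrite ler_nat.
    by apply: ltW; exact: truncnS_gt.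
  have se : 0 < s * e1 by exact: mulr_gt0.
  have Ns : 0 < N%:R * s by exact: mulr_gt0.
  rewrite (ler_pdivrMr _ _ se) => hN; rewrite (ler_pdivrMr _ _ Ns); apply: le_trans hN _.
  by rewrite le_eqVlt; apply/orP; left; apply/eqP; ring.
have h3 : K%:R * (3 * e1 + 4 * M1 / (N%:R * s)) <= K%:R * (4 * e1).
  by apply: ler_wpM2l; [exact: ltW|lra].
have h4 : 5 * (K%:R * e1) = e by rewrite /e1; field; rewrite gt_eqF.
have := le_trans yB h3; move: h1.
rewrite !ler_norml => /andP[? ?] /andP[? ?]; apply/andP; split; lra.
Qed.

End fejer_multi.

(** * Poisson summation by Fejer means *)
Section poisson.
Context (R : realType).
Notation leb := (@lebesgue_measure R).
Notation lam n := (lebesgue_tuple R n).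
Notation rv := (@rV_of_tuple R _).
Implicit Types (N A : nat).

Definition freq N n (J K : 'rV['I_N]_n) : 'cV[R]_n :=
  \col_i (tpi R * ((J 0 i)%:R - (K 0 i)%:R)).

Lemma freq_cons N n x (v : 'rV[R]_n) a b (J K : 'rV['I_N]_n) :
  (row_cons x v *m freq (row_cons a J) (row_cons b K)) 0 0 =
  tpi R * (a%:R - b%:R) * x + (v *m freq J K) 0 0.
Proof.
have fE m (J' K' : 'rV['I_N]_m) i : freq J' K' i 0 = tpi R * ((J' 0 i)%:R - (K' 0 i)%:R).
  by rewrite mxE.
rewrite ![(_ *m _) _ _]mxE big_ord_recl fE !row_cons0 mulrC; congr (_ + _).
by apply: eq_bigr => i _; rewrite !fE !row_consS.
Qed.

Lemma fejern_sum N n (v : 'rV[R]_n) th : (0 < N)%N ->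
  \sum_(J : 'rV['I_N]_n) \sum_(K : 'rV['I_N]_n) cos (th + (v *m freq J K) 0 0) =
  cos th * (N%:R ^+ n * fejern N v).
Proof.
move=> N0; elim: n v th => [|n IH] v th.
  rewrite !(big_row0 _ (const_mx (Ordinal N0))) /fejern big_ord0 expr0 !mulr1.
  by rewrite mxE big_ord0 addr0.
rewrite (row_consP v); set x := v 0 ord0; set v' := \row_i _.
rewrite big_row_cons.
transitivity (\sum_(a < N) \sum_(b < N) \sum_(J : 'rV['I_N]_n) \sum_(K : 'rV['I_N]_n)
    cos ((th + tpi R * (a%:R - b%:R) * x) + (v' *m freq J K) 0 0)).
  apply: eq_bigr => a _; rewrite [RHS]exchange_big/=; apply: eq_bigr => J _.
  rewrite big_row_cons; apply: eq_bigr => b _; apply: eq_bigr => K _.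
  by rewrite freq_cons addrA.
under eq_bigr => a _ do under eq_bigr => b _ do rewrite IH.
under eq_bigr => a _ do rewrite -mulr_suml.
rewrite -mulr_suml fejer_sum fejern_cons (exprS _ n) /fejer; field.
by rewrite pnatr_eq0 -lt0n.
Qed.

Lemma sumr_cst (I : finType) (c : R) : \sum_(i : I) c = #|I|%:R * c.
Proof. by rewrite sumr_const mulr_natl. Qed.

Lemma measurable_tame_cos n A M om (F : 'rV[R]_n -> R) (xi : 'cV[R]_n) : tame A M om F ->
  measurable_fun setT (fun t : Rtuple R n => (F (rv t) * (1 + cos ((rv t *m xi) 0 0)))%:E).
Proof.
move=> [mF _ _ _]; apply/measurable_EFinP; apply: measurable_funM => //.
by apply: measurable_cosD; apply: measurable_lin; exact: measurable_row_rv.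
Qed.

(** Poisson summation as an inequality. The product Fejer kernel is N^-n times
    the sum of the cosines of the frequencies [freq J K]. Integrated against it,
    F gives on one side nearly the sum of F over the integer points, on the other
    I0 from the diagonal J = K and, for each J, at most B from the K != J. *)
Lemma poisson_bound n A (M : R) om (F : 'rV[R]_n -> R) (I0 B : R)
    (b : forall N, 'rV['I_N]_n -> 'rV['I_N]_n -> R) :
  (forall e, 0 < e -> 0 < om e) -> tame A M om F ->
  (\int[lam n]_t (F (rv t))%:E = I0%:E)%E ->
  (forall N (J K : 'rV['I_N]_n), J != K -> exists2 x,
    (\int[lam n]_t (F (rv t) * (1 + cos ((rv t *m freq J K) 0 0)))%:E = (I0 + x)%:E)%E &
    `|x| <= b N J K) ->
  (forall N (J : 'rV['I_N]_n), \sum_(K | K != J) b N J K <= B) ->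
  `|\sum_(m : 'rV['I_(2 * A)%N.+1]_n) F (ivec R A m) - I0| <= B.
Proof.
move=> om0 tF FI xb bB.
have [mF F0 _ _] := tF.
have F0' v : 0 <= F v by have /andP[] := F0 v.
apply/ler_addgt0Pr => e e0.
have [N0 HN] := fejern_approx n A M om0 e0.
pose N := N0.+1; have Npos : (0 < N)%N by [].
have [y yE yS] := HN N (leqnSn _) Npos F tF.
have Np : (0 : R) < N%:R by rewrite ltr0n.
pose P : R := N%:R ^+ n; have P0 : 0 < P by exact: exprn_gt0.
pose X (J K : 'rV['I_N]_n) :=
  fine (\int[lam n]_t (F (rv t) * (1 + cos ((rv t *m freq J K) 0 0)))%:E)%E - I0.
have XE J K : (\int[lam n]_t (F (rv t) * (1 + cos ((rv t *m freq J K) 0 0)))%:E =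
    (I0 + X J K)%:E)%E.
  have [->|JK] := eqVneq J K; last first.
    by have [x xE _] := xb N J K JK; rewrite /X xE/=; congr (_%:E); ring.
  have E : (\int[lam n]_t (F (rv t) * (1 + cos ((rv t *m freq K K) 0 0)))%:E = (2 * I0)%:E)%E.
    rewrite EFinM -FI -ge0_integralZl_EFin//; last 2 first.
    - by move=> t _; rewrite lee_fin.
    - exact/measurable_EFinP.
    apply: eq_integral => t _; rewrite -EFinM; congr (_%:E).
    rewrite (_ : freq K K = 0) ?mulmx0 ?mxE ?cos0; first by ring.
    by apply/colP => i; rewrite !mxE subrr mulr0.
  by rewrite /X E/=; congr (_%:E); ring.
have XJJ J : X J J = I0.
  apply: (addrI I0); apply: EFin_inj; rewrite -XE.
  rewrite -mulr2n -mulr_natl EFinM -FI -ge0_integralZl_EFin//; last 2 first.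
  - by move=> t _; rewrite lee_fin.
  - exact/measurable_EFinP.
  apply: eq_integral => t _; rewrite -EFinM; congr (_%:E).
  rewrite (_ : freq J J = 0) ?mulmx0 ?mxE ?cos0; first by ring.
  by apply/colP => i; rewrite !mxE subrr mulr0.
have Xb J K : K != J -> `|X J K| <= b N J K.
  rewrite eq_sym => JK; have [x xE xle] := xb N J K JK.
  by rewrite /X xE/= addrAC subrr add0r.
have cardP : #|{: 'rV['I_N]_n}|%:R = P.
  by rewrite card_mx card_ord mul1n natrX.
(* P^2 copies of the constant 1 are added to make all the terms nonnegative. *)
have main : P * y + P ^+ 2 * I0 = \sum_(J : 'rV['I_N]_n) \sum_(K : 'rV['I_N]_n) (I0 + X J K).
  apply: EFin_inj.
  rewrite -sumEFin; under [RHS]eq_bigr => J _ do rewrite -sumEFin.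
  under [RHS]eq_bigr => J _ do under eq_bigr => K _ do rewrite -XE.
  under [RHS]eq_bigr => J _.
    rewrite -ge0_integral_sum//; last 2 first.
    - by move=> K; exact: measurable_tame_cos tF.
    - by move=> K t _; rewrite lee_fin mulr_ge0// cosD1_ge0.
    over.
  rewrite -ge0_integral_sum//; last 2 first.
  - by move=> J; apply: emeasurable_sum => K; exact: measurable_tame_cos tF.
  - by move=> J t _; apply: sume_ge0 => K _; rewrite lee_fin mulr_ge0// cosD1_ge0.
  have mFf : measurable_fun setT (fun t => (F (rv t) * fejern N (rv t))%:E).
    apply/measurable_EFinP; apply: measurable_funM => //.
    by apply: measurable_fejern; exact: measurable_row_rv.
  have mFE : measurable_fun setT (fun t => (F (rv t))%:E) by exact/measurable_EFinP.
  have Ff0 t : (0 <= (F (rv t) * fejern N (rv t))%:E)%E.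
    by rewrite lee_fin mulr_ge0// fejern_ge0.
  have FE0 t : (0 <= (F (rv t))%:E)%E by rewrite lee_fin.
  have P2 : 0 <= P ^+ 2 by exact: sqr_ge0.
  rewrite EFinD !EFinM -yE -FI.
  rewrite -(ge0_integralZl_EFin _ measurableT (fun t _ => Ff0 t) mFf (ltW P0)).
  rewrite -EFinM -(ge0_integralZl_EFin _ measurableT (fun t _ => FE0 t) mFE P2).
  rewrite -ge0_integralD//; last 4 first.
  - by move=> t _; rewrite mule_ge0// lee_fin ltW.
  - exact: measurable_funeM.
  - by move=> t _; rewrite mule_ge0// lee_fin.
  - exact: measurable_funeM.
  apply: eq_integral => t _; rewrite -!EFinM -EFinD.
  under [RHS]eq_bigr => J _ do rewrite sumEFin.
  rewrite sumEFin; congr (_%:E).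
  under [RHS]eq_bigr => J _ do rewrite -mulr_sumr.
  rewrite -mulr_sumr.
  have -> : \sum_(J : 'rV['I_N]_n) \sum_(K : 'rV['I_N]_n) (1 + cos ((rv t *m freq J K) 0 0)) =
      P ^+ 2 + P * fejern N (rv t).
    transitivity (\sum_(J : 'rV['I_N]_n) (P + \sum_(K : 'rV['I_N]_n) cos (0 + (rv t *m freq J K) 0 0))).
      apply: eq_bigr => J _; rewrite big_split/= sumr_cst mulr1 -cardP; congr (_ + _).
      by apply: eq_bigr => K _; rewrite add0r.
    rewrite big_split/= sumr_cst fejern_sum// cos0 mul1r cardP.
    by rewrite expr2.
  by ring.
have {}main : P * (y - I0) = \sum_(J : 'rV['I_N]_n) \sum_(K | K != J) X J K.
  have : P * y + P ^+ 2 * I0 = P ^+ 2 * I0 + P * I0 + \sum_(J : 'rV['I_N]_n) \sum_(K | K != J) X J K.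
    rewrite main.
    transitivity (\sum_(J : 'rV['I_N]_n) ((P * I0 + I0) + \sum_(K | K != J) X J K)).
      apply: eq_bigr => J _; rewrite big_split/= sumr_cst cardP.
      by rewrite (bigD1 J)//= XJJ addrA.
    by rewrite big_split/= sumr_cst cardP; congr (_ + _); ring.
  lra.
have yI : `|y - I0| <= B.
  rewrite -(ler_pM2l P0) -{1}(gtr0_norm P0) -normrM main.
  apply: (le_trans (ler_norm_sum _ _ _)); rewrite -cardP; apply: sumr_const_le => J.
  apply: (le_trans (ler_norm_sum _ _ _)); apply: le_trans (bB N J).
  by apply: ler_sum => K; exact: Xb.
set S := \sum_(m : _) _ in yS *.
have -> : S - I0 = (y - I0) - (y - S) by ring.
by rewrite (le_trans (ler_normB _ _))// lerD.
Qed.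

End poisson.

(** * Summable weights and moduli of continuity *)
Section weights.
Context (R : realType).

Definition pweight (s : R) (a : nat) : R := (maxn 1 a)%:R `^ (- s).

(** The convexity bound that replaces the comparison of a sum with an integral. *)
Lemma powR_telescope (de x : R) : 0 < de -> 1 < x ->
  de * x `^ (- (1 + de)) <= (x - 1) `^ (- de) - x `^ (- de).
Proof.
move=> de0 x1; have x0 : 0 < x by lra.
have xm : 0 < x - 1 by lra.
have E : (x - 1) `^ (- de) = x `^ (- de) * expR (de * (ln x - ln (x - 1))).
  rewrite /powR !gt_eqF// -expRD; congr expR; ring.
have l1 : x^-1 <= ln x - ln (x - 1).
  have := expR_ge1Dx (ln (x - 1) - ln x).
  rewrite expRD expRN !lnK ?posrE// => h.
  have : (x - 1) / x = 1 - x^-1 by field; rewrite gt_eqF.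
  lra.
have e1 := expR_ge1Dx (de * (ln x - ln (x - 1))).
have p0 : 0 < x `^ (- de) by exact: powR_gt0.
have -> : x `^ (- (1 + de)) = x `^ (- de) * x^-1.
  rewrite opprD addrC powRD; last by rewrite (gt_eqF x0) implybT.
  by congr (_ * _); rewrite powRN powRr1 ?ltW.
rewrite E -[X in _ <= _ - X]mulr1 -mulrBr mulrCA ler_pM2l//.
have : de * x^-1 <= de * (ln x - ln (x - 1)) by rewrite ler_pM2l.
lra.
Qed.

Lemma pweight_sum (de : R) : 0 < de -> forall a,
  \sum_(i < a) pweight (1 + de) i <= 2 + de^-1.
Proof.
move=> de0.
have key a : \sum_(i < a.+2) pweight (1 + de) i <= 2 + de^-1 * (1 - (a.+1)%:R `^ (- de)).
  elim: a => [|a IH].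
    by rewrite !big_ord_recr big_ord0/= /pweight !powR1; lra.
  rewrite big_ord_recr/=; apply: (le_trans (lerD IH (lexx _))).
  have x1 : (1 : R) < a.+2%:R by rewrite ltr1n.
  have := powR_telescope de0 x1; rewrite -[a.+2%:R - 1]/(_) => h.
  have e : a.+2%:R - 1 = a.+1%:R :> R by rewrite -(natr1 a.+1); ring.
  rewrite e in h; rewrite /pweight (maxn_idPr _)//.
  have h2 : a.+2%:R `^ (- (1 + de)) <= de^-1 * (a.+1%:R `^ (- de) - a.+2%:R `^ (- de)).
    by rewrite -(ler_pM2l de0) mulrA divff ?mul1r// gt_eqF.
  lra.
have di : 0 < de^-1 by rewrite invr_gt0.
move=> a; apply: (@le_trans _ _ (\sum_(i < a.+2) pweight (1 + de) i)).
  by rewrite !big_ord_recr/= -addrA lerDl addr_ge0// powR_ge0.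
apply: (le_trans (key a)); rewrite lerD2l -[leRHS]mulr1 ler_pM2l // gerBl powR_ge0.
Qed.

Definition ndist (j k : nat) := ((j - k) + (k - j))%N.

Lemma pweight_dist (s W : R) : (forall a, \sum_(i < a) pweight s i <= W) ->
  forall N (j : 'I_N), \sum_(k < N) pweight s (ndist j k) <= 2 * W.
Proof.
move=> HW N j; rewrite -(big_mkord xpredT (fun k => pweight s (ndist j k))).
rewrite (@big_cat_nat _ _ _ j)//=; last exact/ltnW.
have -> : 2 * W = W + W by ring.
apply: lerD.
  rewrite big_nat_rev/= add0n.
  apply: (@le_trans _ _ (\sum_(i < j.+1) pweight s i)); last exact: HW.
  rewrite big_ord_recl/= -[leLHS]add0r lerD ?powR_ge0//.
  rewrite big_mkord; apply: ler_sum => i _.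
  rewrite /ndist (_ : (j - (j - i.+1) + (j - i.+1 - j) = i.+1)%N)//.
  by have := ltn_ord i; lia.
rewrite -{1}[nat_of_ord j]add0n big_addn big_mkord.
apply: (@le_trans _ _ (\sum_(i < N - j) pweight s i)); last exact: HW.
apply: ler_sum => i _; rewrite /ndist (_ : (j - (i + j) + (i + j - j) = i)%N)//; lia.
Qed.

Lemma pweight_prod (s W : R) : (forall a, \sum_(i < a) pweight s i <= W) ->
  forall N n (J : 'rV['I_N]_n),
  \sum_(K : 'rV['I_N]_n) \prod_i pweight s (ndist (J 0 i) (K 0 i)) <= (2 * W) ^+ n.
Proof.
move=> HW N n; elim: n => [|n IH] J.
  by rewrite (big_row0 _ J) big_ord0 expr0.
rewrite big_row_cons exprS.
have W0 : 0 <= W by apply: le_trans (HW 0%N); rewrite big_ord0.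
apply: (@le_trans _ _ (\sum_(a < N) pweight s (ndist (J 0 ord0) a) * (2 * W) ^+ n)); last first.
  by rewrite -mulr_suml ler_wpM2r ?exprn_ge0 ?mulr_ge0// pweight_dist.
apply: ler_sum => a _.
rewrite (eq_bigr (fun K : 'rV['I_N]_n => pweight s (ndist (J 0 ord0) a) *
   \prod_i pweight s (ndist ((\row_i J 0 (lift ord0 i)) 0 i) (K 0 i)))); last first.
  move=> K _; rewrite big_ord_recl row_cons0; congr (_ * _).
  by apply: eq_bigr => i _; rewrite row_consS mxE.
by rewrite -mulr_sumr ler_wpM2l ?powR_ge0.
Qed.

End weights.

Section modulus.
Context (R : realType).

Lemma sqrt_sub (a b : R) : `|Num.sqrt a - Num.sqrt b| <= Num.sqrt `|a - b|.
Proof.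
wlog ab : a b / b <= a.
  move=> H; have [/H//|/ltW/H] := leP b a.
  by rewrite distrC (distrC b).
have sab := ler_wsqrtr ab.
rewrite !ger0_norm ?subr_ge0//.
have [a0|a0] := leP a 0.
  by rewrite (ler0_sqrtr a0) (ler0_sqrtr (le_trans ab a0)) subrr sqrtr_ge0.
have [b0|b0] := leP b 0.
  by rewrite (ler0_sqrtr b0) subr0 ler_wsqrtr//; lra.
rewrite -[leLHS]ger0_norm ?subr_ge0// -sqrtr_sqr ler_wsqrtr//.
have ha := sqr_sqrtr (ltW a0); have hb := sqr_sqrtr (ltW b0).
have := sqrtr_ge0 b; move: sab ha hb.
set x := Num.sqrt a; set y := Num.sqrt b; move=> *; nra.
Qed.

Lemma expr_sub_le (x y r : R) k : 0 <= x <= r -> 0 <= y <= r ->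
  `|x ^+ k.+1 - y ^+ k.+1| <= k.+1%:R * r ^+ k * `|x - y|.
Proof.
move=> /andP[x0 xr] /andP[y0 yr]; have r0 : 0 <= r by exact: le_trans xr.
rewrite subrXX normrM mulrC ler_wpM2r// (le_trans (ler_norm_sum _ _ _))//.
rewrite -[X in X%:R](card_ord k.+1); apply: sumr_const_le => i.
rewrite ger0_norm ?mulr_ge0 ?exprn_ge0//.
have -> : r ^+ k = r ^+ (k.+1.-1 - i) * r ^+ i.
  by rewrite -exprD subnK// -ltnS.
by rewrite ler_pM ?exprn_ge0// lerXn2r ?nnegrE.
Qed.

Lemma phiS_sub (a b v : R) k : a <= v -> b <= v ->
  `|phi k.+1 a - phi k.+1 b| <= k.+1%:R * Num.sqrt v ^+ k * Num.sqrt `|a - b|.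
Proof.
have phiE c : phi k.+1 c = Num.sqrt c ^+ k.+1.
  rewrite /phi; have [//|c0] := ltP 0 c; first by rewrite mul1r.
  by rewrite mul0r ler0_sqrtr// expr0n.
move=> av bv; rewrite !phiE.
apply: (le_trans (expr_sub_le _ (_ : 0 <= _ <= Num.sqrt v) (_ : 0 <= _ <= Num.sqrt v))).
- by rewrite sqrtr_ge0 ler_wsqrtr.
- by rewrite sqrtr_ge0 ler_wsqrtr.
by rewrite ler_wpM2l ?mulr_ge0 ?exprn_ge0// sqrt_sub.
Qed.

Lemma sqn_coord n (p : 'rV[R]_n) i (v : R) : sqn p <= v -> `|p 0 i| <= Num.sqrt v.
Proof.
move=> pv; rewrite -sqrtr_sqr ler_wsqrtr//; apply: le_trans pv.
rewrite /sqn (bigD1 i)//= lerDl; apply: sumr_ge0 => j _; exact: sqr_ge0.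
Qed.

Lemma sqnD_le n (p q : 'rV[R]_n) (v eta : R) : sqn p <= v -> 0 <= eta <= 1 ->
  (forall i, `|q 0 i| <= eta) -> `|sqn (p + q) - sqn p| <= n%:R * (2 * Num.sqrt v + 1) * eta.
Proof.
move=> pv /andP[e0 e1] qe; rewrite /sqn -sumrB (le_trans (ler_norm_sum _ _ _))//.
rewrite -mulrA -[X in X%:R](card_ord n); apply: sumr_const_le => i.
rewrite mxE (_ : _ - _ = (2 * p 0 i + q 0 i) * q 0 i); last by ring.
rewrite normrM ler_pM// (le_trans (ler_normD _ _))// lerD//.
  by rewrite normrM ger0_norm// ler_wpM2l// sqn_coord.
exact: le_trans (qe _) e1.
Qed.

Lemma phi_quad_modulus n k (w : 'M[R]_n) (r : 'rV[R]_n) v (e : R) : 0 < e ->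
  exists2 de, 0 < de & forall x y : 'rV[R]_n, (forall i, `|x 0 i - y 0 i| <= de) ->
   `|phi k.+1 (v - sqn (x *m w + r)) - phi k.+1 (v - sqn (y *m w + r))| <= e.
Proof.
move=> e0.
pose W := 1 + \sum_i \sum_j `|w i j|.
have W1 : 1 <= W by rewrite lerDl; apply: sumr_ge0 => i _; apply: sumr_ge0.
have W0 : 0 < W by lra.
pose L := 1 + n%:R * (2 * Num.sqrt v + 1).
have L1 : 1 <= L.
  by rewrite lerDl mulr_ge0// addr_ge0// mulr_ge0// sqrtr_ge0.
have L0 : 0 < L by lra.
pose Q := 1 + k.+1%:R * Num.sqrt v ^+ k.
have Q1 : 1 <= Q by rewrite lerDl mulr_ge0// exprn_ge0.
have Q0 : 0 < Q by lra.
pose eta := Num.min 1 ((e / Q) ^+ 2 / L).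
have eta0 : 0 < eta by rewrite lt_min ltr01 divr_gt0// exprn_gt0// divr_gt0.
have eta1 : eta <= 1 by rewrite ge_min lexx.
have etaL : eta * L <= (e / Q) ^+ 2 by rewrite -ler_pdivlMr// ge_min lexx orbT.
exists (eta / W); first by rewrite divr_gt0.
move=> x y xy.
wlog yv : x y xy / sqn (y *m w + r) <= v.
  move=> H; have [/H|yv] := leP (sqn (y *m w + r)) v; first exact.
  have [xv|xv] := leP (sqn (x *m w + r)) v.
    by rewrite distrC; apply: H => // i; rewrite distrC.
  by rewrite !phi_le0 ?subrr ?normr0 ?subr_le0 ltW.
have dE : x *m w + r = (y *m w + r) + (x - y) *m w.
  by rewrite mulmxBl addrAC [y *m w + _]addrC subrK.
have db i : `|((x - y) *m w) 0 i| <= eta.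
  rewrite mxE (le_trans (ler_norm_sum _ _ _))//.
  apply: (@le_trans _ _ (\sum_j eta / W * `|w j i|)).
    apply: ler_sum => j _; rewrite normrM ler_wpM2r//.
    by have := xy j; rewrite !mxE.
  rewrite -mulr_sumr mulrAC ler_pdivrMr// ler_pM2l//.
  rewrite /W -[leLHS]add0r lerD//; apply: ler_sum => j _.
  by rewrite (bigD1 i)//= lerDl; apply: sumr_ge0.
have h := sqnD_le yv (_ : 0 <= eta <= 1) db.
have {h}h : `|sqn (x *m w + r) - sqn (y *m w + r)| <= (e / Q) ^+ 2.
  rewrite dE (le_trans (h _))//; first by rewrite eta1 ltW.
  by apply: le_trans etaL; rewrite mulrC ler_pM2l// /L lerDr.
have g (c : 'rV[R]_n) : v - sqn c <= v by rewrite gerBl sqn_ge0.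
apply: (le_trans (phiS_sub _ (g _) (g _))).
rewrite (_ : v - _ - _ = - (sqn (x *m w + r) - sqn (y *m w + r))); last by ring.
rewrite normrN; have := ler_wsqrtr h; rewrite sqrtr_sqr (@ger0_norm _ (e / Q)); last by rewrite divr_ge0// ltW.
move=> h2; apply: (@le_trans _ _ (Q * (e / Q))).
  by rewrite ler_pM// ?mulr_ge0 ?exprn_ge0// /Q lerDr.
by rewrite mulrC divfK// gt_eqF.
Qed.

End modulus.

(** * Lattice sums over ellipsoids *)
Section lattice_sum.
Context (R : realType).
Notation leb := (@lebesgue_measure R).
Notation lam n := (lebesgue_tuple R n).
Notation rv := (@rV_of_tuple R _).

Lemma tpi_ge1 : 1 <= tpi R.
Proof. by have := pi_ge2 R; rewrite /tpi; lra. Qed.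

Lemma ndistE (j k : nat) : (ndist j k)%:R = `|j%:R - k%:R| :> R.
Proof.
rewrite /ndist; have [jk|kj] := leqP j k.
  rewrite (_ : (j - k + (k - j) = k - j)%N); last by lia.
  by rewrite natrB// distrC ger0_norm// subr_ge0 ler_nat.
rewrite (_ : (j - k + (k - j) = j - k)%N); last by lia.
by rewrite natrB 1?ltnW// ger0_norm// subr_ge0 ler_nat ltnW.
Qed.

Lemma powRN_anti (s x y : R) : 0 <= s -> 0 < x -> x <= y -> y `^ (- s) <= x `^ (- s).
Proof.
move=> s0 x0 xy; have y0 : 0 < y by exact: lt_le_trans xy.
rewrite !powRN lef_pV2 ?posrE ?powR_gt0//.
by rewrite ge0_ler_powR// nnegrE ltW.
Qed.

Lemma powR_half n (q : R) : 0 < q ->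
  (q `^ (- (1 + (2 * n.+1%:R)^-1)) ^+ n.+1) ^+ 2 = (q ^+ (2 * n + 3))^-1.
Proof.
move=> q0; rewrite -exprM -powR_mulrn ?powR_ge0// -powRrM.
rewrite -[in RHS]powR_mulrn; last exact: ltW.
rewrite -powRN; congr (powR q _).
have h : (2 * n + 3)%N = (2 * n.+1).+1 by rewrite mulnS; lia.
rewrite h -(natr1 (2 * n.+1)%N) !natrM.
have : (n.+1%:R : R) != 0 by rewrite pnatr_eq0.
by move: (n.+1%:R : R) => y y0; field.
Qed.

(** The Fourier integrals of [fourier_quad] decay like |xi|^(-(k+n+2)/2), and
    n < k gives (k + n + 2) / 2 >= (n + 1) + 1/2. The extra 1/2 is
    shared among the n + 1 coordinates, which bounds the integral at xi by a product
    of weights |xi_i|^(-(1 + de)), each of them summable over the integers; then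
    [poisson_bound] applies. The number be measures how w distorts the
    dual lattice. *)
Lemma lattice_sum n k : (n < k)%N -> exists2 C : R, 0 <= C &
  forall A (w : 'M[R]_n.+1) (r : 'rV[R]_n.+1) v be,
  upper_triangular w -> (forall i, 0 < w i i) -> 0 < be ->
  (forall (xi : 'cV[R]_n.+1) i, be * `|xi i 0| <= Num.sqrt (sqn (invmx w *m xi)^T)) ->
  (forall (m : 'rV[R]_n.+1) i, A%:R <= `|m 0 i| -> v <= sqn (m *m w + r)) ->
  `|\sum_(m : 'rV['I_(2 * A)%N.+1]_n.+1) phi k (v - sqn (ivec R A m *m w + r)) -
     phiC R k n.+1 / (\prod_i w i i) * phi (k + n.+1) v| <=
  C / (\prod_i w i i) * Num.sqrt (be^-1 ^+ (k + n).+2 * Num.sqrt v ^+ (k + n)).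
Proof.
move=> nk; have [C0 C00 HC] := fourier_quad R n k.
pose de : R := (2 * n.+1%:R)^-1.
have de0 : 0 < de by rewrite invr_gt0 mulr_gt0.
pose s := 1 + de; have s0 : 0 < s by rewrite addr_gt0.
have HW := pweight_sum de0; set W := 2 + de^-1 in HW.
have W0 : 0 <= W by rewrite addr_ge0// invr_ge0 ltW.
exists (Num.sqrt C0 * (2 * W) ^+ n.+1).
  by rewrite mulr_ge0 ?sqrtr_ge0// exprn_ge0// mulr_ge0.
move=> A w r v be uw w0 be0 Hbe HA.
have wn0 i : w i i != 0 by rewrite gt_eqF.
set D := \prod_i w i i; have D0 : 0 < D by apply: prodr_gt0.
have absD : \prod_i `|w i i| = D by apply: eq_bigr => i _; rewrite gtr0_norm.
set T := Num.sqrt (be^-1 ^+ (k + n).+2 * Num.sqrt v ^+ (k + n)).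
have T0 : 0 <= T by exact: sqrtr_ge0.
have T2 : T ^+ 2 = be^-1 ^+ (k + n).+2 * Num.sqrt v ^+ (k + n).
  by rewrite sqr_sqrtr// mulr_ge0// exprn_ge0 ?invr_ge0 ?ltW.
pose Z := Num.sqrt C0 / D * T.
have Z0 : 0 <= Z by rewrite mulr_ge0// divr_ge0 ?sqrtr_ge0 ?ltW.
pose F (u : 'rV[R]_n.+1) := phi k (v - sqn (u *m w + r)).
have kE : k = k.-1.+1 by rewrite prednK// (leq_ltn_trans _ nk).
have mod e : 0 < e -> exists de, 0 < de /\ forall x y : 'rV[R]_n.+1,
    (forall i, `|x 0 i - y 0 i| <= de) -> `|F x - F y| <= e.
  move=> e0; have [d d0 dP] := phi_quad_modulus k.-1 w r v e0.
  by exists d; split => // x y xy; rewrite /F kE; exact: dP.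
have mod' e : exists de, 0 < e -> 0 < de /\ forall x y : 'rV[R]_n.+1,
    (forall i, `|x 0 i - y 0 i| <= de) -> `|F x - F y| <= e.
  have [e0|e0] := ltP 0 e; last by exists 0.
  by have [d dP] := mod e e0; exists d.
have [om omP] := choice mod'.
have om0 e : 0 < e -> 0 < om e by move=> /omP[].
have tF : tame A (phi k v) om F.
  split.
  - by apply/measurable_EFinP; exact: measurable_phi_quad.
  - by move=> u; rewrite phi_ge0/= phi_mono// gerBl sqn_ge0.
  - by move=> u i /HA uv; rewrite /F phi_le0// subr_le0.
  - by move=> e u u' e0; have [_] := omP e e0; apply.
pose b N (J K : 'rV['I_N]_n.+1) := Z * \prod_i pweight s (ndist (J 0 i) (K 0 i)).
have FI : (\int[lam n.+1]_t (F (rv t))%:E = (phiC R k n.+1 / D * phi (k + n.+1) v)%:E)%E.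
  by rewrite integral_phi_triangular// absD.
have -> : Num.sqrt C0 * (2 * W) ^+ n.+1 / D * T = Z * (2 * W) ^+ n.+1.
  by rewrite /Z; ring.
apply: (poisson_bound (b := b) om0 tF FI); last first.
  move=> N J; rewrite /b -mulr_sumr ler_wpM2l//.
  apply: le_trans (pweight_prod HW J).
  rewrite [leRHS](bigD1 J)//= lerDr; apply: prodr_ge0 => i _; exact: powR_ge0.
move=> N J K JK.
have [i0 Ji0] : exists i, J 0 i != K 0 i.
  apply/existsP; rewrite -negb_forall; apply: contra JK => /forallP h.
  by apply/eqP/rowP => i; apply/eqP.
have fE i : `|freq R J K i 0| = tpi R * (ndist (J 0 i) (K 0 i))%:R.
  rewrite mxE normrM ndistE ger0_norm//; have := tpi_ge1; lra.
have xi0 : freq R J K != 0.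
  apply: contra Ji0 => /eqP h; have := fE i0; rewrite h mxE normr0 => /esym/eqP.
  rewrite mulf_eq0 gt_eqF/=; last by have := tpi_ge1; lra.
  rewrite pnatr_eq0 /ndist addn_eq0 !subn_eq0 => /andP[h1 h2].
  by apply/eqP/val_inj/eqP; rewrite eqn_leq h1.
have [x xE xB] := HC w r v (freq R J K) 0 uw w0 xi0.
exists x.
  rewrite -xE; apply: eq_integral => t _; by rewrite addr0.
set la := Num.sqrt _ in xB.
have lai i : be * (ndist (J 0 i) (K 0 i))%:R <= la.
  apply: le_trans (Hbe (freq R J K) i); rewrite fE ler_pM2l//.
  by rewrite -[leLHS]mul1r ler_wpM2r// tpi_ge1.
pose q := la / be.
have qi i : (ndist (J 0 i) (K 0 i))%:R <= q by rewrite /q ler_pdivlMr// mulrC.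
have q1 : 1 <= q.
  apply: le_trans (qi i0); rewrite (_ : 1 = 1%:R)// ler_nat.
  rewrite lt0n /ndist addn_eq0 !subn_eq0; apply: contra Ji0 => /andP[h1 h2].
  by apply/eqP/val_inj/eqP; rewrite eqn_leq h1.
have q0 : 0 < q by lra.
have mq i : (maxn 1 (ndist (J 0 i) (K 0 i)))%:R <= q.
  by rewrite /maxn; case: ifP.
pose p := q `^ (- s).
have p0 : 0 < p by exact: powR_gt0.
have pP : p ^+ n.+1 <= \prod_i pweight s (ndist (J 0 i) (K 0 i)).
  rewrite -[X in p ^+ X](card_ord n.+1) -prodr_const.
  apply: ler_prod => i _; apply/andP; split; first exact: ltW.
  by apply: powRN_anti => //; exact: ltW.
apply: (@le_trans _ _ (Z * p ^+ n.+1)); last by rewrite ler_wpM2l.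
have Zp : 0 <= Z * p ^+ n.+1 by rewrite mulr_ge0// exprn_ge0// ltW.
rewrite -(ler_pXn2r (n := 2))// ?nnegrE// real_normK ?num_real//.
have p2 : (p ^+ n.+1) ^+ 2 = (q ^+ (2 * n + 3))^-1.
  exact: powR_half.
have -> : (Z * p ^+ n.+1) ^+ 2 =
    (C0 / D ^+ 2 * (be^-1 ^+ (k + n).+2 * Num.sqrt v ^+ (k + n))) * (q ^+ (2 * n + 3))^-1.
  by rewrite exprMn p2 /Z exprMn T2 exprMn sqr_sqrtr //; congr (_ * _ * _ / _); rewrite exprVn.
have la0 : 0 < la by have := mulr_gt0 q0 be0; rewrite /q divfK// gt_eqF.
have xB2 : x ^+ 2 <= C0 / D ^+ 2 * Num.sqrt v ^+ (k + n) / la ^+ (k + n).+2.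
  by rewrite ler_pdivlMr// exprn_gt0.
apply: (le_trans xB2).
have laE : la = q * be by rewrite /q divfK// gt_eqF.
have -> : C0 / D ^+ 2 * Num.sqrt v ^+ (k + n) / la ^+ (k + n).+2 =
    (C0 / D ^+ 2 * (be^-1 ^+ (k + n).+2 * Num.sqrt v ^+ (k + n))) * (q ^+ (k + n).+2)^-1.
  by rewrite laE exprMn [(q ^+ _ * _)^-1]invfM exprVn; ring.
apply: ler_wpM2l.
  by rewrite mulr_ge0 ?divr_ge0 ?sqr_ge0// mulr_ge0// exprn_ge0// ?invr_ge0 ltW.
rewrite lef_pV2 ?posrE ?exprn_gt0// ler_weXn2l//.
by clear -nk; lia.
Qed.

End lattice_sum.

(** * Counting error along one coordinate *)
Section zsum.
Context (R : realType).
Implicit Types (F : int -> R) (M N L : nat).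

(** Used for functions of finite support only. *)
Definition zsum F : R := \sum_(z \in [set: int]) F z.

Lemma zsum_fin (I : finType) (h : I -> int) F : injective h ->
  (forall z, F z != 0 -> exists i, z = h i) -> zsum F = \sum_i F (h i).
Proof.
move=> hi hF; rewrite /zsum -(big_map h xpredT F).
have u : uniq (map h (index_enum I)) by rewrite map_inj_uniq// index_enum_uniq.
rewrite (fsbig_seq _ _ u); apply/esym/fsbig_widen => // z [_ /= zr].
apply/eqP; apply: contrapT => /negP Fz; apply: zr.
by have [i ->] := hF z Fz; apply/mapP; exists i => //; rewrite mem_index_enum.
Qed.

Lemma zsum_window M F : (forall z, F z != 0 -> (`|z| <= M)%N) ->
  zsum F = \sum_(c < (2 * M)%N.+1) F (c%:Z - M%:Z).
Proof.
move=> FM; apply: (zsum_fin (h := fun c : 'I_(2 * M)%N.+1 => c%:Z - M%:Z)).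
  by move=> c c' /addIr [] /val_inj.
move=> z /FM zM.
have h : (`|(z + M%:Z)%R| < (2 * M)%N.+1)%N by lia.
by exists (Ordinal h) => /=; lia.
Qed.

Lemma zsum_shift (q : int) F : zsum (fun z => F (z + q)) = zsum F.
Proof.
rewrite /zsum [RHS](@reindex_fsbigT _ _ _ _ _ (fun z : int => z + q))//.
by exists (fun z => z - q) => z; [rewrite addrK|rewrite subrK].
Qed.

(** Sorting the integers by their residue modulo N. *)
Lemma zsum_split N L F : (0 < N)%N -> (forall z, F z != 0 -> (`|z| <= L)%N) ->
  \sum_(i < N) zsum (fun z => F (N%:Z * z + i%:Z)) = zsum F.
Proof.
move=> N0 FL.
transitivity (\sum_(i < N) \sum_(c < (2 * L.+1)%N.+1) F (N%:Z * (c%:Z - L.+1%:Z) + i%:Z)).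
  apply: eq_bigr => i _; rewrite (@zsum_window L.+1)// => z /FL h.
  have iN := ltn_ord i; nia.
rewrite pair_big/=; apply/esym.
apply: (zsum_fin (h := fun p : 'I_N * 'I_(2 * L.+1)%N.+1 => N%:Z * (p.2%:Z - L.+1%:Z) + p.1%:Z)).
  move=> [i c] [i' c'] /= e; have iN := ltn_ord i; have iN' := ltn_ord i'.
  have cc : (c : nat) = c' by nia.
  by congr (_, _); apply/val_inj => //=; move: e; rewrite cc => /addrI [].
move=> z /FL zL.
pose q := (z %/ N%:Z)%Z; pose r := (z %% N%:Z)%Z.
have zE : z = q * N%:Z + r by exact: divz_eq.
have r0 : 0 <= r by rewrite modz_ge0// eqz_nat -lt0n.
have rN : r < N%:Z by rewrite ltz_pmod// ltz_nat.
have h1 : (`|r| < N)%N by lia.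
have h2 : (`|(q + L.+1%:Z)%R| < (2 * L.+1)%N.+1)%N by nia.
exists (Ordinal h1, Ordinal h2) => /=.
have -> : `|(q + L.+1%:Z)%R|%N%:Z = q + L.+1%:Z by nia.
by rewrite addrK mulrC gez0_abs.
Qed.

End zsum.

Section counting_error.
Context (R : realType).
Notation leb := (@lebesgue_measure R).

Lemma phic0 : phic R 0 = 2.
Proof.
apply: EFin_inj; rewrite -phicE.
transitivity (\int[leb]_s (\1_(`]-1, 1[ : set R) s)%:E)%E.
  apply: eq_integral => s _; congr (_%:E); rewrite indicE /phi expr0 mulr1.
  congr (nat_of_bool _)%:R; rewrite subr_gt0.
  apply/idP/idP => h.
    rewrite inE/= in_itv/= -ltr_norml ltNge; apply/negP => s1.
    by move: h; rewrite -real_normK ?num_real// ltNge exprn_ege1.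
  move: h; rewrite inE/= in_itv/= -ltr_norml => h.
  by rewrite -real_normK ?num_real// exprn_ilt1.
rewrite integral_indic// setIT [LHS]lebesgue_measure_itv/= lte_fin ifT; last by lra.
by rewrite -EFinB; congr (_%:E); ring.
Qed.

Lemma count_lt (n : nat) (y : R) : 0 <= y <= n%:R ->
  y <= \sum_(i < n) (i%:R < y)%R%:R < y + 1.
Proof.
elim: n => [|n IH] /andP[y0 yn]; first by rewrite big_ord0; apply/andP; split; lra.
rewrite big_ord_recr/=; have [ny|ny] := ltP n%:R y.
  rewrite (eq_bigr (fun=> 1)); last first.
    by move=> i _; rewrite (lt_trans _ ny)// ltr_nat.
  rewrite sumr_const card_ord; move: yn; rewrite -natr1 => yn /=.
  by rewrite yn/= ltrD2r.
by rewrite mulr0n addr0 IH// y0.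
Qed.

Lemma count_le (n : nat) (y : R) : 0 <= y -> y < n%:R ->
  y < \sum_(i < n) (i%:R <= y)%R%:R <= y + 1.
Proof.
elim: n => [|n IH] y0 yn; first by lra.
rewrite big_ord_recr/=; have [ny|ny] := leP n%:R y.
  rewrite (eq_bigr (fun=> 1)); last first.
    by move=> i _; rewrite (le_trans _ ny)// ler_nat ltnW.
  rewrite sumr_const card_ord; move: yn; rewrite -natr1 => yn /=.
  by rewrite yn/= lerD2r.
by rewrite mulr0n addr0 IH// y0.
Qed.

Lemma count_interval (n : nat) (p q : R) : -1 <= p -> p <= q -> q <= n%:R -> p < n%:R ->
  0 <= q ->
  `|\sum_(i < n) (p < i%:R < q)%R%:R - (q - p)| <= 1.
Proof.
move=> p1 pq qn pn q0.
have hq := count_lt (_ : 0 <= q <= n%:R).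
have {}hq := hq (introT andP (conj q0 qn)).
have e : \sum_(i < n) (p < i%:R < q)%R%:R =
    \sum_(i < n) (i%:R < q)%R%:R - \sum_(i < n) ((i%:R <= p) && (i%:R < q))%R%:R :> R.
  rewrite -sumrB; apply: eq_bigr => i _; rewrite ltNge.
  by case: (_ <= p); case: (_ < q); rewrite /= ?subrr ?subr0.
have [p0|p0] := leP 0 p; last first.
  rewrite e [X in _ - X - _]big1; last first.
    move=> i _; rewrite leNgt (lt_le_trans p0)//.
  rewrite ler_norml; case/andP: hq => *; apply/andP; split; lra.
have [pq'|] := ltP p q; last first.
  move=> qp; rewrite big1; last first.
    by move=> i _; case: (ltP p i%:R) => //= pi; rewrite ltNge (le_trans qp (ltW pi)).
  rewrite ler_norml; apply/andP; split; lra.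
have hp := count_le p0 pn.
rewrite e [X in _ - X - _](eq_bigr (fun i : 'I_n => (i%:R <= p)%R%:R)); last first.
  move=> i _; congr (nat_of_bool _)%:R.
  by apply/andP/idP => [[]//|h]; split => //; exact: le_lt_trans pq'.
rewrite ler_norml; case/andP: hq => *; case/andP: hp => *; apply/andP; split; lra.
Qed.

(** The error made in replacing a sum over x + Z by the integral over the
    line, whose value is the second term. *)
Definition zerr k (b v x : R) : R :=
  zsum (fun z => phi k (v - (b * (z%:~R + x)) ^+ 2)) - phic R k / b * phi k.+1 v.

Lemma phi_support k (b v x : R) (z : int) : 0 < b -> 0 <= v ->
  phi k (v - (b * (z%:~R + x)) ^+ 2) != 0 -> `|z%:~R + x| < Num.sqrt v / b.
Proof.
move=> b0 v0; rewrite ltr_pdivlMr// -[X in _ * X < _](gtr0_norm b0) -normrM mulrC => h.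
rewrite ltNge; apply: contra h => h; apply/eqP/phi_le0.
rewrite subr_le0 -[leRHS]real_normK ?num_real// -[leLHS]sqr_sqrtr//.
by rewrite lerXn2r ?nnegrE ?sqrtr_ge0.
Qed.

Lemma zerr_support k (b v x : R) (M : nat) : 0 < b -> Num.sqrt v / b + `|x| <= M%:R ->
  forall z : int, phi k (v - (b * (z%:~R + x)) ^+ 2) != 0 -> (`|z| <= M)%N.
Proof.
move=> b0 vM z h; have v0 : 0 <= v.
  rewrite leNgt; apply: contra h => v0; rewrite phi_le0//.
  by rewrite subr_le0 (le_trans (ltW v0))// sqr_ge0.
have := phi_support b0 v0 h => hz.
rewrite -(@ler_nat R) natr_absz intr_norm.
have := ler_normB (z%:~R + x) x; rewrite addrK; lra.
Qed.

(** For k = 0 this counts the integers in an interval; for k > 0 it is the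
    one-dimensional case of [lattice_sum]. *)
Lemma zerr_bound k : exists2 C : R, 0 <= C & forall b v x, 0 < b ->
  `|zerr k b v x| <= C * Num.sqrt ((b * Num.sqrt v) ^+ k).
Proof.
case: k => [|k].
  exists 1 => // b v x b0; rewrite expr0 sqrtr1 mulr1 /zerr.
  have [v0|v0] := leP v 0.
    rewrite [phi 1 v]phi_le0// mulr0 subr0 /zsum fsbig1 ?normr0// => z _.
    by rewrite phi_le0// subr_le0 (le_trans v0)// sqr_ge0.
  pose M := (Num.truncn (Num.sqrt v / b + `|x|)).+1.
  have MP : Num.sqrt v / b + `|x| < M%:R by exact: truncnS_gt.
  rewrite (zsum_window (zerr_support b0 (ltW MP))).
  set rho := Num.sqrt v / b in MP.
  have rho0 : 0 < rho by rewrite divr_gt0// sqrtr_gt0.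
  have x1 := ler_norm x; have x2 : - x <= `|x| by rewrite -normrN ler_norm.
  have := @count_interval (2 * M)%N.+1 (M%:R - x - rho) (M%:R - x + rho).
  rewrite -natr1 natrM => /(_ _ _ _ _ _) h.
  apply: le_trans (h _ _ _ _ _); try lra.
  rewrite le_eqVlt; apply/orP; left; apply/eqP; congr (`|_ - _|).
    apply: eq_bigr => c _; rewrite /phi expr0 mulr1; congr (nat_of_bool _)%:R.
    rewrite subr_gt0 -[ltRHS](sqr_sqrtr (ltW v0)) -[ltLHS]real_normK ?num_real//.
    rewrite ltr_pXn2r ?nnegrE ?sqrtr_ge0// normrM (gtr0_norm b0) mulrC -ltr_pdivlMr//.
    rewrite -/rho ltr_norml rmorphB/= !pmulrn.
    by apply/andP/andP => -[? ?]; split; lra.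
  by rewrite phic0 phi_gt0// expr1 /rho; field; rewrite gt_eqF.
have [C C0 HC] := lattice_sum R (n := 0) (k := k.+1) isT.
exists C => // b v x b0; rewrite /zerr.
have [v0|v0] := leP v 0.
  rewrite [phi k.+2 v]phi_le0// mulr0 subr0 /zsum fsbig1 ?normr0 ?mulr_ge0 ?sqrtr_ge0// => z _.
  by rewrite phi_le0// subr_le0 (le_trans v0)// sqr_ge0.
pose M := (Num.truncn (Num.sqrt v / b + `|x|)).+1.
have MP : Num.sqrt v / b + `|x| < M%:R by exact: truncnS_gt.
rewrite (zsum_window (zerr_support b0 (ltW MP))).
pose w : 'M[R]_1 := b%:M; pose r : 'rV[R]_1 := (b * x)%:M.
have uw : upper_triangular w by move=> i j; rewrite !ord1.
have w0 i : 0 < w i i by rewrite mxE eqxx.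
have bi : 0 < b^-1 by rewrite invr_gt0.
have H := HC M w r v b^-1 uw w0 bi.
have sqn1 (u : 'rV[R]_1) : sqn u = u 0 0 ^+ 2 by rewrite /sqn big_ord1.
have {}H := H _ _.
have e1 (u : 'rV[R]_1) : sqn (u *m w + r) = (b * (u 0 0 + x)) ^+ 2.
  by rewrite sqn1 /w mul_mx_scalar !mxE eqxx mulr1n; congr (_ ^+ 2); ring.
have := H; rewrite !big_ord1 /w mxE eqxx mulr1n invrK.
have -> : phiC R k.+1 1 = phic R k.+1 by rewrite /phiC big_ord1 addn0.
rewrite addn1 !addn0.
have -> : \sum_(m : 'rV['I_(2 * M)%N.+1]_1) phi k.+1 (v - sqn (ivec R M m *m w + r)) =
   \sum_(c < (2 * M)%N.+1) phi k.+1 (v - (b * ((c%:Z - M%:Z)%:~R + x)) ^+ 2).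
  rewrite big_row_cons; apply: eq_bigr => c _; rewrite (big_row0 _ 0) e1.
  by rewrite mxE row_cons0 rmorphB/= !pmulrn.
move=> {}H; apply: le_trans (H _ _) _.
- move=> xi i; rewrite /w invmx_scalar mul_scalar_mx linearZ/= sqn1 !mxE !ord1.
  by rewrite sqrtr_sqr normrM gtr0_norm.
- move=> m i; rewrite !ord1 e1 => Mm.
  rewrite -[leLHS](sqr_sqrtr (ltW v0)) -[leRHS]real_normK ?num_real//.
  rewrite lerXn2r ?nnegrE ?sqrtr_ge0// normrM (gtr0_norm b0) mulrC -ler_pdivrMr//.
  have := ler_normB (m 0 0 + x) x; rewrite addrK; lra.
rewrite le_eqVlt; apply/orP; left; apply/eqP.
rewrite -mulrA; congr (C * _).
have -> : b ^+ k.+3 * Num.sqrt v ^+ k.+1 = b ^+ 2 * (b * Num.sqrt v) ^+ k.+1.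
  by rewrite exprMn !(exprS _ k.+2) !(exprS _ k.+1); ring.
rewrite sqrtrM ?sqr_ge0// sqrtr_sqr gtr0_norm// mulrA mulVf ?mul1r// gt_eqF//.
Qed.

(** The translates of Z by the i / N make up Z / N: the sum is the error for the
    step b / N, to which [zerr_bound] applies. The bound does not grow with N. *)
Lemma zerr_avg k : exists2 C : R, 0 <= C & forall b v x N, 0 < b -> (0 < N)%N ->
  `|\sum_(i < N) zerr k b v (x + i%:R / N%:R)| <= C * Num.sqrt ((b * Num.sqrt v) ^+ k).
Proof.
have [C C0 HC] := zerr_bound k; exists C => // b v x N b0 N0.
have Np : (0 : R) < N%:R by rewrite ltr0n.
have Nn0 : (N%:R : R) != 0 by rewrite gt_eqF.
have a0 : 0 < b / N%:R by exact: divr_gt0.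
pose M := (Num.truncn (Num.sqrt v / (b / N%:R) + `|N%:R * x|)).+1.
have MP : Num.sqrt v / (b / N%:R) + `|N%:R * x| < M%:R by exact: truncnS_gt.
have -> : \sum_(i < N) zerr k b v (x + i%:R / N%:R) = zerr k (b / N%:R) v (N%:R * x).
  rewrite /zerr sumrB -(zsum_split N0 (zerr_support a0 (ltW MP))); congr (_ - _).
    apply: eq_bigr => i _; congr zsum; apply/funext => z.
    congr (phi k (v - _ ^+ 2)); rewrite rmorphD rmorphM/= !pmulrn; field.
    by rewrite Nn0.
  by rewrite sumr_const card_ord -mulr_natl; field; rewrite Nn0 gt_eqF.
apply: (le_trans (HC _ _ _ a0)); rewrite ler_wpM2l// ler_wsqrtr//.
have b1 : b / N%:R <= b by rewrite ler_pdivrMr// ler_peMr ?(ltW b0)// ler1n.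
have b2 := ltW a0; have b3 := ltW b0.
by rewrite lerXn2r ?nnegrE ?mulr_ge0 ?sqrtr_ge0// ler_wpM2r ?sqrtr_ge0.
Qed.

Lemma zerr_periodic k (b v x : R) (q : int) : zerr k b v (x + q%:~R) = zerr k b v x.
Proof.
rewrite /zerr -[in RHS](zsum_shift q); congr (zsum _ - _); apply/funext => z.
by congr (phi k (v - (b * _) ^+ 2)); rewrite rmorphD/=; ring.
Qed.

End counting_error.

(** * Changing the fundamental domain *)
Section fundamental_domains.
Local Open Scope ereal_scope.
Context (R : realType) (n : nat).
Notation lam := (lebesgue_tuple R n).
Notation rv := (@rV_of_tuple R _).

Lemma nneseries_single (u : nat -> \bar R) k0 : (forall k, 0 <= u k) ->
  (forall k, k != k0 -> u k = 0) -> \sum_(k <oo) u k = u k0.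
Proof.
move=> u0 uk; rewrite (nneseriesD1 (n := k0))// eseries0 ?adde0// => k _ kk.
exact: uk.
Qed.

(** F1 is cut into the pieces that the translations by the la z carry into F2. *)
Lemma integral_domain_change (la : 'rV[int]_n -> 'rV[R]_n) (P : set 'rV[int]_n)
    (F1 F2 : set 'rV[R]_n) (f : 'rV[R]_n -> R) :
  borel F1 -> borel F2 -> measurable_fun setT (fun t => f (rv t)) ->
  (forall v, 0 <= f v)%R ->
  (forall z v, P z -> f (v + la z)%R = f v) ->
  (forall v, F1 v -> exists! z, P z /\ F2 (v + la z)%R) ->
  (forall v, F2 v -> exists! z, P z /\ F1 (v - la z)%R) ->
  \int[lam]_t (\1_F1 (rv t) * f (rv t))%:E = \int[lam]_t (\1_F2 (rv t) * f (rv t))%:E.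
Proof.
move=> mF1 mF2 mf f0 fla H1 H2.
pose t1 z v : R := (\1_F1 v * \1_F2 (v + la z) * f v)%R.
pose t2 z v : R := (\1_F1 (v - la z) * \1_F2 v * f v)%R.
pose ser (t : 'rV[int]_n -> 'rV[R]_n -> R) k v : R :=
  if pickle_inv k is Some z then (\1_P z * t z v)%R else 0%R.
have m1 z : measurable_fun setT (fun t => t1 z (rv t)).
  apply: measurable_funM => //; apply: measurable_funM.
    by apply: measurable_row_indic => //; exact: measurable_row_rv.
  apply: measurable_row_indic => //; apply: measurable_rowD.
    exact: measurable_row_rv.
  exact: measurable_row_cst.
have m2 z : measurable_fun setT (fun t => t2 z (rv t)).
  apply: measurable_funM => //; apply: measurable_funM.
    apply: measurable_row_indic => //; apply: measurable_rowD.
      exact: measurable_row_rv.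
    exact: measurable_row_cst.
  by apply: measurable_row_indic => //; exact: measurable_row_rv.
have mser t k : (forall z, measurable_fun setT (fun x => t z (rv x))) ->
    measurable_fun setT (fun x => (ser t k (rv x))%:E).
  move=> mt; apply/measurable_EFinP; rewrite /ser.
  by case: (pickle_inv k) => [z|]; [exact: measurable_funM|exact: measurable_cst].
have t10 z v : (0 <= t1 z v)%R by rewrite !mulr_ge0.
have t20 z v : (0 <= t2 z v)%R by rewrite !mulr_ge0.
have ser0 t k v : (forall z v, 0 <= t z v)%R -> 0 <= (ser t k v)%:E.
  by move=> t0; rewrite lee_fin /ser; case: (pickle_inv k) => // z; rewrite mulr_ge0.
have serE t v (y : R) z0 : (forall z v, 0 <= t z v)%R -> P z0 -> t z0 v = y ->
    (forall z, P z -> z != z0 -> t z v = 0%R) -> \sum_(k <oo) (ser t k v)%:E = y%:E.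
  move=> t0 Pz0 tz0 tz; rewrite (nneseries_single (k0 := choice.pickle z0)).
  - by rewrite /ser pickleK_inv indicE mem_set// mul1r tz0.
  - by move=> k; exact: ser0.
  - move=> k kz; congr (_%:E); rewrite /ser.
    case E : (pickle_inv k) => [z|//]; rewrite indicE.
    have [Pz|Pz] := pselect (P z); last by rewrite memNset// mul0r.
    rewrite tz ?mulr0//; apply: contra kz => /eqP zz.
    by rewrite -zz; have := @pickle_invK 'rV[int]_n k; rewrite E /= => ->.
transitivity (\int[lam]_t \sum_(k <oo) (ser t1 k (rv t))%:E).
  apply: eq_integral => t _; apply/esym.
  have [Fv|Fv] := pselect (F1 (rv t)); last first.
    rewrite eseries0.
      by rewrite indicE memNset// mul0r.
    move=> k _ _; rewrite /ser /t1; case: (pickle_inv k) => // z.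
    by rewrite [\1_F1 _]indicE memNset// !mul0r mulr0.
  have [z0 [[Pz0 Fz0] uz0]] := H1 _ Fv.
  apply: (serE _ _ _ z0) => //.
    by rewrite /t1 [\1_F2 _]indicE mem_set// mulr1.
  move=> z Pz zz0; rewrite /t1 [\1_F2 _]indicE memNset ?mulr0 ?mul0r// => Fz.
  by move: zz0; rewrite (uz0 z)// eqxx.
rewrite integral_nneseries//; [|by move=> k; exact: mser|by move=> k t _; exact: ser0].
transitivity (\sum_(k <oo) \int[lam]_t (ser t2 k (rv t))%:E).
  apply: eq_eseriesr => k _; rewrite /ser; case: (pickle_inv k) => [z|//].
  rewrite -(ge0_integral_row_shift (- la z)%R (f := fun v => (\1_P z * t1 z v)%:E)).
  - apply: eq_integral => t _; congr (_%:E).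
    have [Pz|Pz] := pselect (P z); last by rewrite indicE memNset// !mul0r.
    by have := fla z (rv t - la z)%R Pz; rewrite /t1 /t2 subrK => ->.
  - by apply/measurable_EFinP; exact: measurable_funM.
  - by move=> v; rewrite lee_fin mulr_ge0.
rewrite -integral_nneseries//; [|by move=> k; exact: mser|by move=> k t _; exact: ser0].
apply: eq_integral => t _.
have [Fv|Fv] := pselect (F2 (rv t)); last first.
  rewrite eseries0.
    by rewrite indicE memNset// mul0r.
  move=> k _ _; rewrite /ser /t2; case: (pickle_inv k) => // z.
  by rewrite [\1_F2 _]indicE memNset// mulr0 !mul0r mulr0.
have [z0 [[Pz0 Fz0] uz0]] := H2 _ Fv.
apply: (serE _ _ _ z0) => //.
  by rewrite /t2 [\1_F1 _]indicE mem_set// mul1r.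
move=> z Pz zz0; rewrite /t2 [\1_F1 _]indicE memNset ?mul0r// => Fz.
by move: zz0; rewrite (uz0 z)// eqxx.
Qed.


Notation cu := (@unit_cube R n).

Definition supported (V : nmodType) (S : pred 'I_n) (v : 'rV[V]_n) :=
  forall k, ~~ S k -> v 0%R k = 0%R.

Lemma cube_unique (S : pred 'I_n) (v : 'rV[R]_n) :
  (forall k, ~~ S k -> 0%R <= v 0%R k < 1%R)%R ->
  exists! z : 'rV[int]_n, supported S z /\ cu (v - map_mx intr z)%R.
Proof.
move=> vS; exists (\row_k Num.floor (v 0%R k)); split.
  split=> k.
    move=> /vS /andP[v0 v1]; rewrite mxE; apply/eqP; rewrite eq_le.
    by rewrite Num.Theory.floor_ge_int v0 andbT -ltzD1 Num.Theory.floor_lt_int v1.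
  by rewrite !mxE subr_ge0 Num.Theory.floor_le/= ltrBlDr addrC -[1%R]/(1%:~R) -intrD Num.Theory.floorD1_gt.
move=> z [zS zc]; apply/rowP => k; rewrite mxE; apply/eqP.
have := zc k; rewrite !mxE subr_ge0 ltrBlDr => /andP[z1 z2].
by apply/eqP/floor_def; rewrite z1 intrD addrC /=.
Qed.

Notation cube f := (\int[lam]_t (\1_(cu) (rv t) * f (rv t))%:E).

(** The translated cube is another fundamental domain for the translations by
    integer vectors supported on S. *)
Lemma integral_cube_shift (S : pred 'I_n) (s : 'rV[R]_n) (f : 'rV[R]_n -> R) :
  supported S s -> measurable_fun setT (fun t => f (rv t)) -> (forall v, 0 <= f v)%R ->
  (forall z : 'rV[int]_n, supported S z -> forall v, f (v + map_mx intr z)%R = f v) ->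
  cube (fun v => f (v + s)%R) = cube f.
Proof.
move=> sS mf f0 fP.
have mC : borel (cu) by exact: borel_unit_cube.
have mrv : measurable_row (fun t : Rtuple R n => rv t) by exact: measurable_row_rv.
have mD : borel [set v | cu (v - s)%R].
  apply: (borel_preimage (F := fun v => v - s)%R) => //.
  by apply: measurable_rowD => //; exact: measurable_row_cst.
transitivity (\int[lam]_t (\1_[set v | cu (v - s)%R] (rv t) * f (rv t))%:E).
  rewrite -[RHS](ge0_integral_row_shift s
    (f := fun v => (\1_[set v | cu (v - s)%R] v * f v)%:E)).
  - apply: eq_integral => t _; congr ((_ * _)%:E); rewrite !indicE.
    by congr (nat_of_bool _)%:R; apply/idP/idP; rewrite !inE /= addrK.
  - apply/measurable_EFinP; apply: measurable_funM => //.
    exact: measurable_row_indic.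
  - by move=> v; rewrite lee_fin mulr_ge0.
apply: (@integral_domain_change (fun z => - map_mx intr z)%R (supported S)) => //.
- by move=> z v zS; rewrite -(fP z zS (v - map_mx intr z)%R) subrK.
- move=> v /= vF; apply: cube_unique => k kS.
  by have := vF k; rewrite !mxE sS// subr0.
- move=> v /= vF; have [|z [[zS zF] zu]] := @cube_unique S (v - s)%R _.
    by move=> k kS; rewrite !mxE sS// subr0.
  exists (- z)%R; split.
    split; first by move=> k kS; rewrite mxE zS// oppr0.
    by rewrite map_mxN opprK addrAC.
  move=> z' [z'S z'F]; rewrite -[z']opprK; congr (- _)%R; apply: zu; split.
    by move=> k kS; rewrite mxE z'S// oppr0.
  by move: z'F; rewrite map_mxN opprK addrAC.
Qed.

Lemma integral_cube_average (I : finType) (S : pred 'I_n) (s : I -> 'rV[R]_n)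
    (f : 'rV[R]_n -> R) (ka : R) :
  (0 < #|I|)%N -> (forall i, supported S (s i)) ->
  measurable_fun setT (fun t => f (rv t)) -> (forall v, 0 <= f v)%R ->
  (forall z : 'rV[int]_n, supported S z -> forall v, f (v + map_mx intr z)%R = f v) ->
  (forall v, \sum_i f (v + s i) <= #|I|%:R * ka)%R ->
  cube f <= ka%:E.
Proof.
move=> I0 sS mf f0 fP fka.
have mrv : measurable_row (fun t : Rtuple R n => rv t) by exact: measurable_row_rv.
have m1 : measurable_fun setT (fun t : Rtuple R n => \1_(cu) (rv t) : R).
  by apply: measurable_row_indic => //; exact: borel_unit_cube.
have mfs i : measurable_fun setT (fun t => f (rv t + s i)%R).
  apply: (measurable_fun_row (F := fun t => rv t + s i)%R) => //.
  by apply: measurable_rowD => //; exact: measurable_row_cst.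
have I0' : (0 < #|I|%:R :> R)%R by rewrite ltr0n.
rewrite -(@lee_pmul2l _ #|I|%:R%:E)// -EFinM.
have -> : #|I|%:R%:E * cube f = \sum_i cube (fun v => f (v + s i)%R).
  under eq_bigr do rewrite (integral_cube_shift (sS _) mf f0 fP).
  rewrite big_const mule_natl; set x := cube f.
  elim: #|I| => //= k <-; case: k => [|k]; first by rewrite mule0n adde0.
  by [].
rewrite -ge0_integral_sum//; last 2 first.
- by move=> i; apply/measurable_EFinP; exact: measurable_funM.
- by move=> i t _; rewrite lee_fin mulr_ge0.
apply: (@le_trans _ _ (\int[lam]_t ((#|I|%:R * ka) * \1_(cu) (rv t))%:E)).
  apply: ge0_le_integral => //.
  - by move=> t _; apply: sume_ge0 => i _; rewrite lee_fin mulr_ge0.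
  - by apply: emeasurable_sum => i; apply/measurable_EFinP; exact: measurable_funM.
  - by apply/measurable_EFinP; exact: measurable_funM.
  - move=> t _; rewrite sumEFin lee_fin -mulr_sumr mulrC; exact: ler_wpM2r.
have ka0 : (0 <= #|I|%:R * ka)%R by apply: (le_trans _ (fka 0%R)); exact: sumr_ge0.
under eq_integral do rewrite EFinM.
rewrite ge0_integralZl_EFin//; last exact/measurable_EFinP.
by rewrite integral_row_indic ?vol_unit_cube ?mule1//; exact: borel_unit_cube.
Qed.

End fundamental_domains.

(** * Correlations under translations of one column *)
(** Either some vector is orthogonal to one of m, m' but not to the other, or
    both are integral multiples of a common vector, with coprime factors. *)
Lemma int_pair_cases d (m m' : 'rV[int]_d) :
  [\/ (m = 0 /\ m' = 0),
      (exists z : 'cV[int]_d, (m *m z) 0 0 = 0 /\ (m' *m z) 0 0 != 0),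
      (exists z : 'cV[int]_d, (m' *m z) 0 0 = 0 /\ (m *m z) 0 0 != 0) |
      (exists q : 'rV[int]_d, exists a b : int,
        [/\ a != 0, b != 0, q != 0, coprimez a b & m = a *: q /\ m' = b *: q])].
Proof.
have dot (x : 'rV[int]_d) i : (x *m delta_mx i 0 : 'M[int]_1) 0 0 = x 0 i.
  by rewrite -colE mxE.
have nz (x : 'rV[int]_d) : x != 0 -> exists k, x 0 k != 0.
  move=> x0; apply/existsP; rewrite -negb_forall; apply: contra x0 => /forallP h.
  by apply/eqP/rowP => i; rewrite mxE; apply/eqP.
have [->|m0] := eqVneq m 0.
  have [->|/nz[k m'k]] := eqVneq m' 0; first by constructor 1.
  by constructor 2; exists (delta_mx k 0); rewrite mul0mx mxE dot.
have [->|m'0] := eqVneq m' 0.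
  have [k mk] := nz _ m0.
  by constructor 3; exists (delta_mx k 0); rewrite mul0mx mxE dot.
have [k mk] := nz _ m0.
pose z i : 'cV[int]_d := m 0 k *: delta_mx i 0 - m 0 i *: delta_mx k 0.
have zE (x : 'rV[int]_d) i : (x *m z i) 0 0 = m 0 k * x 0 i - m 0 i * x 0 k.
  by rewrite /z mulmxBr -!scalemxAr !mxE -/(mulmx _ _) -!dot !mxE.
have [[i ni]|pz] := pselect (exists i, (m' *m z i) 0 0 != 0).
  by constructor 2; exists (z i); split => //; rewrite zE mulrC subrr.
have {pz} par i : m 0 k * m' 0 i = m 0 i * m' 0 k.
  by apply/eqP; rewrite -subr_eq0 -zE; apply/eqP; apply: contrapT => /eqP h; apply: pz; exists i.
have m'k : m' 0 k != 0.
  have [i m'i] := nz _ m'0; apply: contra_neq m'i => h.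
  by have := par i; rewrite h mulr0 => /eqP; rewrite mulf_eq0 (negPf mk) => /eqP.
constructor 4.
pose g := gcdz (m 0 k) (m' 0 k); pose a := divz (m 0 k) g; pose b := divz (m' 0 k) g.
have g0 : g != 0 by rewrite gcdz_eq0 (negPf mk).
have aE : m 0 k = a * g by rewrite /a divzK// dvdz_gcdl.
have bE : m' 0 k = b * g by rewrite /b divzK// dvdz_gcdr.
have a0 : a != 0 by apply: contra_neq mk; rewrite aE => ->; rewrite mul0r.
have b0 : b != 0 by apply: contra_neq m'k; rewrite bE => ->; rewrite mul0r.
have cab : coprimez a b.
  have : gcdz (a * g) (b * g) = g by rewrite -aE -bE.
  rewrite -mulz_gcdl => /eqP h; rewrite /coprimez.
  have : gcdz a b * `|g|%:Z = 1 * `|g|%:Z.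
    by rewrite mul1r (eqP h); rewrite gez0_abs// /g.
  by move/mulIf => -> //; rewrite eqz_nat absz_eq0.
have par' i : a * m' 0 i = b * m 0 i.
  apply: (mulfI g0); rewrite !mulrA -![g * _]mulrC.
  by rewrite -aE -bE par mulrC.
pose q : 'rV[int]_d := \row_i divz (m 0 i) a.
have qE : m = a *: q.
  apply/rowP => i; rewrite !mxE mulrC divzK//.
  by rewrite -(Gauss_dvdzr _ cab) -par' dvdz_mulr.
exists q, a, b; split => //.
  by apply: contra_neq m0 => q0; rewrite qE q0 scaler0.
split => //; apply/rowP => i; apply: (mulfI a0).
by rewrite par' qE !mxE; ring.
Qed.

Section measurable_zerr.
Context (R : realType) d (X : measurableType d).

(** A pointwise limit of sums over windows, which are eventually constant. *)
Lemma measurable_zerr k (b : R) (f g : X -> R) : 0 < b ->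
  measurable_fun setT f -> measurable_fun setT g ->
  measurable_fun setT (fun x => zerr k b (f x) (g x)).
Proof.
move=> b0 mf mg; apply: measurable_funB; last first.
  by apply: measurable_funM => //; exact: measurable_phi_comp.
pose h M x : R := \sum_(c < (2 * M)%N.+1) phi k (f x - (b * ((c%:Z - M%:Z)%:~R + g x)) ^+ 2).
apply: (@measurable_fun_cvg _ _ _ _ h) => //.
  move=> M; apply: measurable_sum => c; apply: measurable_phi_comp.
  apply: measurable_funB => //; apply: measurable_funX.
  by apply: measurable_funM => //; exact: measurable_funD.
move=> x _; apply: cvg_near_cst; near=> M.
apply/esym/zsum_window; apply: zerr_support => //.
by near: M; exact: nbhs_infty_ger.
Unshelve. all: by end_near. Qed.

End measurable_zerr.

Section column_shifts.
Context (R : realType) (d l : nat) (j : 'I_d) (b : 'M[R]_d).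
Notation N := (nfree d l).
Notation rv := (@rV_of_tuple R _).
Notation entry k := (val (enum_val k : free_entry d l)).

Definition umx (v : 'rV[R]_N) : 'M[R]_d := unipotent_mx (tuple_of_rV v).

Definition in_column : pred 'I_N := fun k => (entry k).2 == j.

(** Translation of the column j of a unipotent matrix by s. *)
Definition shift_of (s : 'cV[R]_d) : 'rV[R]_N :=
  \row_k if (entry k).2 == j then s (entry k).1 0 else 0.

Definition col_of (V : nmodType) (v : 'rV[V]_N) : 'cV[V]_d :=
  \col_i if insub (i, j) is Some e then v 0 (enum_rank (e : free_entry d l)) else 0.

Lemma supported_shift_of s : supported in_column (shift_of s).
Proof. by move=> k kj; rewrite mxE; case: eqP => // e; move: kj; rewrite /in_column e eqxx. Qed.

Lemma umxD v s : supported in_column s ->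
  umx (v + s) = umx v + col_of s *m delta_mx 0 j.
Proof.
move=> sS; apply/matrixP => i k; rewrite !mxE big_ord1 !mxE eqxx /=.
case: eqP => [->|ik].
  case: eqP => [->|_]; last by rewrite mulr0 addr0.
  by rewrite insubF ?mul0r ?addr0//= ltnn.
have [kj|kj] := eqVneq k j.
  rewrite kj mulr1; case: insub => [e|]; last by rewrite addr0.
  by rewrite !tnth_mktuple mxE.
rewrite mulr0 addr0; case: insubP => [e _ eE|//].
rewrite !tnth_mktuple mxE sS ?addr0//.
by rewrite /in_column enum_rankK eE.
Qed.

Lemma col_of_shift_of (m : 'rV[R]_d) s : (l <= j)%N -> (forall i : 'I_d, (j <= i)%N -> m 0 i = 0) ->
  m *m col_of (shift_of s) = m *m s.
Proof.
move=> lj m0; apply/rowP => i0; rewrite !mxE; apply: eq_bigr => i _.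
have [ji|ij] := leqP j i; first by rewrite m0 ?mul0r.
congr (_ * _); rewrite ord1 mxE insubT/= ?ij// => h.
by rewrite mxE enum_rankK /= eqxx.
Qed.

Lemma col_of_intr (z : 'rV[int]_N) : col_of (map_mx intr z) = map_mx intr (col_of z) :> 'cV[R]_d.
Proof. by apply/colP => i; rewrite !mxE; case: insub => [e|//]; rewrite mxE. Qed.

Definition lattice_vec (m : 'rV[R]_d) v : 'rV[R]_d := m *m umx v *m b.

Lemma lattice_vecD m v s : supported in_column s ->
  lattice_vec m (v + s) = lattice_vec m v + (m *m col_of s) 0 0 *: row j b.
Proof.
move=> sS; rewrite /lattice_vec umxD// mulmxDr mulmxDl; congr (_ + _).
by rewrite !mulmxA [m *m _]mx11_scalar mul_scalar_mx -scalemxAl -rowE !mxE.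
Qed.

Lemma measurable_umx i k : measurable_fun setT (fun t : Rtuple R N => umx (rv t) i k).
Proof.
rewrite /umx; under eq_fun do rewrite rV_of_tupleK mxE.
case: eqP => _; first exact: measurable_cst.
by case: insub => [e|]; [exact: measurable_tnth|exact: measurable_cst].
Qed.

Lemma measurable_lattice_vec m : measurable_row (fun t : Rtuple R N => lattice_vec m (rv t)).
Proof.
apply: measurable_row_mulmx => i; under eq_fun do rewrite mxE.
by apply: measurable_sum => k; apply: measurable_funM => //; exact: measurable_umx.
Qed.

Variable T : R.

(** What the coordinates before j leave of T^2. *)
Definition height m v : R := T ^+ 2 - \sum_(i < d | (i < j)%N) lattice_vec m v 0 i ^+ 2.

(** Coordinate j of the lattice vector of m + z e_j is b_jj (z + x), where
    x = lattice_vec m v 0 j / b_jj whenever m vanishes from j on. *)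
Definition column_err m v : R := zerr (d - j.+1) (b j j) (height m v) (lattice_vec m v 0 j / b j j).

Hypotheses (ub : upper_triangular b) (b0 : forall i, 0 < b i i) (T0 : 0 <= T).

Lemma heightD m v s : supported in_column s -> height m (v + s) = height m v.
Proof.
move=> sS; rewrite /height; congr (_ - _); apply: eq_bigr => i ij.
rewrite lattice_vecD//; congr (_ ^+ 2); rewrite [LHS]mxE.
have -> : ((m *m col_of s) 0 0 *: row j b) 0 i = 0 by rewrite !mxE ub// mulr0.
by rewrite addr0.
Qed.

Lemma column_errD m v s : supported in_column s ->
  column_err m (v + s) = zerr (d - j.+1) (b j j) (height m v) (lattice_vec m v 0 j / b j j + (m *m col_of s) 0 0).
Proof.
move=> sS; rewrite /column_err heightD// lattice_vecD//; congr zerr.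
rewrite mxE [X in _ + X]mxE [row _ _ _ _]mxE mulrDl mulfK//.
by rewrite gt_eqF.
Qed.

Lemma column_err_periodic (m : 'rV[int]_d) v (z : 'rV[int]_N) : supported in_column z ->
  column_err (map_mx intr m) (v + map_mx intr z) = column_err (map_mx intr m) v.
Proof.
move=> zS; rewrite column_errD; last by move=> k /zS; rewrite mxE => ->.
rewrite col_of_intr -map_mxM.
have -> : map_mx intr (m *m col_of z) 0 0 = ((m *m col_of z) 0 0)%:~R :> R by rewrite mxE.
exact: zerr_periodic.
Qed.

Lemma measurable_column_err m : measurable_fun setT (fun t : Rtuple R N => column_err m (rv t)).
Proof.
have my := @measurable_lattice_vec m.
apply: measurable_zerr => //; last by apply: measurable_funM => //; exact: my.
apply: measurable_funB => //.
rewrite (_ : (fun t => _) = (fun t : Rtuple R N => \sum_(i < d) ((i < j)%N%:R * lattice_vec m (rv t) 0 i ^+ 2))).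
  apply: measurable_sum => i; apply: measurable_funM => //; apply: measurable_funX; exact: my.
apply/funext => t; rewrite big_mkcond; apply: eq_bigr => i _.
by case: (i < j)%N; rewrite ?mul1r ?mul0r.
Qed.

Lemma height_le m v : height m v <= T ^+ 2.
Proof. by rewrite /height gerBl sumr_ge0// => i _; exact: sqr_ge0. Qed.

Variable K : R.
Hypothesis HK : forall v x (n : nat), v <= T ^+ 2 -> (0 < n)%N ->
  `|\sum_(i < n) zerr (d - j.+1) (b j j) v (x + i%:R / n%:R)| <= K.

Lemma column_err_le m v : `|column_err m v| <= K.
Proof.
have := HK (lattice_vec m v 0 j / b j j) (height_le m v) (isT : (0 < 1)%N).
by rewrite big_ord1 mul0r addr0.
Qed.

(** Averaging over the N1 N2 translations s p1 p2 of column j makes the two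
    arguments run independently through the points p1 / N1 and p2 / N2,
    whence a product of two sums, each bounded by K. The added K^2 makes
    the integrand nonnegative. *)
Lemma column_err_correlation (m1 m2 : 'rV[int]_d) (N1 N2 : nat) (s : 'I_N1 -> 'I_N2 -> 'cV[R]_d) :
  (l <= j)%N -> (0 < N1)%N -> (0 < N2)%N ->
  (forall i : 'I_d, (j <= i)%N -> m1 0 i = 0) ->
  (forall i : 'I_d, (j <= i)%N -> m2 0 i = 0) ->
  (forall p1 p2, exists z : int, (map_mx intr m1 *m s p1 p2) 0 0 = p1%:R / N1%:R + z%:~R) ->
  (forall p1 p2, exists z : int, (map_mx intr m2 *m s p1 p2) 0 0 = p2%:R / N2%:R + z%:~R) ->
  (\int[lebesgue_tuple R N]_t (\1_(@unit_cube R N) (rv t) *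
     (column_err (map_mx intr m1) (rv t) * column_err (map_mx intr m2) (rv t) + K ^+ 2))%:E <=
   (K ^+ 2 / (N1%:R * N2%:R) + K ^+ 2)%:E)%E.
Proof.
move=> lj N10 N20 m10 m20 s1 s2.
have tl (m : 'rV[int]_d) : (forall i : 'I_d, (j <= i)%N -> m 0 i = 0) ->
    forall i : 'I_d, (j <= i)%N -> map_mx intr m 0 i = 0 :> R.
  by move=> m0 i /m0; rewrite mxE => ->.
have N12 : (0 : R) < N1%:R * N2%:R by rewrite mulr_gt0// ltr0n.
have N12n : (N1%:R != 0 :> R) && (N2%:R != 0 :> R) by rewrite !pnatr_eq0 -!lt0n N10.
apply: (@integral_cube_average _ _ ('I_N1 * 'I_N2)%type in_column (fun p => shift_of (s p.1 p.2))
  (fun v => column_err (map_mx intr m1) v * column_err (map_mx intr m2) v + K ^+ 2)).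
- by rewrite card_prod !card_ord muln_gt0 N10.
- by move=> p; exact: supported_shift_of.
- apply: measurable_funD => //; apply: measurable_funM; exact: measurable_column_err.
- move=> v; rewrite -lerBlDr sub0r; apply: lerNnormlW; rewrite normrM expr2.
  by apply: ler_pM => //; exact: column_err_le.
- by move=> z zS v; rewrite !column_err_periodic.
move=> v; rewrite card_prod !card_ord big_split/= sumr_const card_prod !card_ord.
rewrite -[K ^+ 2 *+ _]mulr_natl natrM mulrDr lerD2r.
have -> : N1%:R * N2%:R * (K ^+ 2 / (N1%:R * N2%:R)) = K * K.
  by case/andP: N12n => *; field; apply/andP.
pose a1 (p : 'I_N1) := zerr (d - j.+1) (b j j) (height (map_mx intr m1) v)
  (lattice_vec (map_mx intr m1) v 0 j / b j j + p%:R / N1%:R).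
pose a2 (p : 'I_N2) := zerr (d - j.+1) (b j j) (height (map_mx intr m2) v)
  (lattice_vec (map_mx intr m2) v 0 j / b j j + p%:R / N2%:R).
have -> : \sum_(i : 'I_N1 * 'I_N2) column_err (map_mx intr m1) (v + shift_of (s i.1 i.2)) *
     column_err (map_mx intr m2) (v + shift_of (s i.1 i.2)) = (\sum_p a1 p) * (\sum_p a2 p).
  rewrite big_distrlr/= pair_big/=; apply: eq_bigr => -[p1 p2] _ /=.
  rewrite !(column_errD _ _ (supported_shift_of _)) !col_of_shift_of//; [|exact: tl|exact: tl].
  have [z1 ->] := s1 p1 p2; have [z2 ->] := s2 p1 p2.
  by rewrite !addrA !zerr_periodic.
apply: le_trans (ler_norm _) _; rewrite normrM; apply: ler_pM => //.
  by apply: HK => //; exact: height_le.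
by apply: HK => //; exact: height_le.
Qed.

End column_shifts.

(** * Summation over pairs of integer vectors *)
Section windows.
Variables (d M : nat).
Notation W := ('I_(2 * M)%N.+1).

Definition centered (c : W) : int := c%:Z - M%:Z.
Definition centered_row (m : 'rV[W]_d) : 'rV[int]_d := \row_i centered (m 0 i).
(** An integer vector of j entries is encoded by one of d entries, of which those
    from j on vanish, so that all the S_j are sums over one type. *)
Definition tailed (j : nat) (m : 'rV[W]_d) := [forall i : 'I_d, (j <= i)%N ==> (centered (m 0 i) == 0)].

Lemma centered_inj : injective centered.
Proof. by move=> c c' /addIr [] /val_inj. Qed.

Lemma centered_row_inj : injective centered_row.
Proof.
by move=> m m' /rowP h; apply/rowP => i; apply: centered_inj; have := h i; rewrite !mxE.
Qed.

Lemma centered_le c : (`|centered c| <= M)%N.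
Proof. by rewrite /centered; have := ltn_ord c; lia. Qed.

Lemma centered_surj z : (`|z| <= M)%N -> exists c, centered c = z.
Proof.
move=> zM; have h : (`|(z + M%:Z)%R| < (2 * M)%N.+1)%N by lia.
by exists (Ordinal h); rewrite /centered /=; lia.
Qed.

Lemma centered_row_surj (v : 'rV[int]_d) : (forall i, (absz (v 0%R i) <= M)%N) -> exists m, centered_row m = v.
Proof.
move=> vM; have [f fP] := choice (fun i => centered_surj (vM i)).
by exists (\row_i f i); apply/rowP => i; rewrite !mxE.
Qed.

Lemma tailedP j m : reflect (forall i : 'I_d, (j <= i)%N -> centered_row m 0 i = 0) (tailed j m).
Proof.
apply: (iffP forallP) => h i.
  by move=> ji; have /implyP/(_ ji)/eqP := h i; rewrite mxE.
by apply/implyP => /h; rewrite mxE => ->.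
Qed.

Lemma ivec_centered (R : realType) m : ivec R M m = map_mx intr (centered_row m).
Proof. by apply/rowP => i; rewrite !mxE /centered rmorphB/= !pmulrn. Qed.

Definition center : W := inord M.
Lemma centered_center : centered center = 0.
Proof. by rewrite /centered /center inordK ?subrr//; lia. Qed.

Definition set_entry (j : 'I_d) (m : 'rV[W]_d) (c : W) : 'rV[W]_d := \row_i if i == j then c else m 0 i.

Lemma sum_tailedS (V : nmodType) (F : 'rV[W]_d -> V) (j : 'I_d) :
  \sum_(m | tailed j.+1 m) F m = \sum_(m | tailed j m) \sum_c F (set_entry j m c).
Proof.
rewrite pair_big_dep/=.
rewrite (reindex_onto (fun p : 'rV[W]_d * W => set_entry j p.1 p.2) (fun m => (set_entry j m center, m 0 j)))/=.
  apply: eq_bigl => -[m c] /=; rewrite andbT xpair_eqE mxE eqxx eqxx andbT.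
  apply/andP/tailedP => [[/tailedP h /eqP mE] i ji|h].
    rewrite -mE !mxE; case: eqP => [_|/eqP ij]; first exact: centered_center.
    have := h i; rewrite !mxE (negPf ij); apply.
    by rewrite ltn_neqAle ji andbT eq_sym.
  split.
    apply/tailedP => i ji; rewrite !mxE gt_eqF//.
    by have := h i (ltnW ji); rewrite mxE.
  apply/eqP/rowP => i; rewrite !mxE; case: eqP => [->|//].
  by apply: centered_inj; rewrite centered_center; have := h j (leqnn _); rewrite mxE.
move=> m /tailedP h; apply/rowP => i; rewrite !mxE; case: eqP => [->//|//].
Qed.

Lemma sum_tailed0 (V : nmodType) (F : 'rV[W]_d -> V) :
  \sum_(m | tailed 0 m) F m = F (const_mx center).
Proof.
rewrite (big_pred1 (const_mx center))// => m; apply/tailedP/eqP => [h|-> i _]; last by rewrite !mxE centered_center.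
by apply/rowP => i; apply: centered_inj; rewrite !mxE centered_center; have := h i isT; rewrite mxE.
Qed.

Lemma card_tailed (R : realType) j : (j <= d)%N ->
  #|[pred m | tailed j m]|%:R = (2 * M).+1%:R ^+ j :> R.
Proof.
rewrite -[LHS](sumr_const (fun m => tailed j m) (1 : R)).
elim: j => [_|j IH jd]; first by rewrite sum_tailed0.
rewrite exprSr -IH ?(ltnW jd)// (@sum_tailedS _ (fun=> 1) (Ordinal jd)) mulr_suml.
by apply: eq_bigr => m _; rewrite sumr_const card_ord mul1r.
Qed.

End windows.

Section pair_counting.
Context (R : realType) (d l : nat) (j : 'I_d) (b : 'M[R]_d) (T K : R) (M : nat).
Notation N := (nfree d l).
Notation rv := (@rV_of_tuple R _).
Notation W := ('I_(2 * M)%N.+1).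
Hypotheses (lj : (l <= j)%N) (ub : upper_triangular b) (b0 : forall i, 0 < b i i) (T0 : 0 <= T).
Hypothesis HK : forall v x (n : nat), v <= T ^+ 2 -> (0 < n)%N ->
  `|\sum_(i < n) zerr (d - j.+1) (b j j) v (x + i%:R / n%:R)| <= K.

Definition recip (a : W) : R := `|centered a|%N%:R^-1.

Lemma recip_ge0 a : 0 <= recip a. Proof. by rewrite invr_ge0. Qed.

(** At least 1 / |a c| when the pair is (a q, c q) with q in the window; as a sum over
    all q, a, c it is easy to sum over the pairs in turn. *)
Definition ratio_weight (m1 m2 : 'rV[W]_d) : R :=
  \sum_(q : 'rV[W]_d | tailed j q) \sum_(a : W) \sum_(c : W)
    ((centered_row m1 == centered a *: centered_row q) && (centered_row m2 == centered c *: centered_row q))%:R *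
    (recip a * recip c).

Lemma ler_sum_term (I : finType) (P : pred I) (F : I -> R) i :
  (forall k, 0 <= F k) -> P i -> F i <= \sum_(k | P k) F k.
Proof. by move=> F0 Pi; rewrite (bigD1 i)//= lerDl sumr_ge0. Qed.

Lemma ratio_weight_ge0 m1 m2 : 0 <= ratio_weight m1 m2.
Proof.
by do 3!apply: sumr_ge0 => ? _; rewrite mulr_ge0// mulr_ge0// recip_ge0.
Qed.

Notation E m v := (@column_err R d l j b T (map_mx intr (centered_row m)) v).

Lemma intr_sg (z : int) : z%:~R = (sgz z)%:~R * `|z|%N%:R :> R.
Proof. by rewrite [in LHS](intEsg z) rmorphM. Qed.

(** The bound 1 / n stands for an arbitrarily small quantity: it suffices
    for the pairs in which the argument of one error can be moved alone. *)
Lemma column_err_pair (n : nat) (m1 m2 : 'rV[W]_d) : (0 < n)%N -> tailed j m1 -> tailed j m2 ->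
  (\int[lebesgue_tuple R N]_t (\1_(@unit_cube R N) (rv t) *
     (E m1 (rv t) * E m2 (rv t) + K ^+ 2))%:E <=
   (K ^+ 2 * (((centered_row m1 == 0) && (centered_row m2 == 0))%:R + n%:R^-1 + ratio_weight m1 m2) + K ^+ 2)%:E)%E.
Proof.
move=> n0 /tailedP t1 /tailedP t2.
have K2 : 0 <= K ^+ 2 by exact: sqr_ge0.
have nV : 0 <= (n%:R : R)^-1 by rewrite invr_ge0.
have rw0 := ratio_weight_ge0 m1 m2.
have Nn0 : (n%:R : R) != 0 by rewrite pnatr_eq0 -lt0n.
have dotz (x : 'rV[int]_d) (z : 'cV[int]_d) (y : R) :
    (map_mx intr x *m (y *: map_mx intr z)) 0 0 = y * ((x *m z) 0 0)%:~R.
  by rewrite -scalemxAr -map_mxM mxE [map_mx _ _ _ _]mxE.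
have bound (y z : R) : y <= z -> ((K ^+ 2 * y + K ^+ 2)%R%:E <= (K ^+ 2 * z + K ^+ 2)%R%:E)%E.
  by move=> yz; rewrite lee_fin lerD2r ler_wpM2l.
have corr := @column_err_correlation R d l j b T ub b0 K HK (centered_row m1) (centered_row m2).
case: (int_pair_cases (centered_row m1) (centered_row m2)) => [[e1 e2]|[z [z1 z2]]|[z [z1 z2]]|].
- apply: le_trans (bound _ _ _); first apply: (corr 1%N 1%N (fun _ _ => 0)) => //.
  + by move=> p1 p2; exists 0; rewrite mulmx0 mxE ord1 mul0r addr0.
  + by move=> p1 p2; exists 0; rewrite mulmx0 mxE ord1 mul0r addr0.
  by rewrite e1 e2 eqxx mulr1 invr1 -addrA lerDl addr_ge0.
- set D := (centered_row m2 *m z) 0 0 in z2.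
  have D0 : (D%:~R : R) != 0 by rewrite intr_eq0.
  apply: le_trans (bound _ _ _).
    apply: (corr 1%N n (fun _ p => (p%:R / n%:R / D%:~R) *: map_mx intr z)) => //.
    + by move=> p1 p2; exists 0; rewrite dotz z1 mulr0 ord1 mul0r addr0.
    + by move=> p1 p2; exists 0; rewrite dotz -/D divfK// addr0.
  by rewrite mul1r -addrA addrCA lerDl addr_ge0.
- set D := (centered_row m1 *m z) 0 0 in z2.
  have D0 : (D%:~R : R) != 0 by rewrite intr_eq0.
  apply: le_trans (bound _ _ _).
    apply: (corr n 1%N (fun p _ => (p%:R / n%:R / D%:~R) *: map_mx intr z)) => //.
    + by move=> p1 p2; exists 0; rewrite dotz -/D divfK// addr0.
    + by move=> p1 p2; exists 0; rewrite dotz z1 mulr0 ord1 mul0r addr0.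
  by rewrite mulr1 -addrA addrCA lerDl addr_ge0.
move=> [q [x [y [x0 y0 q0 cxy [e1 e2]]]]].
have [k qk] : exists k, q 0 k != 0.
  apply/existsP; rewrite -negb_forall; apply: contra q0 => /forallP h.
  by apply/eqP/rowP => i; rewrite mxE; apply/eqP.
have m1E i : centered (m1 0 i) = x * q 0 i by have := congr1 (fun v : 'rV[int]_d => v 0 i) e1; rewrite !mxE.
have m2E i : centered (m2 0 i) = y * q 0 i by have := congr1 (fun v : 'rV[int]_d => v 0 i) e2; rewrite !mxE.
have [qi qiE] : exists qi : 'rV[W]_d, centered_row qi = q.
  apply: (@centered_row_surj d M) => i; have := centered_le (m1 0 i); rewrite m1E abszM.
  by apply: leq_trans; rewrite leq_pmull// absz_gt0.
have [xi xiE] : exists xi : W, centered xi = x.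
  apply: (@centered_surj M); have := centered_le (m1 0 k); rewrite m1E abszM.
  by apply: leq_trans; rewrite leq_pmulr// absz_gt0.
have [yi yiE] : exists yi : W, centered yi = y.
  apply: (@centered_surj M); have := centered_le (m2 0 k); rewrite m2E abszM.
  by apply: leq_trans; rewrite leq_pmulr// absz_gt0.
have tq : tailed j qi.
  apply/tailedP => i /t1; rewrite mxE m1E qiE => /eqP; rewrite mulf_eq0 (negPf x0) => /eqP.
  by [].
have [[u v] /= uv] : exists p : int * int, p.1 * x + p.2 * y = 1.
  by have [u [v uv]] := Bezoutz x y; exists (u, v); rewrite uv (eqP cxy).
have xa : (`|x|%N%:R : R) != 0 by rewrite pnatr_eq0 absz_eq0.
have ya : (`|y|%N%:R : R) != 0 by rewrite pnatr_eq0 absz_eq0.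
have qk' : ((q 0 k)%:~R : R) != 0 by rewrite intr_eq0.
(* As u x + v y = 1, up to integers this translation moves the argument of
   m1 = x q by p1 / |y| and that of m2 = y q by p2 / |x|. *)
pose s (p1 : 'I_`|y|%N) (p2 : 'I_`|x|%N) : 'cV[R]_d :=
  ((p1%:R * u%:~R / `|y|%N%:R + p2%:R * v%:~R / `|x|%N%:R) / (q 0 k)%:~R) *:
  map_mx intr (delta_mx k 0 : 'cV[int]_d).
have dk (c : int) : ((c *: q) *m (delta_mx k 0 : 'cV[int]_d)) 0 0 = c * q 0 k.
  by rewrite -colE !mxE.
have uvR : u%:~R * x%:~R + v%:~R * y%:~R = 1 :> R by rewrite -!intrM -intrD uv.
apply: le_trans (bound _ _ _).
  apply: (corr _ _ s) => //; rewrite ?absz_gt0//.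
  + move=> p1 p2; exists (p2%:Z * v * sgz x - p1%:Z * v * sgz y).
    rewrite /s dotz e1 dk !(rmorphM, rmorphB)/= !pmulrn.
    have := uvR; rewrite (intr_sg x) (intr_sg y) => {}uvR.
    apply/eqP; rewrite -subr_eq0; apply/eqP.
    transitivity (p1%:R / `|y|%N%:R * (u%:~R * ((sgz x)%:~R * `|x|%N%:R) + v%:~R * ((sgz y)%:~R * `|y|%N%:R) - 1) : R).
      by field; rewrite qk' ya xa.
    by rewrite uvR subrr mulr0.
  + move=> p1 p2; exists (p1%:Z * u * sgz y - p2%:Z * u * sgz x).
    rewrite /s dotz e2 dk !(rmorphM, rmorphB)/= !pmulrn.
    have := uvR; rewrite (intr_sg x) (intr_sg y) => {}uvR.
    apply/eqP; rewrite -subr_eq0; apply/eqP.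
    transitivity (p2%:R / `|x|%N%:R * (u%:~R * ((sgz x)%:~R * `|x|%N%:R) + v%:~R * ((sgz y)%:~R * `|y|%N%:R) - 1) : R).
      by field; rewrite qk' ya xa.
    by rewrite uvR subrr mulr0.
apply: (@le_trans _ _ (ratio_weight m1 m2)); last by rewrite lerDr addr_ge0.
have nn q' a c : 0 <= ((centered_row m1 == centered a *: centered_row q') && (centered_row m2 == centered c *: centered_row q'))%:R *
    (recip a * recip c) by rewrite mulr_ge0// mulr_ge0// recip_ge0.
rewrite /ratio_weight; apply: le_trans (@ler_sum_term _ _ (fun q => \sum_a \sum_c _) qi _ tq); last first.
  by move=> q'; do 2!apply: sumr_ge0 => ? _.
apply: le_trans (@ler_sum_term _ xpredT (fun a => \sum_c _) xi _ isT); last first.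
  by move=> a; apply: sumr_ge0 => ? _.
apply: le_trans (@ler_sum_term _ xpredT _ yi _ isT); last by move=> c.
by rewrite e1 e2 xiE yiE qiE !eqxx /= mul1r /recip xiE yiE invfM mulrC.
Qed.

Lemma sum_inj_le1 (I : finType) (J : eqType) (P : pred I) (f : I -> J) y : injective f ->
  \sum_(i | P i) (f i == y)%:R <= 1 :> R.
Proof.
move=> fi; have [[i /eqP iy]|ne] := pselect (exists i, f i == y).
  rewrite big_mkcond (bigD1 i)//= big1 ?addr0; last first.
    move=> k ki; case: ifP => // _; case: eqP => // ky.
    by move: ki; rewrite (fi k i) ?eqxx// ky iy.
  by case: ifP => // _; case: (f i == y).
rewrite big1// => i _; case: eqP => // iy; by exfalso; apply: ne; exists i; apply/eqP.
Qed.

Notation H := (\sum_a recip a).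
Notation n := #|[pred m : 'rV[W]_d | tailed j m]|.

(** A triple (q, a, c) determines the pair (a q, c q): each triple is counted at
    most once. *)
Lemma sum_ratio_weight :
  \sum_(m1 | tailed j m1) \sum_(m2 | tailed j m2) ratio_weight m1 m2 <= n%:R * H ^+ 2.
Proof.
have -> : n%:R * H ^+ 2 = \sum_(q : 'rV[W]_d | tailed j q) \sum_a \sum_c recip a * recip c.
  rewrite sumr_const -[RHS]mulr_natl; congr (_ * _).
  by rewrite expr2 big_distrlr.
rewrite /ratio_weight; under eq_bigr do rewrite exchange_big/=; rewrite exchange_big/=.
apply: ler_sum => q _.
under eq_bigr do rewrite exchange_big/=; rewrite exchange_big/=; apply: ler_sum => a _.
under eq_bigr do rewrite exchange_big/=; rewrite exchange_big/=; apply: ler_sum => c _.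
under eq_bigr do rewrite -mulr_suml; rewrite -mulr_suml.
apply: ler_piMl; first by rewrite mulr_ge0// recip_ge0.
under eq_bigr => m1 _ do under eq_bigr => m2 _ do rewrite -mulnb natrM.
rewrite -big_distrlr/=; apply: mulr_ile1; rewrite ?sumr_ge0//.
  exact/sum_inj_le1/centered_row_inj.
exact/sum_inj_le1/centered_row_inj.
Qed.

(** The square is expanded; the sums and the integral are exchanged after adding
    K^2 to each product of errors, and the integral c of what was added is cancelled
    at the end. *)
Lemma column_err_square_sum :
  (\int[lebesgue_tuple R N]_t (\1_(@unit_cube R N) (rv t) *
     (\sum_(m : 'rV[W]_d | tailed j m) E m (rv t)) ^+ 2)%:E <=
   (K ^+ 2 * (2 + n%:R * H ^+ 2))%:E)%E.
Proof.
pose s := [seq p <- index_enum ('rV[W]_d * 'rV[W]_d)%type | tailed j p.1 && tailed j p.2].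
have K2 : 0 <= K ^+ 2 by exact: sqr_ge0.
have sumE (F : 'rV[W]_d -> 'rV[W]_d -> R) :
    \sum_(p <- s) F p.1 p.2 = \sum_(m1 | tailed j m1) \sum_(m2 | tailed j m2) F m1 m2.
  by rewrite /s big_filter pair_big.
have mrv : measurable_row (fun t : Rtuple R N => rv t) by exact: measurable_row_rv.
have mc : measurable_fun setT (fun t : Rtuple R N => \1_(@unit_cube R N) (rv t) : R).
  by apply: measurable_row_indic => //; exact: borel_unit_cube.
have mE (m : 'rV[W]_d) : measurable_fun setT (fun t : Rtuple R N => E m (rv t)) by exact: measurable_column_err.
have c0 t : 0 <= \1_(@unit_cube R N) (rv t) :> R by [].
pose c : R := n%:R * n%:R * K ^+ 2.
have cE : \sum_(p <- s) K ^+ 2 = c.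
  by rewrite (sumE (fun _ _ => K ^+ 2)) !sumr_const -!mulrnA -mulr_natl natrM.
have cc0 : 0 <= c by exact: mulr_ge0 (mulr_ge0 (ler0n _ _) (ler0n _ _)) K2.
have main : (\int[lebesgue_tuple R N]_t (\1_(@unit_cube R N) (rv t) *
     (\sum_(m : 'rV[W]_d | tailed j m) E m (rv t)) ^+ 2)%:E + c%:E <=
   (K ^+ 2 * (2 + n%:R * H ^+ 2))%:E + c%:E)%E.
  have cI : (c%:E = \int[lebesgue_tuple R N]_t (c * \1_(@unit_cube R N) (rv t))%:E)%E.
    under eq_integral do rewrite EFinM.
    rewrite ge0_integralZl_EFin//; last exact/measurable_EFinP.
    by rewrite integral_row_indic ?vol_unit_cube ?mule1//; exact: borel_unit_cube.
  rewrite [in leLHS]cI -ge0_integralD//=; last 4 first.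
  - by move=> t _; rewrite lee_fin mulr_ge0// sqr_ge0.
  - apply/measurable_EFinP; apply: measurable_funM => //; apply: measurable_funX.
    rewrite (_ : (fun t => _) = (fun t => \sum_(m <- [seq m <- index_enum 'rV[W]_d | tailed j m]) E m (rv t))).
      exact: measurable_sum.
    by apply/funext => t; rewrite big_filter.
  - by move=> t _; rewrite lee_fin mulr_ge0.
  - by apply/measurable_EFinP; exact: measurable_funM.
  under eq_integral => t _.
    rewrite -EFinD (_ : _ + _ = \sum_(p <- s) \1_(@unit_cube R N) (rv t) *
       (E p.1 (rv t) * E p.2 (rv t) + K ^+ 2)); last first.
      rewrite -mulr_sumr [X in _ = _ * X]big_split/= cE [c * _]mulrC -mulrDr; congr (_ * (_ + _)).
      by rewrite (sumE (fun m1 m2 => E m1 (rv t) * E m2 (rv t))) expr2 big_distrlr.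
    rewrite -sumEFin.
    over.
  have pos (m1 m2 : 'rV[W]_d) t : 0 <= \1_(@unit_cube R N) (rv t) * (E m1 (rv t) * E m2 (rv t) + K ^+ 2).
    rewrite mulr_ge0// -lerBlDr sub0r; apply: lerNnormlW; rewrite normrM expr2.
    by apply: ler_pM => //; exact: column_err_le.
  rewrite ge0_integral_sum//; last 2 first.
  - move=> p; apply/measurable_EFinP; apply: measurable_funM => //.
    by apply: measurable_funD => //; exact: measurable_funM.
  - by move=> p t _; rewrite lee_fin.
  pose ka (p : 'rV[W]_d * 'rV[W]_d) : R :=
    K ^+ 2 * (((centered_row p.1 == 0) && (centered_row p.2 == 0))%:R + (n * n).+1%:R^-1 + ratio_weight p.1 p.2) + K ^+ 2.
  apply: (@le_trans _ _ (\sum_(p <- s) (ka p)%:E)%E).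
    rewrite big_seq [leRHS]big_seq; apply: lee_sum => p.
    by rewrite mem_filter => /andP[/andP[t1 t2] _]; exact: column_err_pair.
  rewrite sumEFin -EFinD lee_fin /ka big_split/= cE lerD2r -mulr_sumr ler_wpM2l// !big_split/=.
  rewrite (sumE (fun m1 m2 => ((centered_row m1 == 0) && (centered_row m2 == 0))%:R)).
  rewrite (sumE (fun m1 m2 => (n * n).+1%:R^-1)) (sumE ratio_weight).
  apply: lerD; last exact: sum_ratio_weight.
  rewrite -[2]/(1 + 1); apply: lerD.
    under eq_bigr => m1 _ do under eq_bigr => m2 _ do rewrite -mulnb natrM.
    rewrite -big_distrlr/=; apply: mulr_ile1; rewrite ?sumr_ge0//.
      exact/sum_inj_le1/centered_row_inj.
    exact/sum_inj_le1/centered_row_inj.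
  rewrite !sumr_const -!mulrnA -[leLHS]mulr_natl ler_pdivrMr ?ltr0n// mul1r ler_nat.
  exact: ltnW.
by move: main; rewrite leeD2rE.
Qed.

End pair_counting.

(** * Replacing sums by integrals one coordinate at a time *)
Section triangular.
Context (R : realType) (d : nat).

Lemma big_ltS (V : nmodType) (j : 'I_d) (F : 'I_d -> V) :
  \sum_(i < d | (i < j.+1)%N) F i = \sum_(i < d | (i < j)%N) F i + F j.
Proof.
rewrite (bigD1 j)//= addrC; congr (_ + _); apply: eq_bigl => i.
by rewrite ltnS [in RHS]ltn_neqAle andbC.
Qed.

(** Forward substitution: entry k of m is bounded by (T + W times the sum of the
    previous ones) / be, and this quantity grows by a factor of at most 1 + W / be
    at each step. *)
Lemma forward_bound (w : 'M[R]_d) (be W T : R) (m : 'rV[R]_d) (k : 'I_d) :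
  upper_triangular w -> 0 < be -> (forall i, be <= w i i) ->
  (forall i j, `|w i j| <= W) -> 0 <= T ->
  (forall i : 'I_d, (i <= k)%N -> `|(m *m w) 0 i| <= T) ->
  `|m 0 k| <= T / be * (1 + W / be) ^+ d.
Proof.
move=> uw be0 wbe wW T0 mT.
have W0 : 0 <= W by apply: le_trans (wW k k); exact: normr_ge0.
have Wb : 0 <= W / be by rewrite divr_ge0// ltW.
have step n (nd : (n < d)%N) : (n <= k)%N ->
    be * `|m 0 (Ordinal nd)| <= T + W * \sum_(i < d | (i < n)%N) `|m 0 i|.
  move=> nk; set i0 := Ordinal nd.
  apply: (@le_trans _ _ `|m 0 i0 * w i0 i0|).
    by rewrite normrM mulrC ler_wpM2l// (le_trans (wbe i0))// ler_norm.
  have -> : m 0 i0 * w i0 i0 = (m *m w) 0 i0 - \sum_(i < d | (i < n)%N) m 0 i * w i i0.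
    rewrite mxE (bigID (fun i : 'I_d => (i < n.+1)%N))/= (@big_ltS _ i0).
    rewrite [X in _ + X - _]big1; first by rewrite addr0 addrAC subrr add0r.
    by move=> i; rewrite -leqNgt => ni; rewrite uw ?mulr0.
  apply: (le_trans (ler_normB _ _)); apply: lerD; first exact: mT.
  rewrite mulr_sumr; apply: (le_trans (ler_norm_sum _ _ _)); apply: ler_sum => i _.
  by rewrite normrM mulrC ler_wpM2r.
have main n : (n <= k)%N ->
    T + W * \sum_(i < d | (i < n)%N) `|m 0 i| <= T * (1 + W / be) ^+ n.
  elim: n => [_|n IH nk].
    by rewrite big_pred0// mulr0 addr0 expr0 mulr1.
  have nd : (n < d)%N by apply: ltn_trans nk _.
  have := step n nd (ltnW nk); have := IH (ltnW nk).
  rewrite (@big_ltS _ (Ordinal nd))/=; set A := T + _; set x := `|m 0 _| => AT hx.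
  rewrite mulrDr addrA -/A exprSr mulrA mulrDr mulr1.
  have h1 : W * x <= A * (W / be).
    have -> : W * x = (be * x) * (W / be) by field; exact: lt0r_neq0.
    exact: ler_wpM2r.
  apply: le_trans (lerD (lexx A) h1) _.
  by apply: lerD => //; rewrite ler_wpM2r.
rewrite -(ler_pM2l be0); have := step k (ltn_ord k) (leqnn _).
rewrite (_ : Ordinal _ = k); last exact: val_inj.
move=> h; apply: (le_trans h); apply: (le_trans (main k (leqnn _))).
rewrite mulrA [be * _]mulrC divfK ?gt_eqF// ler_wpM2l// ler_weXn2l//; last exact: ltnW.
by rewrite lerDl.
Qed.

End triangular.

Section peeling.
Context (R : realType) (d l : nat) (b : 'M[R]_d) (T be : R) (M : nat).
Notation N := (nfree d l).
Notation W := ('I_(2 * M)%N.+1).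
Hypotheses (ub : upper_triangular b) (be0 : 0 < be) (bbe : forall i, be <= b i i) (T0 : 0 <= T).

Definition abs_sum : R := \sum_i \sum_k `|b i k|.

Hypothesis MT : T / be * (1 + abs_sum / be) ^+ d <= M%:R.

Lemma diag_gt0 i : 0 < b i i. Proof. exact: lt_le_trans (bbe i). Qed.

(** The volume of the unit ball of R^(d-j) over the covolume of the block of b from
    index j on: the density of the points of the fibers of the lattice over the
    first j coordinates. *)
Definition tail_density (j : nat) : R := phiC R 0 (d - j) / \prod_(i < d | (j <= i)%N) b i i.

Lemma tail_densityS (j : 'I_d) : tail_density j = tail_density j.+1 * (phic R (d - j.+1) / b j j).
Proof.
rewrite /tail_density (bigD1 j)//= -[(d - j)%N]prednK ?subn_gt0// -subnS phiCS add0n invfM.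
rewrite (eq_bigl (fun i : 'I_d => (j < i)%N)); first ring.
by move=> i; rewrite [RHS]ltn_neqAle andbC eq_sym.
Qed.

Definition ctail (j : nat) (v : 'rV[R]_N) (m : 'rV[R]_d) : R :=
  T ^+ 2 - \sum_(i < d | (i < j)%N) (lattice_vec b m v) 0 i ^+ 2.

(** The number S_j of the introduction: the sum over the last d - j integers is
    replaced by the integral, the volume of a ball of R^(d-j) of radius
    sqrt(ctail j v m) divided by the covolume of the last block of b. *)
Definition partial_count (j : nat) (v : 'rV[R]_N) : R :=
  tail_density j * \sum_(m : 'rV[W]_d | tailed j m) phi (d - j) (ctail j v (map_mx intr (centered_row m))).

Section unit_cube.
Variable v : 'rV[R]_N.
Hypothesis vc : unit_cube v.

Lemma umx_upper : upper_triangular (umx v *m b).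
Proof.
have [_ uL _] := unipotent_mxP (tuple_of_rV v) => i k ki; rewrite mxE big1// => x _.
have [xi|ix] := ltnP x i; first by rewrite uL ?mul0r.
by rewrite ub ?mulr0// (leq_trans ki).
Qed.

Lemma umx_diag i : (umx v *m b) i i = b i i.
Proof.
have [u1 uL _] := unipotent_mxP (tuple_of_rV v).
rewrite mxE (bigD1 i)//= u1 mul1r big1 ?addr0// => k ki.
have [ik|ik] := ltnP i k; first by rewrite ub ?mulr0.
by rewrite uL ?mul0r// ltn_neqAle ik andbT.
Qed.

Lemma umx_le1 i k : `|umx v i k| <= 1.
Proof.
rewrite /umx mxE; case: eqP => _; first by rewrite normr1.
case: insub => [e|]; last by rewrite normr0.
rewrite tnth_mktuple; have /andP[h1 h2] := vc (enum_rank e).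
by rewrite ger0_norm// ltW.
Qed.

Lemma umx_abs i k : `|(umx v *m b) i k| <= abs_sum.
Proof.
rewrite mxE; apply: (le_trans (ler_norm_sum _ _ _)); apply: ler_sum => x _.
rewrite normrM; apply: (@le_trans _ _ `|b x k|); first by rewrite ler_piMl// umx_le1.
by rewrite (bigD1 k)//= lerDl sumr_ge0.
Qed.

Lemma umx_forward (m : 'rV[R]_d) (k : 'I_d) :
  (forall i : 'I_d, (i <= k)%N -> `|lattice_vec b m v 0 i| <= T) -> `|m 0 k| <= M%:R.
Proof.
move=> mT; apply: le_trans MT.
apply: (@forward_bound _ _ (umx v *m b) be abs_sum T m k) => //.
- exact: umx_upper.
- by move=> i; rewrite umx_diag.
- exact: umx_abs.
- by move=> i /mT; rewrite /lattice_vec mulmxA.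
Qed.

(** The sum over n_j for fixed n_0, ..., n_(j-1) is a [zsum], up to terms that
    vanish by [umx_forward]; the integral over n_j produces S_j. *)
Lemma partial_countS (j : 'I_d) :
  partial_count j.+1 v - partial_count j v =
  tail_density j.+1 * \sum_(m : 'rV[W]_d | tailed j m) column_err j b T (map_mx intr (centered_row m)) v.
Proof.
rewrite /partial_count tail_densityS -mulrA -mulrBr sum_tailedS; congr (_ * _).
rewrite mulr_sumr -sumrB; apply: eq_bigr => m /tailedP tm.
set mr := map_mx intr (centered_row m); set bj := b j j; have bj0 : 0 < bj by exact: diag_gt0.
have mj : mr 0 j = 0 by rewrite mxE tm.
have yE (z : R) : lattice_vec b (mr + z *: delta_mx 0 j) v = lattice_vec b mr v + z *: row j (umx v *m b).
  by rewrite /lattice_vec !mulmxDl -!scalemxAl rowE mulmxA.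
have y1 z (i : 'I_d) : (i < j)%N -> lattice_vec b (mr + z *: delta_mx 0 j) v 0 i = lattice_vec b mr v 0 i.
  move=> ij; rewrite yE mxE; have -> : (z *: row j (umx v *m b)) 0 i = 0.
    by rewrite mxE [row _ _ _ _]mxE umx_upper ?mulr0.
  by rewrite addr0.
have y2 z : lattice_vec b (mr + z *: delta_mx 0 j) v 0 j = lattice_vec b mr v 0 j + z * bj.
  by rewrite yE mxE; congr (_ + _); rewrite mxE [row _ _ _ _]mxE umx_diag.
pose x := lattice_vec b mr v 0 j / bj.
have cE (z : int) : ctail j.+1 v (mr + z%:~R *: delta_mx 0 j) =
    height j b T mr v - (bj * (z%:~R + x)) ^+ 2.
  rewrite /ctail big_ltS y2 /height opprD addrA; congr (_ - _ - _).
    by apply: eq_bigr => i ij; rewrite y1.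
  by rewrite /x; congr (_ ^+ 2); field; rewrite gt_eqF.
rewrite /column_err /zerr -/bj -/x.
have -> : (d - j = (d - j.+1).+1)%N by rewrite subnSK.
congr (_ - _).
rewrite (@zsum_window _ M); last first.
  move=> z; rewrite -cE => hz.
  have {}hz : 0 < ctail j.+1 v (mr + z%:~R *: delta_mx 0 j).
    by rewrite ltNge; apply: contra hz => /phi_le0 ->.
  rewrite -(@ler_nat R) natr_absz intr_norm.
  have -> : z%:~R = (mr + z%:~R *: delta_mx 0 j) 0 j :> R.
    by rewrite mxE mj add0r !mxE !eqxx mulr1.
  apply: umx_forward => i ij.
  rewrite -(ler_pXn2r (n := 2))// ?nnegrE// real_normK ?num_real//.
  move: hz; rewrite /ctail subr_gt0 => /ltW; apply: le_trans.
  by rewrite (bigD1 i)//= lerDl sumr_ge0// => k _; exact: sqr_ge0.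
apply: eq_bigr => c _; rewrite -cE; congr (phi _ (ctail _ _ _)).
apply/rowP => i; rewrite !mxE eqxx /=; case: eqP => [->|_].
  by have := mj; rewrite !mxE => ->; rewrite add0r mulr1.
by rewrite mulr0 addr0.
Qed.

End unit_cube.
End peeling.

(** * The remainder of a lattice *)
(** A reflection H carries g^-1 e_0 to a positive multiple of e_0, hence
    g H^T fixes the line of e_0; the minor without the first row and column is treated
    by induction. *)
Lemma qr_upper (R : realType) n (g : 'M[R]_n) : g \in unitmx ->
  exists k : 'M[R]_n, [/\ k *m k^T = 1%:M, upper_triangular (g *m k) &
    forall i, 0 < (g *m k) i i].
Proof.
elim: n g => [|n IH] g gu.
  by exists 1%:M; split; [by apply/matrixP => -[]|by case|by case].
pose e : 'cV[R]_n.+1 := delta_mx ord0 0.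
pose eta := invmx g *m e.
have geta : g *m eta = e by rewrite /eta mulKVmx.
have eta0 : eta != 0.
  apply/eqP => h; have := geta; rewrite h mulmx0 => /colP/(_ ord0).
  by rewrite !mxE eqxx => /eqP; rewrite eq_sym oner_eq0.
have [H HH Heta] := householder eta0; set la := Num.sqrt _ in Heta.
have HtH : H^T *m H = 1%:M by apply: mulmx1C.
have la0 : 0 < la.
  rewrite sqrtr_gt0 lt_def sqn_ge0 andbT sqn_eq0; apply: contra eta0 => /eqP h.
  by rewrite -[eta]trmxK h trmx0.
pose a := g *m H^T.
have acol (i : 'I_n.+1) : a i ord0 = (i == ord0)%:R / la.
  have : a *m e = la^-1 *: e.
    apply: (@scalerI _ _ la); first by rewrite gt_eqF.
    rewrite scalerA divff ?gt_eqF// scale1r scalemxAr -Heta mulmxA -[a *m H]mulmxA HtH.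
    by rewrite mulmx1.
  rewrite /e -colE => /colP/(_ i); rewrite !mxE andbT => ->.
  by rewrite mulrC.
have a00 : a ord0 ord0 = la^-1 by rewrite acol eqxx div1r.
have aS i : a (lift ord0 i) ord0 = 0 by rewrite acol mul0r.
have au : a \in unitmx.
  have Hu : H^T \in unitmx by have [] := mulmx1_unit HtH.
  by rewrite unitmx_mul gu.
have mu : minor00 a \in unitmx.
  move: au; rewrite !unitmxE !unitfE (expand_det_col _ ord0) big_ord_recl big1 ?addr0; last first.
    by move=> i _; rewrite aS mul0r.
  rewrite mulf_eq0 negb_or => /andP[_]; rewrite /cofactor expr0 mul1r.
  by congr (\det _ != 0); apply/matrixP => i j; rewrite !mxE.
have [k' [k1 k2 k3]] := IH _ mu.
pose k : 'M[R]_n.+1 := \matrix_(i, j)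
  if unlift ord0 i is Some i' then if unlift ord0 j is Some j' then k' i' j' else 0
  else (j == ord0)%:R.
have k00 : k ord0 ord0 = 1 by rewrite mxE unlift_none eqxx.
have k0S j : k ord0 (lift ord0 j) = 0 by rewrite mxE unlift_none.
have kS0 i : k (lift ord0 i) ord0 = 0 by rewrite mxE liftK unlift_none.
have kSS i j : k (lift ord0 i) (lift ord0 j) = k' i j by rewrite mxE !liftK.
have ak0 i : (a *m k) i ord0 = a i ord0.
  by rewrite mxE big_ord_recl k00 mulr1 big1 ?addr0// => x _; rewrite kS0 mulr0.
have akS i j : (a *m k) (lift ord0 i) (lift ord0 j) = (minor00 a *m k') i j.
  rewrite [LHS]mxE [RHS]mxE big_ord_recl k0S mulr0 add0r; apply: eq_bigr => x _.
  by rewrite kSS [minor00 _ _ _]mxE.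
exists (H^T *m k); split.
- have kk : k *m k^T = 1%:M.
    apply/matrixP => i j; rewrite mxE big_ord_recl.
    case: (unliftP ord0 i) => [i' ->|->]; case: (unliftP ord0 j) => [j' ->|->].
    + rewrite kS0 mul0r add0r; have := congr1 (fun m : 'M[R]_n => m i' j') k1.
      rewrite !mxE (inj_eq lift_inj) => <-; apply: eq_bigr => x _.
      by rewrite !mxE !liftK.
    + rewrite kS0 mul0r add0r big1 ?mxE//= => x _; by rewrite [k^T _ _]mxE k0S mulr0.
    + rewrite [k^T _ _]mxE kS0 mulr0 add0r big1 ?mxE//= => x _; by rewrite k0S mul0r.
    + rewrite [k^T _ _]mxE k00 mulr1 big1 ?addr0 ?mxE// => x _; by rewrite k0S mul0r.
  by rewrite trmx_mul trmxK mulmxA -[H^T *m k *m _]mulmxA kk mulmx1 HtH.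
- rewrite mulmxA -/a => i j; case: (unliftP ord0 i) => [i' ->|->//].
  case: (unliftP ord0 j) => [j' ->|->]; last by rewrite ak0 aS.
  by rewrite !lift0 ltnS akS => /k2.
- move=> i; rewrite mulmxA -/a; case: (unliftP ord0 i) => [i' ->|->].
    by rewrite akS.
  by rewrite ak0 a00 invr_gt0.
Qed.

Section covolume.
Context (R : realType) (d : nat).
Notation lam n := (lebesgue_tuple R n).
Notation rv := (@rV_of_tuple R _).

(** [integral_domain_change] for the constant function 1. *)
Lemma fundamental_domain_vol (h : 'M[R]_d) F1 F2 : h \in unitmx ->
  fundamental_domain (Zlattice h) F1 -> fundamental_domain (Zlattice h) F2 -> vol F1 = vol F2.
Proof.
move=> hu [m1 f1] [m2 f2].
have inj : injective (fun z : 'rV[int]_d => map_mx intr z *m h : 'rV[R]_d).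
  move=> z z' /(can_inj (mulmxK hu)) /rowP e; apply/rowP => i.
  by have := e i; rewrite !mxE => /intr_inj.
have := @integral_domain_change R d (fun z => map_mx intr z *m h) setT F1 F2 (fun=> 1) m1 m2.
have e F : (\int[lam d]_t (\1_F (rv t) * 1)%:E = \int[lam d]_t (\1_F (rv t))%:E)%E.
  by apply: eq_integral => t _; rewrite mulr1.
rewrite !e !integral_row_indic//; apply => //.
- move=> v _; have [x [[Fx [z _ zE]] xu]] := f2 v.
  exists z; split; first by split; rewrite // zE addrCA subrr addr0.
  move=> z' [_ Fz']; apply: inj => /=; rewrite zE.
  rewrite (xu (v + map_mx intr z' *m h)); first by rewrite addrAC subrr add0r.
  by split => //; exists z' => //; rewrite addrAC subrr add0r.
- move=> v _; have [x [[Fx [z _ zE]] xu]] := f1 v.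
  have oppE (y : 'rV[int]_d) : map_mx intr (- y) *m h = - (map_mx intr y *m h) :> 'rV[R]_d.
    by rewrite map_mxN mulNmx.
  exists (- z); split.
    by split; rewrite // oppE opprK zE addrCA subrr addr0.
  move=> z' [_ Fz']; apply: inj => /=; rewrite oppE zE.
  rewrite (xu (v - map_mx intr z' *m h)); first by rewrite addrAC subrr add0r opprK.
  split => //; exists (- z') => //; by rewrite oppE addrAC subrr add0r.
Qed.

Lemma cube_fundamental (h : 'M[R]_d) : h \in unitmx ->
  fundamental_domain (Zlattice h) [set x | unit_cube (x *m invmx h)].
Proof.
move=> hu; split.
  apply: (borel_preimage (F := fun v => v *m invmx h)); last exact: borel_unit_cube.
  by apply: measurable_row_mulmx; exact: measurable_row_rv.
move=> v; have [|z [[_ zc] zu]] := @cube_unique R d xpredT (v *m invmx h); first by [].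
exists (v - map_mx intr z *m h); split.
  split; first by rewrite /= mulmxBl mulmxK.
  by exists (- z) => //; rewrite map_mxN mulNmx addrAC subrr add0r.
move=> x [/= xc [y _ yE]].
have xE : x = v + map_mx intr y *m h by rewrite yE addrCA subrr addr0.
rewrite xE; congr (_ + _); rewrite -mulNmx -map_mxN; congr (map_mx _ _ *m _).
apply/eqP; rewrite eqr_oppLR; apply/eqP/zu; split => //.
by move: xc; rewrite xE mulmxDl mulmxK// map_mxN opprK.
Qed.

Lemma euclidean_norm_lt (T : R) (v : 'rV[R]_d) : 0 < T ->
  (euclidean_norm v < T) = (sqn v < T ^+ 2).
Proof.
move=> T0; rewrite /euclidean_norm -/(sqn v) -{2}(sqr_sqrtr (sqn_ge0 v)).
by rewrite ltr_pXn2r ?nnegrE ?sqrtr_ge0// ltW.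
Qed.

Lemma borel_eball (T : R) : 0 < T -> borel (eball T : set 'rV[R]_d).
Proof.
move=> T0; rewrite /borel (_ : _ @^-1` _ = (fun t : Rtuple R d => sqn (rv t)) @^-1` `]-oo, T ^+ 2[).
  rewrite -[X in measurable X]setTI; apply: measurable_sqn => //.
  exact: measurable_row_rv.
by apply/seteqP; split=> t /=; rewrite in_itv/= /eball/= euclidean_norm_lt.
Qed.

Lemma phi0E (v : R) : phi 0 v = (0 < v)%R%:R.
Proof. by rewrite /phi expr0 mulr1. Qed.

Lemma phi_sqr k (T : R) : 0 < T -> phi k (T ^+ 2) = T ^+ k.
Proof. by move=> T0; rewrite /phi exprn_gt0// mul1r sqrtr_sqr gtr0_norm. Qed.

(** x |-> x h multiplies the volumes by the same factor for the ball and
    for a fundamental domain, and it carries the unit cube to the latter. The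
    ratio is the volume of the ellipsoid of the x with |x h| < T. *)
Lemma density (h w : 'M[R]_d) (T : R) : h \in unitmx -> 0 < T ->
  upper_triangular w -> (forall i, 0 < w i i) -> (forall x, sqn (x *m h) = sqn (x *m w)) ->
  fine (vol (eball T : set 'rV[R]_d)) / covolume (Zlattice h) = phiC R 0 d / \prod_i w i i * T ^+ d.
Proof.
move=> hu T0 uw w0 hw; have [ka ka0 kaP] := vol_mulmx hu.
have mB : borel (eball T : set 'rV[R]_d) := borel_eball T0.
set F0 := [set x | unit_cube (x *m invmx h)].
have fF0 : fundamental_domain (Zlattice h) F0 by exact: cube_fundamental.
have covE : vol (xget set0 (fundamental_domain (Zlattice h))) = vol F0.
  by apply: (fundamental_domain_vol hu) => //; case: xgetP => [F _ //|/(_ F0)].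
have v1 : (1 = ka%:E * vol F0)%E.
  rewrite -kaP; last by have [] := fF0.
  rewrite -(@vol_unit_cube R d); congr vol; apply/seteqP; split=> v; by rewrite /F0 /= (mulmxK hu).
have v2 : (ka%:E * vol (eball T : set 'rV[R]_d) = (phiC R 0 d / \prod_i w i i * T ^+ d)%:E)%E.
  rewrite -kaP// -integral_row_indic; last first.
    apply: (borel_preimage (F := fun v => v *m h)) => //.
    by apply: measurable_row_mulmx; exact: measurable_row_rv.
  have := integral_phi_triangular 0 (T ^+ 2) 0 uw (fun i => lt0r_neq0 (w0 i)).
  rewrite add0n phi_sqr// => e.
  transitivity (\int[lam d]_t (phi 0 (T ^+ 2 - sqn (rv t *m w + 0)))%:E)%E.
    apply: eq_integral => t _; rewrite addr0 phi0E subr_gt0 -hw indicE; congr ((nat_of_bool _)%:R%:E).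
    by apply/idP/idP; rewrite inE /= /eball/= euclidean_norm_lt.
  rewrite e; congr ((_ / _ * _)%:E); apply: eq_bigr => i _; by rewrite gtr0_norm.
rewrite /covolume covE.
have f1 : fine (vol F0) = ka^-1.
  case: (vol F0) v1 => [x| |] //=; last 2 first.
  - by rewrite gt0_muley ?lte_fin.
  - by rewrite gt0_muleNy ?lte_fin.
  by rewrite -EFinM => -[e]; apply: (mulfI (lt0r_neq0 ka0)); rewrite -e divff// gt_eqF.
rewrite f1 invrK; case: (vol (eball T : set 'rV[R]_d)) v2 => [x| |] //=; last 2 first.
- by rewrite gt0_muley ?lte_fin.
- by rewrite gt0_muleNy ?lte_fin.
by rewrite -EFinM => -[<-]; rewrite mulrC.
Qed.

End covolume.

Section counting.
Context (R : realType) (d l : nat) (g b : 'M[R]_d) (k : 'M[R]_d) (T be : R) (M : nat).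
Notation N := (nfree d l).
Notation W := ('I_(2 * M)%N.+1).
Hypotheses (gu : g \in unitmx) (kk : k *m k^T = 1%:M) (gk : g *m k = b).
Hypotheses (ub : upper_triangular b) (be0 : 0 < be) (bbe : forall i, be <= b i i) (T0 : 0 < T).
Hypothesis MT : T / be * (1 + abs_sum b / be) ^+ d <= M%:R.
Variable v : 'rV[R]_N.
Hypothesis vc : unit_cube v.

Lemma umx_unit : umx v \in unitmx.
Proof.
have [u1 uL _] := unipotent_mxP (tuple_of_rV v).
by apply: upper_unit => [i j ij|i]; rewrite /umx; [exact: uL|rewrite u1].
Qed.

Lemma sqn_umx x : sqn (x *m (umx v *m g)) = sqn (x *m (umx v *m b)).
Proof. by rewrite -gk !mulmxA [RHS]sqn_orthogonal. Qed.

Lemma lattice_count :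
  #|` fset_set (Zlattice (umx v *m g) `&` eball T)|%:R = partial_count b T M d v.
Proof.
pose f (m : 'rV[W]_d) : 'rV[R]_d := map_mx intr (centered_row m) *m (umx v *m g).
have hu : umx v *m g \in unitmx by rewrite unitmx_mul umx_unit.
have fi : injective f.
  move=> m m' /(can_inj (mulmxK hu)) /rowP e; apply: centered_row_inj; apply/rowP => i.
  by have := e i; rewrite mxE [RHS]mxE => /intr_inj.
pose s := [seq f m | m <- enum [pred m | sqn (f m) < T ^+ 2]].
have sE : Zlattice (umx v *m g) `&` eball T = [set` s].
  apply/seteqP; split=> x /=.
    move=> [[n _ nE]]; rewrite /eball/= euclidean_norm_lt// => xT.
    have [m mE] : exists m : 'rV[W]_d, centered_row m = n.
      apply: centered_row_surj => i; rewrite -(@ler_nat R) natr_absz intr_norm.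
      rewrite (_ : (n 0 i)%:~R = map_mx intr n 0 i :> R); last by rewrite mxE.
      apply: (umx_forward ub be0 bbe (ltW T0) MT vc (m := map_mx intr n)) => i' _.
      rewrite -(ler_pXn2r (n := 2))// ?nnegrE ?(ltW T0)// real_normK ?num_real//.
      move: xT; rewrite -nE sqn_umx => /ltW; apply: le_trans.
      by rewrite /lattice_vec mulmxA /sqn (bigD1 i')//= lerDl sumr_ge0// => y _; exact: sqr_ge0.
    have fx : f m = x by rewrite /f mE nE.
    by apply/mapP; exists m; rewrite ?mem_enum ?inE fx.
  move=> /mapP[m]; rewrite mem_enum inE => mT ->; split.
    by exists (centered_row m).
  by rewrite /eball/= euclidean_norm_lt.
have su : uniq s by rewrite map_inj_uniq// enum_uniq.
have -> : fset_set (Zlattice (umx v *m g) `&` eball T) = seq_fset tt s.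
  apply/fsetP => x; rewrite in_fset_set sE; last exact: finite_seq.
  by rewrite seq_fsetE; apply/idP/idP; rewrite inE.
rewrite size_seq_fset undup_id// size_map -cardE.
rewrite /partial_count /tail_density subnn /phiC big_ord0 big_pred0; last first.
  by move=> i; rewrite leqNgt ltn_ord.
rewrite divr1 mul1r -sum1_card natr_sum [in LHS]big_mkcond [in RHS]big_mkcond.
apply: eq_bigr => m _; rewrite [RHS]ifT; last first.
  by apply/tailedP => i; rewrite leqNgt ltn_ord.
rewrite phi0E /ctail subr_gt0 inE.
have -> : \sum_(i < d | (i < d)%N) lattice_vec b (map_mx intr (centered_row m)) v 0 i ^+ 2 = sqn (f m).
  by rewrite sqn_umx /sqn /lattice_vec mulmxA; apply: eq_bigl => i; rewrite ltn_ord.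
by case: ifP.
Qed.

Lemma main_term :
  fine (vol (eball T : set 'rV[R]_d)) / covolume (Zlattice (umx v *m g)) = tail_density b 0 * T ^+ d.
Proof.
have hu : umx v *m g \in unitmx by rewrite unitmx_mul umx_unit.
have b0 i : 0 < b i i by exact: lt_le_trans (bbe i).
rewrite (density (w := umx v *m b) hu T0); first last.
- exact: sqn_umx.
- by move=> i; rewrite umx_diag.
- exact: umx_upper.
rewrite /tail_density subn0; congr (_ / _ * _).
by apply: eq_big => // i _; rewrite umx_diag.
Qed.

Lemma remainderE :
  remainder (eball T) (Zlattice (umx v *m g)) = partial_count b T M d v - tail_density b 0 * T ^+ d.
Proof. by rewrite /remainder lattice_count main_term. Qed.

End counting.

(** * Summation over the first coordinates *)
Section truncation.
Variables (d n M : nat).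
Hypothesis nd : (n <= d)%N.
Notation W := ('I_(2 * M)%N.+1).
Notation wide := (widen_ord nd).

Definition pad (m : 'rV[W]_n) : 'rV[W]_d :=
  \row_i if insub (i : nat) is Some x then m 0 (x : 'I_n) else center M.

Lemma pad_wide m (i : 'I_n) : pad m 0 (wide i) = m 0 i.
Proof. by rewrite mxE /= insubT//= => h; congr (m 0 _); exact: val_inj. Qed.

Lemma sum_tailed_pad (V : nmodType) (F : 'rV[W]_d -> V) :
  \sum_(m | tailed n m) F m = \sum_m F (pad m).
Proof.
rewrite (reindex_onto pad (fun m => \row_i m 0 (wide i)))/=.
  apply: eq_bigl => m; apply/andP; split.
    by apply/tailedP => i ni; rewrite !mxE insubF ?centered_center// ltnNge ni.
  by apply/eqP/rowP => i; rewrite mxE pad_wide.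
move=> m /tailedP tm; apply/rowP => i; rewrite mxE; case: insubP => [x _ xE|].
  by rewrite mxE; congr (m 0 _); exact: val_inj.
by rewrite -leqNgt => /tm; rewrite mxE => h; apply: centered_inj; rewrite centered_center.
Qed.

End truncation.

Section first_count.
Context (R : realType).

Lemma phiC_add k m n : phiC R k (m + n) = phiC R k m * phiC R (k + m) n.
Proof.
elim: n => [|n IH]; first by rewrite addn0 {3}/phiC big_ord0 mulr1.
by rewrite addnS !phiCS IH addnA mulrA.
Qed.

(** In the unipotent matrix u the columns before l = n + 1 are those of the
    identity, so that S_l is a lattice sum for the upper left block of b,
    of order l. The inequality n < d - l required by [lattice_sum] is 2 l <= d. *)
Lemma first_count (d n : nat) (b : 'M[R]_d) (be : R) : (n.+1 <= d./2)%N ->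
  upper_triangular b -> 0 < be -> (forall i, be <= b i i) ->
  exists2 C : R, 0 <= C & forall (T : R) (M : nat) (v : 'rV[R]_(nfree d n.+1)),
    0 < T -> T / be * (1 + abs_sum b / be) ^+ d < M%:R ->
    unit_cube v ->
    (partial_count b T M n.+1 v - tail_density b 0 * T ^+ d) ^+ 2 <= C * T ^+ (d - 1).
Proof.
move=> nd2 ub be0 bbe.
have nd : (n.+1 <= d)%N by clear -nd2; lia.
pose wide := widen_ord nd.
have b0 i : 0 < b i i by exact: lt_le_trans (bbe i).
have nk : (n < d - n.+1)%N by clear -nd2; lia.
have dk : (d - n.+1 + n.+1 = d)%N by rewrite subnK.
have [C C0 HC] := lattice_sum R nk.
pose w : 'M[R]_n.+1 := \matrix_(i, k) b (wide i) (wide k).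
have uw : upper_triangular w by move=> i k ki; rewrite mxE ub.
have w0 i : 0 < w i i by rewrite mxE.
pose B := abs_sum b.
have B0 : 0 <= B by apply: sumr_ge0 => i _; apply: sumr_ge0 => k _.
have bB i k : `|b i k| <= B.
  rewrite /B /abs_sum (bigD1 i)//= (bigD1 k)//= -addrA lerDl addr_ge0//.
    by apply: sumr_ge0.
  by apply: sumr_ge0 => x _; apply: sumr_ge0.
have wB i k : `|w i k| <= B by rewrite mxE.
pose D : R := n.+1%:R * B + 1.
have D0 : 0 < D by rewrite ltr_wpDl// mulr_ge0.
pose g0 := tail_density b n.+1 * (C / (\prod_i w i i)).
exists (g0 ^+ 2 * D ^+ d.+1); first by rewrite mulr_ge0 ?sqr_ge0// exprn_ge0// ltW.
move=> T M v T0 MT vc.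
have wu := upper_unit uw w0.
have yE (m : 'rV[R]_d) (i : 'I_n.+1) :
    (forall k : 'I_d, (n.+1 <= k)%N -> m 0 k = 0) ->
    lattice_vec b m v 0 (wide i) = \sum_(k < n.+1) m 0 (wide k) * w k i.
  move=> mt; rewrite /lattice_vec -mulmxA mxE (bigID (fun k : 'I_d => (k < n.+1)%N))/= [X in _ + X]big1 ?addr0.
    rewrite (big_ord_narrow nd); apply: eq_bigr => k _; congr (_ * _).
    have [u1 uL uF] := unipotent_mxP (tuple_of_rV v).
    rewrite [LHS]mxE [RHS]mxE (bigD1 (wide k))//= [umx v _ _]u1 mul1r big1 ?addr0// => x xk.
    have [xi|ix] := leqP x i; last by rewrite ub ?mulr0.
    have [kx|xk'] := ltnP (wide k) x.
      by rewrite [umx v _ _]uF ?mul0r// (leq_ltn_trans xi).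
    by rewrite [umx v _ _]uL ?mul0r// ltn_neqAle xk' andbT.
  by move=> k; rewrite -leqNgt => /mt ->; rewrite mul0r.
have SE : partial_count b T M n.+1 v = tail_density b n.+1 *
    \sum_(m : 'rV['I_(2 * M)%N.+1]_n.+1) phi (d - n.+1) (T ^+ 2 - sqn (ivec R M m *m w + 0)).
  rewrite /partial_count (sum_tailed_pad nd); congr (_ * _); apply: eq_bigr => m _.
  congr (phi _ (_ - _)); rewrite addr0 (big_ord_narrow nd); apply: eq_bigr => i _.
  rewrite yE; last first.
    by move=> k nk'; rewrite !mxE insubF ?centered_center// ltnNge nk'.
  rewrite mxE; congr (_ ^+ 2); apply: eq_bigr => k _; congr (_ * _).
  by rewrite ivec_centered !mxE -(pad_wide nd) mxE.
have mainE : tail_density b 0 * T ^+ d =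
    tail_density b n.+1 * (phiC R (d - n.+1) n.+1 / (\prod_i w i i) * phi (d - n.+1 + n.+1) (T ^+ 2)).
  rewrite phi_sqr// dk /tail_density subn0 mulrA; congr (_ * _).
  have -> : phiC R 0 d = phiC R 0 (d - n.+1) * phiC R (d - n.+1) n.+1.
    by rewrite -[X in phiC R 0 X = _]dk phiC_add.
  have -> : \prod_(i < d | (0 <= i)%N) b i i =
      (\prod_i w i i) * \prod_(i < d | (n.+1 <= i)%N) b i i.
    rewrite (bigID (fun i : 'I_d => (i < n.+1)%N))/= (big_ord_narrow nd); congr (_ * _).
      by apply: eq_bigr => i _; rewrite mxE.
    by apply: eq_bigl => i; rewrite -leqNgt.
  by rewrite invfM; ring.
have g0' : 0 <= tail_density b n.+1 by apply: divr_ge0; [exact/ltW/phiC_gt0|apply: prodr_ge0 => i _; exact: ltW].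
have := HC M w 0 (T ^+ 2) D^-1 uw w0.
rewrite invr_gt0 => /(_ D0) H.
rewrite SE mainE -mulrBr exprMn.
set X := \sum_m _ - _.
have XB : `|X| <= C / (\prod_i w i i) * Num.sqrt (D ^+ d.+1 * T ^+ (d - 1)).
  have e1 : (d - n.+1 + n = d - 1)%N by clear -nd; lia.
  have e2 : (d - 1).+2 = d.+1 by clear -nd; lia.
  have H1 (xi : 'cV[R]_n.+1) i : D^-1 * `|xi i 0| <= Num.sqrt (sqn (invmx w *m xi)^T).
    set eta := invmx w *m xi.
    have -> : xi = w *m eta by rewrite /eta mulKVmx.
    rewrite mulrC ler_pdivrMr// mxE.
    apply: (le_trans (ler_norm_sum _ _ _)).
    apply: (@le_trans _ _ (\sum_(k < n.+1) B * Num.sqrt (sqn eta^T))).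
      apply: ler_sum => k _; rewrite normrM; apply: ler_pM => //.
      by have := sqn_coord k (lexx (sqn eta^T)); rewrite mxE.
    rewrite sumr_const card_ord -mulr_natl mulrA mulrC ler_wpM2l ?sqrtr_ge0//.
    by rewrite /D lerDl.
  have H2 (m : 'rV[R]_n.+1) i : M%:R <= `|m 0 i| -> T ^+ 2 <= sqn (m *m w + 0).
  move=> Mm; rewrite addr0 leNgt; apply/negP => mT.
  suff : `|m 0 i| < M%:R by rewrite ltNge Mm.
  apply: le_lt_trans MT.
  apply: (@le_trans _ _ (T / be * (1 + B / be) ^+ n.+1)); last first.
    rewrite ler_wpM2l ?divr_ge0 ?(ltW T0) ?(ltW be0)// ler_weXn2l//.
    by rewrite lerDl divr_ge0// ltW.
  apply: (forward_bound uw be0 _ wB (ltW T0)).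
    by move=> x; rewrite mxE.
  move=> x _; apply: le_trans (sqn_coord _ (lexx _)) _.
  by rewrite -[leRHS](gtr0_norm T0) -sqrtr_sqr ler_wsqrtr// ltW.
  have := H H1 H2; rewrite invrK sqrtr_sqr (gtr0_norm T0) e1 e2.
  by [].
have P0 : 0 < \prod_i w i i by apply: prodr_gt0.
have : X ^+ 2 <= (C / (\prod_i w i i) * Num.sqrt (D ^+ d.+1 * T ^+ (d - 1))) ^+ 2.
  by rewrite -[leLHS]real_normK ?num_real// lerXn2r ?nnegrE// (le_trans _ XB).
rewrite exprMn sqr_sqrtr; last by rewrite mulr_ge0// exprn_ge0// ltW.
move=> {}XB; apply: le_trans (ler_wpM2l (sqr_ge0 _) XB) _.
by rewrite /g0 [(tail_density _ _ * _) ^+ 2]exprMn !mulrA.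
Qed.

End first_count.

(** * Mean square of the contribution of one column *)
Section elementary_bounds.
Context (R : realType).

Lemma harmonic_le (n : nat) : \sum_(i < n.+1) (i.+1%:R : R)^-1 <= 1 + ln n.+1%:R.
Proof.
elim: n => [|n IH]; first by rewrite big_ord1 invr1 ln1 addr0.
rewrite big_ord_recr/=; apply: (le_trans (lerD IH (lexx _))).
rewrite -addrA lerD2l.
have n1 : (0 : R) < n.+1%:R by rewrite ltr0n.
have n2 : (0 : R) < n.+2%:R by rewrite ltr0n.
have e : n.+1%:R = n.+2%:R * (1 + - n.+2%:R^-1) :> R.
  by rewrite mulrDr mulr1 mulrN divff ?gt_eqF// -[n.+2%:R]natr1 addrK.
have p : 0 < 1 + - n.+2%:R^-1 :> R by rewrite -(pmulr_rgt0 _ n2) -e.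
rewrite {1}e lnM ?posrE// -addrA gerDl.
have : ln (1 + - n.+2%:R^-1) <= - n.+2%:R^-1 :> R.
  by apply: le_ln1Dx; rewrite -subr_gt0 opprK addrC.
by move=> h; rewrite -lerBrDr sub0r.
Qed.

Lemma recip_sum_le (M : nat) : \sum_(a : 'I_(2 * M.+1)%N.+1) @recip R M.+1 a <= 2 * (1 + ln M.+1%:R).
Proof.
pose G (a : nat) : R := (`|a%:Z - M.+1%:Z|%N%:R)^-1.
have -> : \sum_a @recip R M.+1 a = \sum_(0 <= a < (2 * M.+1)%N.+1) G a.
  by rewrite big_mkord; apply: eq_bigr => a _.
rewrite (@big_cat_nat _ _ _ M.+1)//=; last by clear; lia.
have s1 : \sum_(0 <= a < M.+1) G a = \sum_(i < M.+1) (i.+1%:R : R)^-1.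
  rewrite big_nat_rev/= add0n big_mkord; apply: eq_bigr => i _; rewrite /G; congr (_%:R^-1).
  by have := ltn_ord i; clear; lia.
have s2 : \sum_(M.+1 <= a < (2 * M.+1)%N.+1) G a = \sum_(i < M.+1) (i.+1%:R : R)^-1.
  rewrite big_ltn; last by clear; lia.
  rewrite {1}/G subrr absz0 invr0 add0r -[M.+2]add0n big_addn.
  have -> : ((2 * M.+1).+1 - M.+2 = M.+1)%N by clear; lia.
  rewrite big_mkord; apply: eq_bigr => i _; rewrite /G; congr (_%:R^-1).
  by clear; lia.
by rewrite s1 s2 -mulr2n -[leLHS]mulr_natl ler_wpM2l// harmonic_le.
Qed.

Lemma sqr_sum_le (I : finType) (P : pred I) (x : I -> R) :
  (\sum_(i | P i) x i) ^+ 2 <= #|I|%:R * \sum_(i | P i) x i ^+ 2.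
Proof.
have h : (\sum_(i | P i) x i) ^+ 2 <= \sum_(i | P i) \sum_(k | P k) (x i ^+ 2 + x k ^+ 2) / 2.
  rewrite expr2 big_distrlr/=; apply: ler_sum => i _; apply: ler_sum => k _.
  have := sqr_ge0 (x i - x k); rewrite sqrrB; lra.
apply: (le_trans h).
set S := \sum_(i | P i) x i ^+ 2.
have S0 : 0 <= S by apply: sumr_ge0 => i _; exact: sqr_ge0.
have -> : \sum_(i | P i) \sum_(k | P k) (x i ^+ 2 + x k ^+ 2) / 2 = #|P|%:R * S.
  under eq_bigr do rewrite -mulr_suml big_split/= sumr_const.
  rewrite -mulr_suml big_split/= sumr_const sumrMnl -/S.
  rewrite (_ : S *+ _ = #|P|%:R * S); first by field.
  by rewrite mulr_natl.
by rewrite ler_wpM2r// ler_nat max_card.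
Qed.

End elementary_bounds.

Section columns.
Context (R : realType) (d : nat) (b : 'M[R]_d) (be : R).
Notation lam n := (lebesgue_tuple R n).
Notation rv := (@rV_of_tuple R _).
Hypotheses (ub : upper_triangular b) (be0 : 0 < be) (bbe : forall i, be <= b i i).

Definition slope : R := (1 + abs_sum b / be) ^+ d / be.
(** A window for the integer entries of the vectors that count, by
    [forward_bound]. *)
Definition radius (T : R) : nat := (Num.truncn (T * slope)).+1.

Lemma abs_sum_ge0 : 0 <= abs_sum b.
Proof. by apply: sumr_ge0 => i _; apply: sumr_ge0 => k _. Qed.

Lemma slope_ge0 : 0 <= slope.
Proof.
by rewrite divr_ge0 ?(ltW be0)// exprn_ge0// addr_ge0// divr_ge0 ?abs_sum_ge0// ltW.
Qed.

Lemma radius_gt T : T / be * (1 + abs_sum b / be) ^+ d < (radius T)%:R.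
Proof. by rewrite -mulrA [be^-1 * _]mulrC; exact: truncnS_gt. Qed.

Lemma radius_le T : 1 <= T -> (radius T)%:R <= (slope + 1) * T.
Proof.
move=> T1; have s0 := slope_ge0; have T0 : 0 <= T by apply: le_trans T1.
rewrite /radius -natr1 mulrDl mul1r; apply: lerD => //.
by rewrite mulrC truncn_le// mulr_ge0.
Qed.

Lemma ln2_gt0 : 0 < ln (2 : R).
Proof. by rewrite ln_gt0// ltr1n. Qed.

(** [column_err_square_sum] with K^2 of order T^(d-j-1), a number of vectors q
    of order T^j and harmonic sums of order log T. *)
Lemma column_bound (l : nat) (j : 'I_d) : (l <= j)%N ->
  exists2 C : R, 0 <= C & forall T, 2 <= T ->
  (\int[lam (nfree d l)]_t (\1_(@unit_cube R (nfree d l)) (rv t) *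
     (tail_density b j.+1 * \sum_(m : 'rV['I_(2 * radius T)%N.+1]_d | tailed j m)
        column_err j b T (map_mx intr (centered_row m)) (rv t)) ^+ 2)%:E <=
   (C * T ^+ (d - 1) * ln T ^+ 2)%:E)%E.
Proof.
move=> lj; have b0 i : 0 < b i i by exact: lt_le_trans (bbe i).
have s0 := slope_ge0; have l2 := ln2_gt0.
have [C0 C00 HC] := zerr_avg R (d - j.+1).
set kk := (d - j.+1)%N in HC *.
pose A2 := 2 * (slope + 1) + 1.
pose A3 := 2 * ((1 + ln (slope + 1)) / ln 2 + 1).
have ls : 0 <= ln (slope + 1) by rewrite ln_ge0// lerDr.
have A30 : 0 <= A3 by rewrite mulr_ge0// addr_ge0// divr_ge0 ?addr_ge0// ltW.
have A20 : 0 <= A2 by rewrite addr_ge0// mulr_ge0// addr_ge0.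
pose G := tail_density b j.+1 ^+ 2; have G0 : 0 <= G by exact: sqr_ge0.
exists (G * (C0 ^+ 2 * b j j ^+ kk * (2 / ln 2 ^+ 2 + A2 ^+ j * A3 ^+ 2))).
  rewrite mulr_ge0// mulr_ge0//; first by rewrite mulr_ge0 ?sqr_ge0// exprn_ge0// ltW.
  by rewrite addr_ge0 ?divr_ge0 ?sqr_ge0// mulr_ge0 ?exprn_ge0.
move=> T T2; have T0 : 0 <= T by apply: le_trans T2.
have T1 : 1 <= T by apply: le_trans T2; rewrite ler1n.
have Tp : 0 < T by apply: lt_le_trans T1.
pose K := C0 * Num.sqrt ((b j j * T) ^+ kk).
have HK v x (n : nat) : v <= T ^+ 2 -> (0 < n)%N ->
    `|\sum_(i < n) zerr kk (b j j) v (x + i%:R / n%:R)| <= K.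
  move=> vT n0; apply: (le_trans (HC _ _ _ _ (b0 j) n0)); rewrite ler_wpM2l// ler_wsqrtr//.
  have bj := ltW (b0 j).
  have h : b j j * Num.sqrt v <= b j j * T.
    by rewrite ler_wpM2l// -[leRHS](ger0_norm T0) -sqrtr_sqr ler_wsqrtr.
  by apply: lerXn2r => //; rewrite nnegrE mulr_ge0// sqrtr_ge0.
have K2 : K ^+ 2 = C0 ^+ 2 * b j j ^+ kk * T ^+ kk.
  rewrite exprMn sqr_sqrtr ?exprMn ?mulrA//.
  by rewrite mulr_ge0// exprn_ge0// ltW.
have := @column_err_square_sum R d l j b T K (radius T) lj ub b0 HK.
set I := (X in (X <= _)%E) => hI.
have -> : (\int[lam (nfree d l)]_t (\1_(@unit_cube R (nfree d l)) (rv t) *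
     (tail_density b j.+1 * \sum_(m : 'rV['I_(2 * radius T)%N.+1]_d | tailed j m)
        column_err j b T (map_mx intr (centered_row m)) (rv t)) ^+ 2)%:E = G%:E * I)%E.
  rewrite /I -ge0_integralZl_EFin//.
  - by apply: eq_integral => t _; rewrite -EFinM exprMn mulrCA.
  - by move=> t _; rewrite lee_fin mulr_ge0// sqr_ge0.
  - apply/measurable_EFinP; apply: measurable_funM.
      by apply: measurable_row_indic; [exact: borel_unit_cube|exact: measurable_row_rv].
    apply: measurable_funX.
    rewrite (_ : (fun t => _) = (fun t => \sum_(m <- [seq m <- index_enum 'rV['I_(2 * radius T)%N.+1]_d | tailed j m])
        column_err j b T (map_mx intr (centered_row m)) (rv t))).
      by apply: measurable_sum => m; exact: measurable_column_err.
    by apply/funext => t; rewrite big_filter.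
apply: (@le_trans _ _ (G%:E * (K ^+ 2 * (2 + #|[pred m : 'rV['I_(2 * radius T)%N.+1]_d | tailed j m]|%:R *
   (\sum_a @recip R (radius T) a) ^+ 2))%:E)%E); first by rewrite lee_wpmul2l.
rewrite -EFinM lee_fin K2.
have lT : ln 2 <= ln T by rewrite ler_ln ?posrE//.
have lT0 : 0 < ln T by apply: lt_le_trans lT.
have n_le : #|[pred m : 'rV['I_(2 * radius T)%N.+1]_d | tailed j m]|%:R <= A2 ^+ j * T ^+ j :> R.
  rewrite card_tailed ?(ltnW (ltn_ord j))// -exprMn; apply: lerXn2r.
  - by rewrite nnegrE.
  - by rewrite nnegrE mulr_ge0.
  rewrite -natr1 natrM; have -> : A2 * T = 2 * ((slope + 1) * T) + T by rewrite /A2; ring.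
  apply: lerD => //.
  by rewrite ler_wpM2l// radius_le.
have H_le : \sum_a @recip R (radius T) a <= A3 * ln T.
  apply: (le_trans (recip_sum_le _ _)); rewrite /A3 -mulrA ler_wpM2l// mulrDl mul1r.
  have : ln (radius T)%:R <= ln (slope + 1) + ln T.
    by rewrite -lnM ?posrE ?ltr_wpDl// ler_ln ?posrE ?ltr0n ?mulr_gt0 ?ltr_wpDl// radius_le.
  have : 1 + ln (slope + 1) <= (1 + ln (slope + 1)) / ln 2 * ln T.
    by rewrite -mulrA ler_peMr ?addr_ge0// mulrC ler_pdivlMr// mul1r.
  rewrite /radius; lra.
have H0 : 0 <= \sum_a @recip R (radius T) a by apply: sumr_ge0 => a _; exact: recip_ge0.
have H2 : (\sum_a @recip R (radius T) a) ^+ 2 <= A3 ^+ 2 * ln T ^+ 2.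
  by rewrite -exprMn; apply: lerXn2r => //; rewrite nnegrE// mulr_ge0// ltW.
have two : 2 <= 2 / ln 2 ^+ 2 * (T ^+ j * ln T ^+ 2).
  rewrite -mulrA ler_peMr// mulrC ler_pdivlMr ?exprn_gt0// mul1r.
  apply: (@le_trans _ _ (1 * ln T ^+ 2)).
    by rewrite mul1r; apply: lerXn2r => //; rewrite nnegrE ltW.
  by rewrite ler_wpM2r ?sqr_ge0// exprn_ege1.
have Td : T ^+ (d - 1) = T ^+ kk * T ^+ j.
  by rewrite -exprD; congr (_ ^+ _); rewrite /kk; have := ltn_ord j; clear; lia.
have main : 2 + #|[pred m : 'rV['I_(2 * radius T)%N.+1]_d | tailed j m]|%:R *
   (\sum_a @recip R (radius T) a) ^+ 2 <= (2 / ln 2 ^+ 2 + A2 ^+ j * A3 ^+ 2) * (T ^+ j * ln T ^+ 2).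
  rewrite mulrDl; apply: lerD => //.
  have -> : A2 ^+ j * A3 ^+ 2 * (T ^+ j * ln T ^+ 2) = (A2 ^+ j * T ^+ j) * (A3 ^+ 2 * ln T ^+ 2) by ring.
  by apply: ler_pM => //; exact: sqr_ge0.
set X := 2 + _ in main *; set Y := 2 / _ + _ in main *.
have -> : G * (C0 ^+ 2 * b j j ^+ kk * Y) * T ^+ (d - 1) * ln T ^+ 2 =
    G * (C0 ^+ 2 * b j j ^+ kk * T ^+ kk * (Y * (T ^+ j * ln T ^+ 2))) by rewrite Td; ring.
have c0 : 0 <= C0 ^+ 2 * b j j ^+ kk * T ^+ kk.
  by rewrite -K2; exact: sqr_ge0.
exact: ler_wpM2l G0 _ _ (ler_wpM2l c0 main).
Qed.

End columns.

(** * Mean square of the remainder *)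
Section final.
Context (R : realType).
Notation lam n := (lebesgue_tuple R n).
Notation rv := (@rV_of_tuple R _).

Lemma integral_unit_box (d l : nat) (f : Rtuple R (nfree d l) -> R) :
  (\int[lam (nfree d l)]_(t in @unit_box R d l) (f t)%:E =
   \int[lam (nfree d l)]_t (\1_(@unit_cube R (nfree d l)) (rv t) * f t)%:E)%E.
Proof.
rewrite integral_mkcond; apply: eq_integral => t _.
rewrite /patch indicE; have [h|h] := boolP (t \in @unit_box R d l).
  rewrite mem_set ?mul1r// => k; rewrite mxE.
  by move: h; rewrite inE; apply.
rewrite memNset ?mul0r// => c; move/negP: h; apply; rewrite inE => k.
by have := c k; rewrite mxE.
Qed.

Lemma measurable_partial_count (d l : nat) (b : 'M[R]_d) (T : R) (M j : nat) :
  measurable_fun setT (fun t : Rtuple R (nfree d l) => partial_count b T M j (rv t)).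
Proof.
apply: measurable_funM => //.
rewrite (_ : (fun t => _) = (fun t : Rtuple R (nfree d l) =>
   \sum_(m <- [seq m <- index_enum 'rV['I_(2 * M)%N.+1]_d | tailed j m])
     phi (d - j) (ctail b T j (rv t) (map_mx intr (centered_row m))))).
  apply: measurable_sum => m.
  apply: (measurable_phi_comp _ (f := fun t : Rtuple R (nfree d l) =>
     ctail b T j (rv t) (map_mx intr (centered_row m)))).
  apply: measurable_funB => //.
  rewrite (_ : (fun t => _) = (fun t : Rtuple R (nfree d l) =>
     \sum_(i <- [seq i : 'I_d <- index_enum 'I_d | (i < j)%N]) lattice_vec b (map_mx intr (centered_row m)) (rv t) 0 i ^+ 2)).
    apply: measurable_sum => i; apply: measurable_funX; exact: measurable_lattice_vec.
  by apply/funext => t; rewrite big_filter.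
by apply/funext => t; rewrite big_filter.
Qed.

(** The remainder is a sum of at most d column terms and of S_l - S_0, whose
    squares are bounded by [column_bound] and [first_count]. *)
Lemma quotient_bound (d : nat) (g : 'M[R]_d) (n : nat) : g \in unitmx -> (n.+1 <= d./2)%N ->
  exists2 C : R, 0 <= C & forall T : R, 2 <= T ->
    (integral_quotient n.+1
       (fun u : 'M[R]_d => (`|remainder (eball T) (Zlattice (u *m g))| ^+ 2)%:E)
     <= (C * T ^+ (d - 1) * ln T ^+ 2)%:E)%E.
Proof.
move=> gu nd; set l := n.+1.
have ld : (l <= d)%N by clear -nd; rewrite /l; lia.
have [k [kk ub b0]] := qr_upper gu; set b := g *m k in ub b0.
pose be : R := (1 + \sum_i (b i i)^-1)^-1.
have bi i : 0 < (b i i)^-1 by rewrite invr_gt0.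
have s0 : 0 <= \sum_i (b i i)^-1 by apply: sumr_ge0 => i _; exact: ltW.
have be0 : 0 < be by rewrite invr_gt0 ltr_pwDl.
have bbe i : be <= b i i.
  rewrite -[leRHS]invrK lef_pV2 ?posrE ?ltr_pwDl//.
  rewrite (bigD1 i)//= addrCA lerDl addr_ge0// sumr_ge0// => x _; exact: ltW.
have [C0 C00 HC0] := first_count nd ub be0 bbe.
have ex (j : 'I_d) : exists C : R, 0 <= C /\ ((l <= j)%N -> forall T, 2 <= T ->
    (\int[lam (nfree d l)]_t (\1_(@unit_cube R (nfree d l)) (rv t) *
     (tail_density b j.+1 * \sum_(m : 'rV['I_(2 * radius b be T)%N.+1]_d | tailed j m)
        column_err j b T (map_mx intr (centered_row m)) (rv t)) ^+ 2)%:E <=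
     (C * T ^+ (d - 1) * ln T ^+ 2)%:E)%E).
  have [lj|jl] := leqP l j; last by exists 0.
  by have [C C1 C2] := column_bound ub be0 bbe lj; exists C.
have [C1 C1P] := choice ex.
have C10 j : 0 <= C1 j by have [] := C1P j.
have l20 : 0 < ln (2 : R) := ln2_gt0 R.
pose C2 := C0 / ln 2 ^+ 2.
have C20 : 0 <= C2 by rewrite divr_ge0// sqr_ge0.
exists (2 * (d%:R * \sum_j C1 j + C2)).
  by rewrite mulr_ge0// addr_ge0// mulr_ge0// sumr_ge0.
move=> T T2.
have T0 : 0 < T by apply: lt_le_trans T2.
have T1 : 1 <= T by apply: le_trans T2; rewrite ler1n.
have lT : ln 2 <= ln T by rewrite ler_ln ?posrE.
set M := radius b be T; have MT := radius_gt b be T; rewrite -/M in MT.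
pose X (j : 'I_d) (v : 'rV[R]_(nfree d l)) : R :=
  tail_density b j.+1 * \sum_(m : 'rV['I_(2 * M)%N.+1]_d | tailed j m) column_err j b T (map_mx intr (centered_row m)) v.
pose c := tail_density b 0 * T ^+ d.
have remE (t : Rtuple R (nfree d l)) : unit_cube (rv t) ->
    remainder (eball T) (Zlattice (unipotent_mx t *m g)) = partial_count b T M d (rv t) - c.
  move=> tc; rewrite -(remainderE gu kk erefl ub be0 bbe T0 (ltW MT) tc).
  by rewrite /umx rV_of_tupleK.
have telE (v : 'rV[R]_(nfree d l)) : unit_cube v ->
    partial_count b T M d v - c = \sum_(j < d | (l <= j)%N) X j v + (partial_count b T M l v - c).
  move=> vc; rewrite (eq_bigr (fun j : 'I_d => partial_count b T M j.+1 v - partial_count b T M j v)).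
    rewrite -(big_geq_mkord _ _ xpredT (fun j => partial_count b T M j.+1 v - partial_count b T M j v)).
    rewrite telescope_sumr//; ring.
  by move=> j _; rewrite (partial_countS ub be0 bbe (ltW T0) (ltW MT) vc).
have mc : measurable_fun setT (fun t : Rtuple R (nfree d l) => \1_(@unit_cube R (nfree d l)) (rv t) : R).
  by apply: measurable_row_indic; [exact: borel_unit_cube|exact: measurable_row_rv].
have mX j : measurable_fun setT (fun t : Rtuple R (nfree d l) => X j (rv t)).
  apply: measurable_funM => //.
  rewrite (_ : (fun t => _) = (fun t => \sum_(m <- [seq m <- index_enum 'rV['I_(2 * M)%N.+1]_d | tailed j m])
        column_err j b T (map_mx intr (centered_row m)) (rv t))).
    by apply: measurable_sum => m; exact: measurable_column_err.
  by apply/funext => t; rewrite big_filter.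
rewrite /integral_quotient integral_unit_box.
have cu01 t : 0 <= \1_(@unit_cube R (nfree d l)) (rv t) :> R by [].
set s := [seq j : 'I_d <- index_enum 'I_d | (l <= j)%N].
pose Ec := C0 * T ^+ (d - 1).
have Ec0 : 0 <= Ec by rewrite mulr_ge0// exprn_ge0// ltW.
apply: (@le_trans _ _ (\int[lam (nfree d l)]_t
   ((2 * d%:R)%:E * (\sum_(j <- s) (\1_(@unit_cube R (nfree d l)) (rv t) * X j (rv t) ^+ 2)%:E) +
    (2 * Ec * \1_(@unit_cube R (nfree d l)) (rv t))%:E))%E).
  rewrite (eq_integral (fun t => (\1_(@unit_cube R (nfree d l)) (rv t) * (partial_count b T M d (rv t) - c) ^+ 2)%:E)); last first.
    move=> t _; rewrite indicE; have [tc|tc] := pselect (unit_cube (rv t)); last by rewrite memNset// !mul0r.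
    by rewrite remE// real_normK ?num_real.
  apply: ge0_le_integral => //.
  - by move=> t _; rewrite lee_fin mulr_ge0// sqr_ge0.
  - apply/measurable_EFinP; apply: measurable_funM => //; apply: measurable_funX.
    by apply: measurable_funB => //; exact: measurable_partial_count.
  - apply: emeasurable_funD.
      apply: emeasurable_funM => //; apply: emeasurable_sum => j.
      by apply/measurable_EFinP; apply: measurable_funM => //; exact: measurable_funX.
    by apply/measurable_EFinP; exact: measurable_funM.
  - move=> t _; rewrite sumEFin -EFinM -EFinD lee_fin -mulr_sumr.
    rewrite indicE; have [tc|tc] := pselect (unit_cube (rv t)); last by rewrite memNset// !mul0r !mulr0 addr0.
    rewrite mem_set// !mul1r mulr1 telE// /s big_filter.
    have h1 := sqr_sum_le (fun j : 'I_d => (l <= j)%N) (fun j => X j (rv t)); rewrite card_ord in h1.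
    have h2 := HC0 T M (rv t) T0 MT tc.
    move: h1 h2; rewrite -/Ec -/c; set x := \sum_(j < d | _) X j _; set y := partial_count _ _ _ _ _ - c.
    rewrite -mulrA; set z := d%:R * _ => h1 h2.
    have -> : (x + y) ^+ 2 = 2 * x ^+ 2 + 2 * y ^+ 2 - (x - y) ^+ 2 by ring.
    have := sqr_ge0 (x - y); lra.
rewrite ge0_integralD//=; last 4 first.
- by move=> t _; rewrite mule_ge0// sume_ge0// => j _; rewrite lee_fin mulr_ge0// sqr_ge0.
- apply: emeasurable_funM => //; apply: emeasurable_sum => j.
  by apply/measurable_EFinP; apply: measurable_funM => //; exact: measurable_funX.
- by move=> t _; rewrite lee_fin mulr_ge0// mulr_ge0.
- by apply/measurable_EFinP; exact: measurable_funM.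
have -> : (C2 : R) = C0 / ln 2 ^+ 2 by [].
rewrite ge0_integralZl_EFin//; last 2 first.
- by move=> t _; rewrite sume_ge0// => j _; rewrite lee_fin mulr_ge0// sqr_ge0.
- apply: emeasurable_sum => j.
  by apply/measurable_EFinP; apply: measurable_funM => //; exact: measurable_funX.
rewrite ge0_integral_sum//; last 2 first.
- by move=> j; apply/measurable_EFinP; apply: measurable_funM => //; exact: measurable_funX.
- by move=> j t _; rewrite lee_fin mulr_ge0// sqr_ge0.
under [X in (_ + X)%E]eq_integral do rewrite EFinM.
rewrite ge0_integralZl_EFin//; last 2 first.
- exact/measurable_EFinP.
- by rewrite mulr_ge0.
rewrite integral_row_indic ?vol_unit_cube ?mule1; last exact: borel_unit_cube.
pose L := T ^+ (d - 1) * ln T ^+ 2.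
have L0 : 0 <= L by rewrite mulr_ge0 ?sqr_ge0// exprn_ge0// ltW.
apply: (@le_trans _ _ ((2 * d%:R)%:E * (\sum_(j <- s) (C1 j * L)%:E) + (2 * (C2 * L))%:E)%E).
  apply: leeD.
    rewrite lee_wpmul2l ?lee_fin ?mulr_ge0// big_seq [leRHS]big_seq; apply: lee_sum => j.
    rewrite mem_filter => /andP[lj _]; have [_ /(_ lj T T2)] := C1P j.
    by rewrite /L mulrA.
  rewrite lee_fin ler_wpM2l// /Ec /C2 /L -mulrA ler_wpM2l//.
  rewrite mulrCA ler_peMr ?exprn_ge0 ?(ltW T0)//.
  rewrite mulrC ler_pdivlMr ?exprn_gt0// mul1r; apply: lerXn2r => //; rewrite nnegrE ltW//.
  exact: lt_le_trans lT.
rewrite sumEFin -EFinM -EFinD lee_fin -mulr_suml /s big_filter -[leRHS]mulrA -/L.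
have : \sum_(j < d | (l <= j)%N) C1 j <= \sum_j C1 j.
  by rewrite [leRHS](bigID (fun j : 'I_d => (l <= j)%N))/= lerDl sumr_ge0.
set s1 := \sum_(j < d | _) _; set s2 := \sum_j _ => ss.
have -> : 2 * d%:R * (s1 * L) + 2 * (C0 / ln 2 ^+ 2 * L) = (2 * (d%:R * s1 + C0 / ln 2 ^+ 2)) * L by ring.
by rewrite ler_wpM2r// ler_wpM2l// lerD2r ler_wpM2l.
Qed.

End final.

Theorem theorem2 (R : realType) (d : nat) (hd : (4 <= d)%N)
    (g : 'M[R]_d) (hg : g \in unitmx) :
  exists c : R, 0 < c /\
    forall T : R, 2 <= T ->
    forall l : nat, (1 <= l <= d./2)%N ->
      (integral_quotient l
         (fun u : 'M[R]_d =>
            (`|remainder (eball T) (Zlattice (u *m g))| ^+ 2)%:E)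
       <= (c * T ^+ (d - 1) * ln T ^+ 2)%:E)%E.
Proof.
have ex (l : nat) : exists C : R, 0 <= C /\ ((1 <= l <= d./2)%N -> forall T : R, 2 <= T ->
    (integral_quotient l
       (fun u : 'M[R]_d => (`|remainder (eball T) (Zlattice (u *m g))| ^+ 2)%:E)
     <= (C * T ^+ (d - 1) * ln T ^+ 2)%:E)%E).
  have [/andP[l0 ld]|_] := boolP (1 <= l <= d./2)%N; last by exists 0.
  case: l l0 ld => // n _ nd.
  by have [C C0 HC] := quotient_bound hg nd; exists C.
have [C CP] := choice ex.
have C0 l : 0 <= C l by have [] := CP l.
exists (1 + \sum_(l < d.+1) C l); split; first by rewrite ltr_pwDl// sumr_ge0.
move=> T T2 l ld; have [_ /(_ ld T T2)] := CP l; move/le_trans; apply.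
have T0 : 0 <= T by apply: le_trans T2.
have ldS : (l < d.+1)%N by clear -ld; lia.
rewrite lee_fin ler_wpM2r ?sqr_ge0// ler_wpM2r ?exprn_ge0//.
by rewrite (bigD1 (Ordinal ldS))//= addrCA lerDl addr_ge0// sumr_ge0.
Qed.
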